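(* There exist a constant $c'_{k+1}$ and, for every $\epsilon_0>0$, a constant $g'_{k+1}(\epsilon_0)>0$ such that the following holds. Let $A\subset\mathbb{Z}^k$ be finite and nonempty with $A=\widehat{\operatorname{co}}(A)$ and $A\subset B=B(n_1,\ldots,n_k;v_1,\ldots,v_k;b)$ with $v_1,\ldots,v_k$ linearly independent and $|A|\ge\epsilon_0|B|$, and let $f:A\to[0,1]$. Let $\widehat f:A\to[0,1]$ be the lower convex hull function of $f$. Then $$\sum_{x\in A}(f-\widehat f)(x)\le c'_{k+1}\Big(2^{k+1}\sum_{x\in A}f(x)-\sum_{x'\in A+A}f^{\square}(x')\Big)+g'_{k+1}(\epsilon_0)\min\{n_i\}^{-\frac{1}{1+\frac12k\lfloor(k+1)/2\rfloor}}|A|.$$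
   Context: $B(n_1,\ldots,n_k;v_1,\ldots,v_k;b)=\{b+\sum\ell_iv_i:0\le\ell_i<n_i\}$. $\widehat{\operatorname{co}}(A)=\widetilde{\operatorname{co}}(A)\cap\Lambda_A$ where $\widetilde{\operatorname{co}}(A)$ is the real convex hull and $\Lambda_A$ the affine sublattice of $\mathbb{Z}^k$ spanned by $A$. The infimum-convolution $f^{\square}:A+A\to\mathbb{R}$ is $f^{\square}(z)=\min_{x,y\in A,\,x+y=z}\{f(x)+f(y)\}$. The lower convex hull function $\widehat f$ is the restriction to $A$ of the largest convex function on $\widetilde{\operatorname{co}}(A)$ which is at most $f$ at every point of $A$. *)

(* Defs.v *)
From HB Require Import structures.
From mathcomp Require Import all_boot all_order all_algebra finmap.
From mathcomp Require Import all_classical all_reals all_analysis.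

Set Implicit Arguments.
Unset Strict Implicit.
Unset Printing Implicit Defensive.

Import Order.TTheory GRing.Theory Num.Theory.

Local Open Scope classical_set_scope.
Local Open Scope ring_scope.

(* A minimum only for nonempty s; minseq x0 [::] = x0 is a dummy value. *)
Definition minseq d (T : orderType d) (x0 : T) (s : seq T) : T :=
  \big[Order.min/head x0 s]_(x <- s) x.

Lemma minseqP d (T : orderType d) (x0 : T) (s : seq T) : s != [::] ->
  minseq x0 s \in s /\ (forall x, x \in s -> (minseq x0 s <= x)%O).
Proof.
case: s => // y s _; rewrite /minseq /=; split; last first.
  by move=> x xs; exact: ge_bigmin_seq.
rewrite big_seq; elim/big_ind: _ => // [|a b sa sb]; first exact: mem_head.
by rewrite minEle; case: ifP.
Qed.

(* B(n_1, ..., n_k; v_1, ..., v_k; b) *)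
Definition gap k (n : 'I_k -> nat) (v : 'I_k -> 'rV[int]_k) (b : 'rV[int]_k) :
    {fset 'rV[int]_k} :=
  [fset (b + \sum_(i < k) (l i)%:Z *: v i)%R
  | l : {dffun forall i, 'I_(n i)} in predT]%fset.

Definition sumset k (A : {fset 'rV[int]_k}) : {fset 'rV[int]_k} :=
  [fset (x + y)%R | x in A, y in A]%fset.

Section Hulls.
Variables (R : realType) (k : nat).
Implicit Types (A : {fset 'rV[int]_k}) (f : 'rV[int]_k -> R).

Definition to_real (z : 'rV[int]_k) : 'rV[R]_k := map_mx intr z.

Definition real_hull A : set 'rV[R]_k :=
  smallest (@convex_set R 'rV[R]_k) (to_real @` [set` A]).

Definition affine_lattice A : set 'rV[int]_k :=
  [set z | exists2 m : 'rV[int]_k -> int,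
             \sum_(a <- A) m a = 1 & z = \sum_(a <- A) m a *: a].

Definition discrete_hull A : set 'rV[int]_k :=
  [set z | real_hull A (to_real z) /\ affine_lattice A z].

(* Functions on A are total functions whose values outside A are never used;
   inf_conv A f z is meaningful for z in A + A only. *)
Definition inf_conv A f (z : 'rV[int]_k) : R :=
  minseq 0 [seq f p.1 + f p.2
           | p <- [seq (x, y) | x <- A, y <- A] & p.1 + p.2 == z].

Definition convex_minorant A f (g : 'rV[R]_k -> R) : Prop :=
  @convex_function R 'rV[R]_k (real_hull A) g /\
  {in A, forall x, g (to_real x) <= f x}.

Definition largest_convex_minorant A f (g : 'rV[R]_k -> R) : Prop :=
  convex_minorant A f g /\
  forall h, convex_minorant A f h -> forall x, real_hull A x -> h x <= g x.

Definition lower_convex_hull A f (fhat : 'rV[int]_k -> R) : Prop :=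
  exists2 g, largest_convex_minorant A f g &
    {in A, forall x, fhat x = g (to_real x)}.

Lemma real_hull_sub A x : x \in A -> real_hull A (to_real x).
Proof. by move=> xA; apply: sub_gen_smallest; exists x. Qed.

Lemma convex_real_hull A : @convex_set R 'rV[R]_k (real_hull A).
Proof.
move=> x y t; rewrite !inE => hx hy C [cC AC].
have := cC x y t; rewrite !inE; apply; [exact: hx|exact: hy].
Qed.

Lemma convex_minorant_ub A f : exists M : R, forall g, convex_minorant A f g ->
  forall x, real_hull A x -> g x <= M.
Proof.
exists (\sum_(a <- A) `|f a|) => g [cg gf] x.
set M := \sum_(a <- A) _.
suff sub : real_hull A `<=` [set y | real_hull A y /\ g y <= M].
  by move=> /sub[].
apply: smallest_sub => [y z t|_ [a /= aA <-]].
  rewrite !inE => -[hy gy] [hz gz]; split.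
    by have := @convex_real_hull A y z t; rewrite !inE; apply.
  have := cg t y z; rewrite !inE => /(_ hy hz) /le_trans; apply.
  rewrite convRE; apply: (@le_trans _ _ (t%:num * M + (1 - t%:num) * M)).
    by rewrite lerD// ler_wpM2l// subr_ge0.
  by rewrite -mulrDl addrC subrK mul1r.
split; first exact: real_hull_sub.
apply: (le_trans (gf a aA)); apply: (le_trans (ler_norm _)).
rewrite /M (big_rem a) //= lerDl; exact: sumr_ge0.
Qed.

Lemma lower_convex_hull_exists A f : exists fhat, lower_convex_hull A f fhat.
Proof.
pose S x := [set g x | g in convex_minorant A f].
have [M hM] := convex_minorant_ub A f.
have cst_minor : convex_minorant A f (fun=> - \sum_(a <- A) `|f a|).
  split; first by move=> t x y _ _; rewrite convmm.
  move=> x xA; rewrite lerNl; apply: (le_trans (ler_norm _)).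
  rewrite normrN (big_rem x) //= lerDl; exact: sumr_ge0.
have S0 x : S x !=set0 by exists (- \sum_(a <- A) `|f a|); eexists; first exact: cst_minor.
have Sub x : real_hull A x -> has_ubound (S x).
  by move=> hx; exists M => _ [g mg <-]; exact: hM.
pose g x := sup (S x).
have gub h x : convex_minorant A f h -> real_hull A x -> h x <= g x.
  by move=> mh hx; apply: ub_le_sup; [exact: Sub|exists h].
exists (g \o to_real), g => //; split=> [|h mh x hx]; last exact: gub.
split=> [t x y|x xA]; last first.
  by apply: ge_sup => // _ [h [_ hf] <-]; exact: hf.
rewrite !inE => hx hy; apply: ge_sup => // _ [h mh <-].
have [ch _] := mh; have := ch t x y; rewrite !inE => /(_ hx hy) /le_trans; apply.
rewrite !convRE lerD// ler_wpM2l ?subr_ge0//; exact: gub.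
Qed.

End Hulls.

(* Main.v *)
(* In coordinates given by a basis of the affine lattice, [A] is the set of all
   integer points of its convex hull. Optimal convex representations of points
   over [A], with ties broken lexicographically, have at most [k + 1] vertices
   and cut the hull into the relatively open cells of a triangulation on which
   the lower convex hull is affine. A point [W / p], [p > k + 1], of a cell has
   a vertex [a] of weight more than [1 / p]; passing from [(W, p)] to
   [(W - a, p - 1)] stays in the cell, so that descending from height [M] to
   height [k + 1] is a map with fibers of size at most [M ^ k], whereas the
   sums at the two heights scale as [M ^ (k + 1)] and [(k + 1) ^ (k + 1)]. For
   [M] large this contracts the total gap between [f] and its lower convex
   hull. Along the segment from [a] through [W / p], each step of the descent is
   a discrete convexity inequality whose error is a midpoint defect of [f], and
   the midpoint defects add up to the doubling deficit. All other errors come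
   from integer points close to the boundary of the hull, of which there are
   only [O(|A| / min n_i)]: this is better than the exponent of the theorem. *)
Require Import Defs.
From HB Require Import structures.
From mathcomp Require Import all_boot all_order all_algebra finmap.
From mathcomp Require Import all_classical all_reals all_analysis.
From mathcomp Require Import zify ring lra.

Set Implicit Arguments.
Unset Strict Implicit.
Unset Printing Implicit Defensive.

Import Order.TTheory GRing.Theory Num.Theory.

Local Open Scope classical_set_scope.
Local Open Scope ring_scope.

(** * Counting *)

(** The gap at [W / p] carries the factor [p] because [p * low (W / p)] is additive under the
    descent: a step loses exactly [f a]. The value at the starting node of the segment is the same
    [f a], so it cancels from the convexity inequality and only midpoint errors remain. The obstacle
    is that [f] lives on integer points only, so its values at rational points have to be simulated.
    All points get one common denominator [N], divisible by every [p (p + 1)] in use, and the value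
    at [m / N] is replaced by the mean of [f] over [N] integer roundings of [m / N]. The mean of
    these roundings is exactly [m / N], which makes the linear part of every local comparison
    cancel. The constant of the deficit depends on [k] only. The density enters through the size of
    a lattice basis, through the number of boundary points, and through the case where some [n_i] is
    bounded in terms of it; there a trivial estimate is enough. *)

Lemma ler_sum_seq (R : numDomainType) (I : eqType) (r : seq I) (F G : I -> R) :
  {in r, forall i, F i <= G i} -> \sum_(i <- r) F i <= \sum_(i <- r) G i.
Proof. by move=> FG; rewrite big_seq [leRHS]big_seq; apply: ler_sum. Qed.

Lemma sum_fiber (R : numDomainType) (T1 T2 : choiceType) (X : {fset T1})
    (Y : {fset T2}) (h : T1 -> T2) (F : T2 -> R) (B : nat) :
  {in Y, forall y, 0 <= F y} -> {in X, forall x, h x \in Y} ->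
  {in Y, forall y, (#|` [fset x in X | h x == y]%fset| <= B)%N} ->
  \sum_(x <- X) F (h x) <= B%:R * \sum_(y <- Y) F y.
Proof.
move=> F0 hXY hB.
have -> : \sum_(x <- X) F (h x) =
    \sum_(x <- X) \sum_(y <- Y) (if h x == y then F y else 0).
  apply: eq_big_seq => x xX.
  rewrite -big_mkcond /= (big_rem (h x)) ?hXY//= eqxx big1_seq ?addr0// => y.
  rewrite mem_rem_uniq ?fset_uniq// inE => /andP[/eqP ->] /andP[].
  by rewrite eqxx.
rewrite exchange_big mulr_sumr; apply: ler_sum_seq => y yY.
rewrite -big_mkcond/= big_const_seq iter_addr_0 -[leLHS]mulr_natl.
rewrite ler_wpM2r ?F0// ler_nat; apply: leq_trans (hB _ yY).
rewrite -size_filter; apply: uniq_leq_size.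
  by rewrite filter_uniq ?fset_uniq.
by move=> x; rewrite mem_filter !inE andbC.
Qed.

Lemma sum_inj_le (R : numDomainType) (T1 T2 : choiceType) (X : {fset T1})
    (Y : {fset T2}) (h : T1 -> T2) (F : T2 -> R) :
  {in Y, forall y, 0 <= F y} -> {in X, forall x, h x \in Y} ->
  {in X &, injective h} -> \sum_(x <- X) F (h x) <= \sum_(y <- Y) F y.
Proof.
move=> F0 hXY hi; rewrite -[leRHS]mul1r.
apply: (sum_fiber (B := 1) F0 hXY) => y yY.
have [->|[x]] := fset_0Vmem [fset x in X | h x == y]%fset.
  by rewrite cardfs0.
rewrite !inE => /andP[xX /eqP hx].
rewrite -(cardfs1 x); apply: fsubset_leq_card; apply/fsubsetP => x'.
rewrite !inE => /andP[x'X /eqP hx']; apply/eqP; apply: hi => //.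
by rewrite hx hx'.
Qed.

Lemma card_inj_le (T1 T2 : choiceType) (X : {fset T1}) (Y : {fset T2})
    (h : T1 -> T2) :
  {in X, forall x, h x \in Y} -> {in X &, injective h} ->
  (#|` X| <= #|` Y|)%N.
Proof.
move=> hXY hi; rewrite -(card_in_imfset imfset_key hi).
by apply: fsubset_leq_card; apply/fsubsetP => _ /imfsetP[x xX ->]; exact: hXY.
Qed.

Lemma sum_le_card (R : numDomainType) (T : choiceType) (X : {fset T}) (F : T -> R)
    (c : R) : {in X, forall x, F x <= c} -> \sum_(x <- X) F x <= c *+ #|` X|.
Proof.
move=> Fc; rewrite (@le_trans _ _ (\sum_(x <- X) c))//.
  by apply: ler_sum_seq => x xX; exact: Fc.
by rewrite big_const_seq count_predT iter_addr_0.
Qed.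

Definition int_box k (lo : 'I_k -> int) (L : 'I_k -> nat) : {fset 'rV[int]_k} :=
  [fset (\row_i (lo i + (l i)%:Z))%R | l : {dffun forall i, 'I_(L i)} in predT]%fset.

Lemma int_boxP k lo L (x : 'rV[int]_k) :
  reflect (forall i, lo i <= x 0 i < lo i + (L i)%:Z) (x \in int_box lo L).
Proof.
apply: (iffP idP) => [/imfsetP[l _ ->] i|xb].
  by rewrite mxE lerDl ltrD2l ltz_nat ltn_ord andbT.
have h i : (`|x 0%R i - lo i|%N < L i)%N by have := xb i; lia.
apply/imfsetP; exists (@finfun _ (fun i => 'I_(L i)) (fun i => Ordinal (h i))) => //=.
apply/rowP => i; rewrite mxE ffunE /=; have := xb i; lia.
Qed.

Lemma card_int_box k (lo : 'I_k -> int) (L : 'I_k -> nat) :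
  #|` int_box lo L| = (\prod_i L i)%N.
Proof.
rewrite card_imfset /=; last first.
  move=> l l' /rowP e; apply/ffunP => i; apply/val_inj => /=.
  by have := e i; rewrite !mxE => /addrI [].
rewrite -cardE card_dep_ffun foldrE big_map /index_enum /= -enumT big_enum /=.
by rewrite [RHS]big_enum; apply: eq_bigr => i _; rewrite card_ord.
Qed.

Lemma card_le_box (T : choiceType) k (X : {fset T}) (h : T -> 'rV[int]_k)
    (lo : 'I_k -> int) (L : 'I_k -> nat) :
  {in X &, injective h} ->
  {in X, forall x i, lo i <= h x 0 i < lo i + (L i)%:Z} ->
  (#|` X| <= \prod_i L i)%N.
Proof.
move=> hi hb; rewrite -(card_int_box lo L).
by apply: (card_inj_le (h := h)) => // x xX; apply/int_boxP => i; exact: hb.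
Qed.

Lemma sum_fset_split (R : nmodType) (T : choiceType) (X : {fset T}) (P : pred T)
    (F : T -> R) :
  \sum_(x <- X) F x = \sum_(x <- [fset x in X | P x]%fset) F x +
    \sum_(x <- [fset x in X | ~~ P x]%fset) F x.
Proof. by rewrite !big_fset /= (bigID P). Qed.

Lemma sum_fset_classes (R : nmodType) (T1 T2 : choiceType) (X : {fset T1})
    (E : {fset T2}) (h : T1 -> T2) (F : T1 -> R) :
  {in X, forall x, h x \in E} ->
  \sum_(x <- X) F x = \sum_(e <- E) \sum_(x <- [fset x in X | h x == e]%fset) F x.
Proof.
move=> hE; under [RHS]eq_bigr do rewrite big_fset big_mkcond /=.
rewrite exchange_big; apply: eq_big_seq => x xX /=.
rewrite -big_mkcond /= (big_rem (h x)) ?hE//= eqxx big1_seq ?addr0// => y.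
by rewrite mem_rem_uniq ?fset_uniq// inE => /andP[/eqP ->] /andP[]; rewrite eqxx.
Qed.

Lemma card_fiber_le (T1 T2 : choiceType) (X : {fset T1}) (Y : {fset T2})
    (h : T1 -> T2) (B : nat) : {in X, forall x, h x \in Y} ->
  {in Y, forall y, (#|` [fset x in X | h x == y]%fset| <= B)%N} ->
  (#|` X| <= B * #|` Y|)%N.
Proof.
move=> hXY hB; have := @sum_fiber int _ _ X Y h (fun=> 1) B (fun _ _ => ler01) hXY hB.
by rewrite !big_const_seq !count_predT !iter_addr_0 -[leLHS]/(#|` X|%:R) -[X in _ * X]/(#|` Y|%:R) -natrM ler_nat.
Qed.

Lemma card_inj_fin (T : choiceType) (J : finType) (X : {fset T}) (P : pred J)
    (h : T -> J) : {in X, forall x, P (h x)} -> {in X &, injective h} ->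
  (#|` X| <= #|P|)%N.
Proof.
move=> hP hi; rewrite cardE -(size_map h X); apply: uniq_leq_size.
  by rewrite map_inj_in_uniq ?fset_uniq.
by move=> _ /mapP[x xX ->]; rewrite mem_enum; exact: hP.
Qed.

Lemma sum_fiber_ge (R : numDomainType) (T1 T2 : choiceType) (X : {fset T1})
    (Y : {fset T2}) (h : T1 -> T2) (F : T2 -> R) (B : nat) :
  (forall y, 0 <= F y) ->
  {in Y, forall y, (B <= #|` [fset x in X | h x == y]%fset|)%N} ->
  B%:R * \sum_(y <- Y) F y <= \sum_(x <- X) F (h x).
Proof.
move=> F0 hB; rewrite (sum_fset_split _ (fun x => h x \in Y)).
rewrite -[leLHS]addr0 lerD ?sumr_ge0//.
rewrite (sum_fset_classes (E := Y) (h := h)); last first.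
  by move=> x; rewrite inE => /andP[].
rewrite mulr_sumr; apply: ler_sum_seq => y yY.
apply: (@le_trans _ _ (\sum_(x <- [fset x in X | h x == y]%fset) F y)).
  rewrite big_const_seq count_predT iter_addr_0 -[leRHS]mulr_natl.
  by rewrite ler_wpM2r// ler_nat hB.
have -> : [fset x in [fset x in X | h x \in Y] | h x == y]%fset =
    [fset x in X | h x == y]%fset.
  by apply/fsetP => x; rewrite !inE; case: eqP => [->|]; rewrite ?yY ?andbT ?andbF.
by apply: ler_sum_seq => x; rewrite inE => /andP[_ /eqP ->].
Qed.

(** * Optimal representations and the cells of a triangulation *)

Fixpoint lexneg (R : realDomainType) (s : seq R) : bool :=
  if s is x :: s' then (x < 0) || ((x == 0) && lexneg s') else false.

Lemma lexnegD (R : realDomainType) (J : Type) (F G : J -> R) (s : seq J) :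
  lexneg [seq F j | j <- s] -> lexneg [seq G j | j <- s] ->
  lexneg [seq F j + G j | j <- s].
Proof.
elim: s => //= j s ih /orP[F0|/andP[/eqP -> Fs]] /orP[G0|/andP[/eqP -> Gs]].
- by rewrite (ltr_wnDr (ltW G0) F0).
- by rewrite addr0 F0.
- by rewrite add0r G0.
- by rewrite addr0 eqxx ih ?orbT.
Qed.

Lemma lexnegZ (R : realDomainType) (J : Type) (F : J -> R) (t : R) (s : seq J) :
  0 < t -> lexneg [seq t * F j | j <- s] = lexneg [seq F j | j <- s].
Proof.
by move=> t0; elim: s => //= j s ->; rewrite pmulr_rlt0// mulf_eq0 gt_eqF.
Qed.

Lemma lexneg0 (R : realDomainType) (J : Type) (s : seq J) :
  lexneg [seq (0 : R) | j <- s] = false.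
Proof. by elim: s => //= j s ->; rewrite ltxx eqxx. Qed.

Lemma lexneg_total (R : realDomainType) (J : eqType) (F : J -> R) (s : seq J) :
  [\/ lexneg [seq F j | j <- s], lexneg [seq - F j | j <- s] |
      {in s, forall j, F j = 0}].
Proof.
elim: s => [|j s ih] /=; first by constructor 3.
case: (ltgtP (F j) 0) => [F0|F0|F0] /=; first by constructor 1.
  by constructor 2; rewrite oppr_lt0 F0.
case: ih => [h|h|h]; first by constructor 1.
  by constructor 2; rewrite F0 oppr0 eqxx h orbT.
by constructor 3 => i; rewrite inE => /predU1P[->//|]; exact: h.
Qed.

Section OptimalRepresentations.
Variables (R : realFieldType) (k : nat) (I : finType).
Variables (P : I -> 'rV[R]_k) (c : I -> R).
Implicit Types (q : 'rV[R]_k) (l d : {ffun I -> R}).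

Definition fscale (t : R) d : {ffun I -> R} := [ffun i => t * d i].

Definition is_rep q l :=
  [/\ forall i, 0 <= l i, \sum_i l i = 1 & \sum_i l i *: P i = q].

Definition is_dep d := \sum_i d i = 0 /\ \sum_i d i *: P i = 0.

(* Representations are compared by their cost first and then by their
   coefficients, which makes the optimal one unique. *)
Definition lex_coord d (o : option I) : R :=
  if o is Some i then d i else \sum_i d i * c i.

Definition lex_neg d :=
  lexneg [seq lex_coord d o | o <- None :: [seq Some i | i <- enum I]].

Lemma lex_negD d d' : lex_neg d -> lex_neg d' -> lex_neg (d + d').
Proof.
move=> h h'; have := lexnegD h h'; rewrite /lex_neg.
congr (lexneg _); apply: eq_map => -[i|] /=; first by rewrite !ffunE.
by rewrite -big_split; apply: eq_bigr => i _; rewrite !ffunE mulrDl.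
Qed.

Lemma lex_negZ t d : 0 < t -> lex_neg (fscale t d) = lex_neg d.
Proof.
move=> t0; rewrite /lex_neg -[RHS](lexnegZ _ _ t0).
congr (lexneg _); apply: eq_map => -[i|] /=; first by rewrite !ffunE.
by rewrite mulr_sumr; apply: eq_bigr => i _; rewrite !ffunE mulrA.
Qed.

Lemma lex_neg0 : lex_neg 0 = false.
Proof.
rewrite /lex_neg -[RHS](@lexneg0 R _ (None :: [seq Some i | i <- enum I])).
congr (lexneg _); apply: eq_map => -[i|] /=; first by rewrite !ffunE.
by apply: big1 => i _; rewrite !ffunE mul0r.
Qed.

Lemma lex_neg_total d : [\/ lex_neg d, lex_neg (- d) | d = 0].
Proof.
have [h|h|h] := lexneg_total (lex_coord d)
  (None :: [seq Some i | i <- enum I]).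
- by constructor 1.
- constructor 2; move: h; congr (lexneg _); apply: eq_map => -[i|] /=.
    by rewrite !ffunE.
  by rewrite -sumrN; apply: eq_bigr => i _; rewrite !ffunE mulNr.
- constructor 3; apply/ffunP => i; rewrite ffunE.
  by apply: (h (Some i)); rewrite inE /= map_f ?mem_enum.
Qed.

Lemma lex_neg_asym d : lex_neg d -> lex_neg (- d) -> False.
Proof. by move=> h /(lex_negD h); rewrite subrr lex_neg0. Qed.

Lemma lex_neg_cost d : lex_neg d -> \sum_i d i * c i <= 0.
Proof. by move=> /orP[/ltW//|/andP[/eqP /= ->]]. Qed.

Lemma rep_move q l d t : is_rep q l -> is_dep d ->
  (forall i, 0 <= l i + t * d i) -> is_rep q (l + fscale t d).
Proof.
move=> [l0 l1 lq] [d0 dP] h; split=> [i||]; first by rewrite !ffunE.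
  under eq_bigr do rewrite !ffunE.
  by rewrite big_split /= -mulr_sumr d0 mulr0 addr0.
under eq_bigr do rewrite !ffunE scalerDl -scalerA.
by rewrite big_split /= -scaler_sumr dP scaler0 addr0.
Qed.

(** Affine independence of the points that carry [l]. *)
Definition indep_supp l :=
  forall d, is_dep d -> (forall i, l i = 0 -> d i = 0) -> d = 0.

(** As [d] is nonzero with sum zero, it has a negative entry. Moving along [d] until the first
    coefficient vanishes keeps a representation, goes down lexicographically and loses a point of
    the support. *)
Lemma rep_shrink q l d : is_rep q l -> is_dep d ->
  (forall i, l i = 0 -> d i = 0) -> lex_neg d ->
  exists2 l', is_rep q l' /\ lex_neg (l' - l) &
    (#|[pred i | l' i != 0%R]| < #|[pred i | l i != 0%R]|)%N.
Proof.
move=> rl dd sd nd; have [l0 _ _] := rl; have [d0 _] := dd.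
have [i0 di0] : exists i, d i < 0.
  apply/existsP; apply: contraT; rewrite negb_exists => /forallP h.
  have dn0 i : 0 <= d i by rewrite leNgt; exact: h.
  have : d = 0.
    apply/ffunP => i; rewrite ffunE; apply/eqP.
    by have /eqP := d0; rewrite psumr_eq0// => /allP/(_ i (mem_index_enum _)).
  by move=> dz; move: nd; rewrite dz lex_neg0.
have [j dj jmin] := @Order.TotalTheory.arg_minP _ _ I i0 (fun i => d i < 0)
  (fun i => l i / - d i) di0.
pose t := l j / - d j.
have lj0 : 0 < l j.
  rewrite lt_def l0 andbT; apply/eqP => /sd dj0.
  by move: dj; rewrite dj0 ltxx.
have t0 : 0 < t by rewrite divr_gt0// oppr_gt0.
have lt0 i : 0 <= l i + t * d i.
  have [di|di] := ltP (d i) 0; last by rewrite addr_ge0// mulr_ge0// ltW.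
  have := jmin i di; rewrite -/t ler_pdivlMr ?oppr_gt0// mulrN.
  by rewrite -subr_ge0 opprK.
exists (l + fscale t d).
  split; first exact: rep_move.
  by rewrite addrAC subrr add0r lex_negZ.
apply: proper_card; apply/fintype.properP; split.
  apply/fintype.subsetP => i; rewrite !inE !ffunE; apply: contra => /eqP li.
  by rewrite li (sd _ li) mulr0 addr0.
exists j; first by rewrite !inE gt_eqF.
rewrite !inE !ffunE negbK /t invrN mulrN mulNr.
by rewrite mulfVK ?subrr// lt_eqF.
Qed.

Lemma rep_reduce q l : is_rep q l ->
  exists2 l', is_rep q l' /\ indep_supp l' & l' = l \/ lex_neg (l' - l).
Proof.
have [n] := ubnP #|[pred i | l i != 0]|; elim: n l => // n ih l ln rl.
have [il|/existsNP[d /not_implyP[dd /not_implyP[sd dn0]]]] := pselect (indep_supp l).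
  by exists l => //; left.
have [d' [dd' sd' nd']] : exists d',
    [/\ is_dep d', forall i, l i = 0 -> d' i = 0 & lex_neg d'].
  case: (lex_neg_total d) => [nd|nd|//]; first by exists d.
  exists (- d); split=> //; last by move=> i /sd; rewrite ffunE => ->; rewrite oppr0.
  case: dd => d0 dP; split.
    by under eq_bigr do rewrite ffunE; rewrite sumrN d0 oppr0.
  by under eq_bigr do rewrite ffunE scaleNr; rewrite sumrN dP oppr0.
have [l' [rl' nl'] cl'] := rep_shrink rl dd' sd' nd'.
have [l'' rl'' hl''] := ih l' (leq_trans cl' ln) rl'.
exists l'' => //; right; case: hl'' => [->//|h].
by rewrite -(subrKA l'); exact: lex_negD.
Qed.

Definition lex_opt q l :=
  is_rep q l /\ forall l', is_rep q l' -> l' = l \/ lex_neg (l - l').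

(** No compactness is involved: by [rep_reduce] only representations with independent support
    compete, there are finitely many supports, and an independent one carries at most one
    representation of [q]. The optimum is thus a minimum over supports. *)
Lemma lex_opt_exists q l0 : is_rep q l0 -> exists l, lex_opt q l /\ indep_supp l.
Proof.
move=> rl0.
pose supp l : {set I} := finset (fun i => l i != 0).
pose cand S : set {ffun I -> R} := [set l | [/\ is_rep q l, indep_supp l & supp l = S]].
pose F S := xget 0 (cand S).
pose ord : rel {ffun I -> R} := fun l l' => ~~ lex_neg (l' - l).
have [l1 [rl1 il1] _] := rep_reduce rl0.
have cs1 : `[< cand (supp l1) !=set0 >] by apply/asboolP; exists l1.
have ord_refl : reflexive ord by move=> l; rewrite /ord subrr lex_neg0.
have ord_tot : total ord.
  move=> l l'; rewrite /ord -negb_and; apply/negP => /andP[h1 h2].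
  by apply: (lex_neg_asym h1); rewrite opprB.
have ord_tr : transitive ord.
  move=> l' l l''; rewrite /ord => h1 h2; apply/negP => h3.
  have [h|h|h] := lex_neg_total (l' - l); first by rewrite h in h1.
    by move/negP: h2; apply; rewrite -(subrKA l); apply: lex_negD => //; rewrite -opprB.
  by move/negP: h2; apply; rewrite -(subrKA l) -(opprB l') h oppr0 addr0.
have [S /asboolP PS Smin] := @extremumP _ _ ord (supp l1)
  (fun S => `[< cand S !=set0 >]) F ord_refl ord_tr ord_tot cs1.
have [rS iS sS] : cand S (F S) by exact: (xgetPex 0 PS).
exists (F S); split=> //; split=> // l rl.
have [l' [rl' il'] ll'] := rep_reduce rl.
have cl' : cand (supp l') l' by split.
have PS' : `[< cand (supp l') !=set0 >] by apply/asboolP; exists l'.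
have [rS' iS' sS'] : cand (supp l') (F (supp l')) by apply: xgetPex; exists l'.
have El' : F (supp l') = l'.
  apply/eqP; rewrite -subr_eq0; apply/eqP; apply: il'.
    have [_ a1 aq] := rS'; have [_ b1 bq] := rl'.
    split; under eq_bigr do rewrite !ffunE ?scalerBl.
      by rewrite sumrB a1 b1 subrr.
    by rewrite sumrB aq bq subrr.
  move=> i li; rewrite !ffunE li subr0.
  have : i \notin supp (F (supp l')) by rewrite sS' finset.in_set li eqxx.
  by rewrite finset.in_set negbK => /eqP.
have := Smin _ PS'; rewrite El' /ord => /negP hS.
have [h|h|h] := lex_neg_total (F S - l').
- case: ll' => [<-|ll']; first by right.
  by right; rewrite -(subrKA l'); exact: lex_negD.
- by rewrite opprB in h; case: hS.
- have E : F S = l' by apply/eqP; rewrite -subr_eq0 h.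
  by rewrite E; case: ll' => [->|ll']; [left|right].
Qed.

Definition in_hull q := exists l, is_rep q l.

Definition opt_rep q : {ffun I -> R} := xget 0 [set l | lex_opt q l /\ indep_supp l].

Definition opt_cost q : R := \sum_i opt_rep q i * c i.

Lemma opt_repP q : in_hull q ->
  lex_opt q (opt_rep q) /\ indep_supp (opt_rep q).
Proof.
by case=> l rl; exact: (@xgetPex _ 0 [set l | lex_opt q l /\ indep_supp l]
  (lex_opt_exists rl)).
Qed.

Lemma opt_cost_min q l : is_rep q l -> opt_cost q <= \sum_i l i * c i.
Proof.
move=> rl; have [|[_ /(_ l rl) h] _] := @opt_repP q; first by exists l.
rewrite -subr_le0; rewrite /opt_cost; case: h => [->|/lex_neg_cost]; first by rewrite subrr.
rewrite -sumrB; congr (_ <= _).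
by apply: eq_bigr => i _; rewrite !ffunE mulrBl.
Qed.

(* The supports of optimal representations are the cells of a triangulation. *)
Lemma opt_rep_sub q q' l : in_hull q -> is_rep q' l ->
  (forall i, opt_rep q i = 0 -> l i = 0) -> opt_rep q' = l.
Proof.
move=> hq rl sl; have [[ro oo] _] := opt_repP hq.
have [|[ro' oo'] _] := @opt_repP q'; first by exists l.
case: (oo' _ rl) => [//|nl].
have [r0 r1 rq] := ro; have [r0' r1' rq'] := ro'; have [l0 l1 lq] := rl.
set d := opt_rep q' - l.
have dd : is_dep d.
  split; under eq_bigr do rewrite !ffunE ?scalerBl.
    by rewrite sumrB l1 r1' subrr.
  by rewrite sumrB lq rq' subrr.
have [i0 oi0] : exists i, opt_rep q i != 0.
  apply/existsP; apply: contraT; rewrite negb_exists => /forallP h.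
  move: (@oner_neq0 R); rewrite -r1 big1 ?eqxx// => i _.
  by apply/eqP; have := h i; rewrite negbK.
(* The step length [t] is the least nonzero coefficient of [opt_rep q]. Since [l] is at most 1 and
   lives on that support, adding [t] times [opt_rep q' - l] to [opt_rep q] still represents [q]; if
   [opt_rep q'] were better than [l], the sum would be better than [opt_rep q]. *)
have [j oj jmin] := @Order.TotalTheory.arg_minP _ _ I i0
  (fun i => opt_rep q i != 0) (opt_rep q) oi0.
set t := opt_rep q j in jmin.
have t0 : 0 < t by rewrite lt_def oj r0.
have l_le1 i : l i <= 1 by rewrite -l1 (bigD1 i)//= lerDl sumr_ge0.
have rt : is_rep q (opt_rep q + fscale t d).
  apply: rep_move => // i; rewrite !ffunE mulrBr.
  have [oi|oi] := eqVneq (opt_rep q i) 0.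
    by rewrite oi sl// mulr0 subr0 add0r mulr_ge0// ltW.
  rewrite addrCA addr_ge0// ?mulr_ge0// ?(ltW t0)// subr_ge0.
  by apply: le_trans (jmin i oi); rewrite ler_piMr// ltW.
have [/eqP|h] := oo _ rt.
  rewrite -subr_eq0 addrAC subrr add0r => /eqP dz0.
  have : lex_neg (fscale t d) by rewrite lex_negZ.
  by rewrite dz0 lex_neg0.
exfalso; apply: (lex_neg_asym h); rewrite opprB addrAC subrr add0r lex_negZ//.
Qed.

(** Carathéodory's bound: more than [k + 1] rows [(1, P i)] of length [k + 1] have a nonzero kernel
    vector, which is a dependence inside the support. *)
Lemma opt_rep_card q : in_hull q -> (#|[pred i | opt_rep q i != 0%R]| <= k.+1)%N.
Proof.
move=> hq; have [_ ind] := opt_repP hq.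
set S := [pred i | opt_rep q i != 0]; rewrite leqNgt; apply/negP => cS.
pose A : 'M[R]_(#|S|, 1 + k) := \matrix_(j < #|S|) row_mx 1 (P (enum_val j)).
have : kermx A != 0.
  rewrite kermx_eq0 -row_leq_rank -ltnNge.
  by apply: leq_ltn_trans (rank_leq_col A) _; rewrite add1n.
case/rowV0Pn => v /sub_kermxP vA /eqP vn0; apply: vn0.
pose d : {ffun I -> R} := [ffun i => \sum_(j | enum_val j == i) v 0 j].
have dsum (U : lmodType R) (F : I -> U) :
    \sum_i d i *: F i = \sum_j v 0 j *: F (enum_val j).
  under eq_bigr do rewrite ffunE scaler_suml.
  rewrite (exchange_big_dep xpredT)//=; apply: eq_bigr => j _.
  by rewrite (big_pred1 (enum_val j))// => i; rewrite eq_sym.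
have vA0 j : (v *m A) 0 j = 0 by rewrite vA mxE.
have d_dep : is_dep d.
  split.
    have := dsum R^o (fun=> 1); under eq_bigr do rewrite /GRing.scale/= mulr1.
    move=> ->; rewrite -[RHS](vA0 (lshift k ord0)) mxE; apply: eq_bigr => j _.
    by rewrite mxE row_mxEl mxE.
  rewrite dsum; apply/rowP => i; rewrite summxE [RHS]mxE -[RHS](vA0 (rshift 1 i)) [RHS]mxE.
by apply: eq_bigr => j _; rewrite mxE [A _ _]mxE row_mxEr.
have d0 : d = 0.
  apply: ind => // i oi; rewrite ffunE big1// => j /eqP ji.
  by have := enum_valP j; rewrite inE ji oi eqxx.
apply/rowP => j; rewrite mxE.
have /ffunP/(_ (enum_val j)) := d0; rewrite !ffunE (big_pred1 j)// => j' /=.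
by rewrite (inj_eq enum_val_inj) eq_sym.
Qed.

End OptimalRepresentations.

Section Hull.
Variables (R : realType) (k : nat) (A : {fset 'rV[int]_k}).
Variable (f : 'rV[int]_k -> R).
Implicit Types (q : 'rV[R]_k) (x y z m : 'rV[int]_k).

Definition vertex (a : A) : 'rV[R]_k := to_real R (val a).
Definition hull q := in_hull vertex q.
(** The lower convex hull as the least cost of a convex representation over [A]. It is linked to the
    notions of the statement by [real_hullP] and [lower_convex_hull_ge]. *)
Definition low q : R := opt_cost vertex (fun a : A => f (val a)) q.

Lemma to_realD x y : to_real R (x + y) = to_real R x + to_real R y.
Proof. by apply/rowP => i; rewrite !mxE intrD. Qed.

Lemma to_realB x y : to_real R (x - y) = to_real R x - to_real R y.
Proof. by apply/rowP => i; rewrite !mxE intrB. Qed.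

Lemma to_realZ (t : int) x : to_real R (t *: x) = t%:~R *: to_real R x.
Proof. by apply/rowP => i; rewrite !mxE intrM. Qed.

Lemma to_real_sum (J : Type) (r : seq J) (F : J -> 'rV[int]_k) :
  to_real R (\sum_(j <- r) F j) = \sum_(j <- r) to_real R (F j).
Proof. by apply/rowP => i; rewrite !mxE !summxE rmorph_sum; apply: eq_bigr => j _; rewrite mxE. Qed.

Lemma rep_vertex (a : A) : is_rep vertex (vertex a) [ffun b => (b == a)%:R].
Proof.
split=> [b||]; first by rewrite ffunE ler0n.
  rewrite (bigD1 a)//= ffunE eqxx big1 ?addr0// => b /negPf ba.
  by rewrite ffunE ba.
rewrite (bigD1 a)//= ffunE eqxx scale1r big1 ?addr0// => b /negPf ba.
by rewrite ffunE ba scale0r.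
Qed.

Lemma hull_mem x : x \in A -> hull (to_real R x).
Proof. by move=> xA; eexists; exact: (rep_vertex [` xA]%fset). Qed.

Lemma rep_comb (n : nat) (w : 'I_n -> R) (q : 'I_n -> 'rV[R]_k)
    (l : 'I_n -> {ffun A -> R}) :
  (forall j, 0 <= w j) -> \sum_j w j = 1 -> (forall j, is_rep vertex (q j) (l j)) ->
  is_rep vertex (\sum_j w j *: q j) [ffun a => \sum_j w j * l j a].
Proof.
move=> w0 w1 rl; split=> [a||].
- by rewrite ffunE sumr_ge0// => j _; rewrite mulr_ge0//; case: (rl j).
- under eq_bigr do rewrite ffunE.
  rewrite exchange_big -[RHS]w1; apply: eq_bigr => j _.
  by rewrite -mulr_sumr; case: (rl j) => _ -> _; rewrite mulr1.
- under eq_bigr do rewrite ffunE scaler_suml.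
  rewrite exchange_big; apply: eq_bigr => j _.
  case: (rl j) => _ _ <-; rewrite scaler_sumr; apply: eq_bigr => a _.
  by rewrite scalerA.
Qed.

Lemma hull_comb (n : nat) (w : 'I_n -> R) (q : 'I_n -> 'rV[R]_k) :
  (forall j, 0 <= w j) -> \sum_j w j = 1 -> (forall j, hull (q j)) ->
  hull (\sum_j w j *: q j) /\ low (\sum_j w j *: q j) <= \sum_j w j * low (q j).
Proof.
move=> w0 w1 hq.
have rl j : is_rep vertex (q j) (opt_rep vertex (fun a : A => f (val a)) (q j)).
  by have [[]] := opt_repP (fun a : A => f (val a)) (hq j).
have rc := rep_comb w0 w1 rl; split; first by eexists; exact: rc.
apply: le_trans (opt_cost_min _ rc) _.
under eq_bigr do rewrite ffunE mulr_suml.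
rewrite exchange_big; rewrite le_eqVlt; apply/predU1P; left; apply: eq_bigr => j _ /=.
by rewrite mulr_sumr; apply: eq_bigr => a _; rewrite mulrA.
Qed.

Lemma hull_mid q q' : hull q -> hull q' -> hull (2^-1 *: (q + q')) /\
  2 * low (2^-1 *: (q + q')) <= low q + low q'.
Proof.
move=> hq hq'.
have [|||h1 h2] := @hull_comb 2 (fun=> 2^-1) (fun j => if j == 0 then q else q').
- by move=> _; rewrite invr_ge0.
- by rewrite !big_ord_recl big_ord0; lra.
- by move=> j; case: ifP.
move: h1 h2; rewrite !big_ord_recl !big_ord0 /= !addr0 scalerDr => h1 h2.
by split=> //; move: h2; lra.
Qed.

Lemma low_le x : x \in A -> low (to_real R x) <= f x.
Proof.
move=> xA; have := opt_cost_min (fun a : A => f (val a)) (rep_vertex [` xA]%fset).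
move=> /le_trans; apply; rewrite (bigD1 [` xA]%fset)//= ffunE eqxx mul1r.
by rewrite big1 ?addr0// => b /negPf ba; rewrite ffunE ba mul0r.
Qed.

Lemma low_ge0 q : (forall x, 0 <= f x) -> hull q -> 0 <= low q.
Proof.
move=> f0 hq; have [[[l0 _ _] _] _] := opt_repP (fun a : A => f (val a)) hq.
by apply: sumr_ge0 => a _; rewrite mulr_ge0.
Qed.

Lemma low_le1 q : (forall x, f x <= 1) -> hull q -> low q <= 1.
Proof.
move=> f1 hq; have [[[l0 l1 _] _] _] := opt_repP (fun a : A => f (val a)) hq.
by rewrite -l1; apply: ler_sum => a _; rewrite ler_piMr.
Qed.

Lemma hull_bound q i : hull q ->
  `|q 0 i| <= (\sum_(a <- A) `|a 0%R i|%N)%:R.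
Proof.
move=> [l [l0 l1 <-]]; rewrite summxE; apply: le_trans (ler_norm_sum _ _ _) _.
rewrite -[leRHS]mul1r -{1}l1 mulr_suml; apply: ler_sum => a _.
rewrite mxE normrM ger0_norm//; apply: ler_wpM2l => //.
rewrite mxE -intr_norm -natr_absz.
by rewrite ler_nat (big_rem (val a)) ?fsvalP//= leq_addr.
Qed.
End Hull.

(** * Rounding rational points to integer points *)

(** Passing from [x] to [x + 1] shifts the summands by one place: [x %/ N] drops out and
    [(x + N) %/ N], which is larger by 1, comes in. So both sides grow alike. *)
Lemma hermite_identity (N : nat) (x : int) : (0 < N)%N ->
  \sum_(j < N) ((x + j%:Z) %/ N%:Z)%Z = x.
Proof.
case: N => // n _; pose S (y : int) := \sum_(j < n.+1) ((y + j%:Z) %/ n.+1%:Z)%Z.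
have SS y : S (y + 1) = S y + 1.
  have e : ((y + 1 + n%:Z) %/ n.+1%:Z)%Z = (y %/ n.+1%:Z)%Z + 1.
    by rewrite -addrA -intS divzDr ?dvdzz// divzz.
  rewrite /S big_ord_recr [in RHS]big_ord_recl /= addr0 e.
  rewrite [in RHS]addrAC [in RHS]addrC [in LHS]addrA [in RHS]addrA; congr (_ + _ + _).
  by apply: eq_bigr => j _; congr (divz _ _); rewrite /bump leq0n intS addrA.
rewrite -[LHS]/(S x); elim/int_rect: x => [|m ih|m ih].
- by apply: big1 => j _; rewrite add0r divz_small// ltz_nat ltn_ord.
- by rewrite -addn1 PoszD SS ih.
- by apply: (@addIr _ 1); rewrite -SS; move: ih; rewrite -addn1 PoszD opprD addrNK.
Qed.

Section Rounding.
Variables (R : realType) (k : nat) (N : nat).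
Hypothesis N_gt0 : (0 < N)%N.
Implicit Types (m y p : 'rV[int]_k).

(* By Hermite's identity the points [rounding m j], [j < N], have mean [m / N]. *)
Definition rounding m (j : nat) : 'rV[int]_k := \row_i ((m 0%R i + j%:Z) %/ N%:Z)%Z.

Definition cell m := rounding m 0.

Definition scaled (n : nat) m : 'rV[R]_k := n%:R^-1 *: to_real R m.

(** Stands in for the value at the rational point [m / N] of a function that is given on integer
    points only. *)
Definition rounding_mean (h : 'rV[int]_k -> R) m : R := N%:R^-1 * \sum_(j < N) h (rounding m j).

Lemma sum_rounding m : \sum_(j < N) rounding m j = m.
Proof.
apply/rowP => i; rewrite summxE -[RHS](hermite_identity _ N_gt0).
by apply: eq_bigr => j _; rewrite mxE.
Qed.

Lemma scaled_rounding m : scaled N m = \sum_(j < N) N%:R^-1 *: to_real R (rounding m j).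
Proof. by rewrite -scaler_sumr -to_real_sum sum_rounding. Qed.

Lemma rounding_cell m (j : nat) i : (j < N)%N ->
  cell m 0 i <= rounding m j 0 i <= cell m 0 i + 1.
Proof. by move=> jN; rewrite !mxE; nia. Qed.

Lemma sumN1 : \sum_(j < N) (N%:R^-1 : R) = 1.
Proof.
by rewrite sumr_const card_ord -[LHS]mulr_natl divff// pnatr_eq0 -lt0n.
Qed.

Lemma rounding_mean_ge0 h m : (forall x, 0 <= h x) -> 0 <= rounding_mean h m.
Proof. by move=> h0; rewrite mulr_ge0 ?invr_ge0 ?sumr_ge0. Qed.

Lemma rounding_mean_le1 h m : (forall x, h x <= 1) -> rounding_mean h m <= 1.
Proof. by move=> h1; rewrite /rounding_mean mulr_sumr -[leRHS]sumN1; apply: ler_sum => j _; rewrite ler_piMr ?invr_ge0. Qed.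

Lemma roundingZ m j : (j < N)%N -> rounding (N%:Z *: m) j = m.
Proof.
move=> jN; apply/rowP => i; rewrite !mxE mulrC divzMDl; last by lia.
by rewrite divz_small ?addr0//; lia.
Qed.

Lemma rounding_meanZ h m : rounding_mean h (N%:Z *: m) = h m.
Proof.
rewrite /rounding_mean; under eq_bigr do rewrite roundingZ//.
by rewrite mulr_sumr -mulr_suml sumN1 mul1r.
Qed.

Lemma scaled_cell m i : `|scaled N m 0 i - (cell m 0 i)%:~R| <= 1.
Proof.
have N0 : 0 < N%:R :> R by rewrite ltr0n.
rewrite !mxE addr0 -(ler_pM2l N0) mulr1 -[X in X * _ <= _](gtr0_norm N0) -normrM.
rewrite mulrBr mulrA divff ?gt_eqF// mul1r -[N%:R]/(N%:Z%:~R) -intrM -intrB.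
rewrite -intr_norm ler_int; nia.
Qed.

Lemma scaledM n d m : (0 < d)%N -> scaled (n * d) (d%:Z *: m) = scaled n m.
Proof.
move=> d0; rewrite /scaled to_realZ scalerA natrM invfM -mulrA mulVf ?mulr1//.
by rewrite pnatr_eq0 -lt0n.
Qed.

Section Hull.
Variables (A : {fset 'rV[int]_k}) (f : 'rV[int]_k -> R).

Lemma hull_rounding m : (forall j, (j < N)%N -> rounding m j \in A) ->
  hull A (scaled N m) /\ low A f (scaled N m) <= rounding_mean (fun x => low A f (to_real R x)) m.
Proof.
move=> hA; rewrite scaled_rounding /rounding_mean mulr_sumr.
apply: hull_comb => [j||j]; [by rewrite invr_ge0|exact: sumN1|].
by apply: hull_mem; exact: hA.
Qed.
End Hull.
End Rounding.

(** * Midpoint defects *)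

(** However large [L] is, half the sum of the two roundings stays close to the cell of [M]: its
    floor and its ceiling are within distance 2. *)
Lemma div_midpoint (N : nat) (M L : int) (j : nat) : (j < N)%N ->
  -1 <= ((M + L + j%:Z) %/ N%:Z)%Z + ((M - L + j%:Z) %/ N%:Z)%Z
    - 2 * (M %/ N%:Z)%Z <= 3.
Proof.
move=> jN; have N0 : 0 < N%:Z by lia.
have := divz_eq (M + L + j%:Z) N%:Z; have := divz_eq (M - L + j%:Z) N%:Z.
have := divz_eq M N%:Z; have := ltz_pmod (M + L + j%:Z) N0.
have := ltz_pmod (M - L + j%:Z) N0; have := ltz_pmod M N0.
have := modz_ge0 (M + L + j%:Z) (lt0r_neq0 N0).
have := modz_ge0 (M - L + j%:Z) (lt0r_neq0 N0).
have := modz_ge0 M (lt0r_neq0 N0).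
set q1 := ((M + L + j%:Z) %/ N%:Z)%Z; set q2 := ((M - L + j%:Z) %/ N%:Z)%Z.
set q3 := (M %/ N%:Z)%Z.
set r1 := ((M + L + j%:Z) %% N%:Z)%Z; set r2 := ((M - L + j%:Z) %% N%:Z)%Z.
set r3 := (M %% N%:Z)%Z.
move=> r3p r2p r1p r3N r2N r1N e3 e2 e1.
have e : (q1 + q2 - 2 * q3) * N%:Z = 2 * r3 + 2 * j%:Z - r1 - r2 by lia.
apply/andP; split.
  by rewrite -ltzD1 -(ltr_pM2r N0) mulrDl e; lia.
by rewrite -ltzD1 -(ltr_pM2r N0) e; lia.
Qed.

Section LocalDefects.
Variables (R : realType) (k : nat) (A : {fset 'rV[int]_k}).
Variable (f : 'rV[int]_k -> R).
Hypotheses (f_ge0 : forall x, 0 <= f x) (f_le1 : forall x, f x <= 1).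
Implicit Types (q : 'rV[R]_k) (x y z a b p : 'rV[int]_k).

Lemma mem_sumset x y : x \in A -> y \in A -> x + y \in sumset A.
Proof. by move=> xA yA; apply/imfset2P; exists x => //; exists y. Qed.

Lemma sumsetP z : z \in sumset A -> exists x y, [/\ x \in A, y \in A & z = x + y].
Proof. by case/imfset2P => x xA [y yA ->]; exists x, y. Qed.

Let pairs z := [seq f w.1 + f w.2
  | w <- [seq (x, y) | x <- A, y <- A] & w.1 + w.2 == z].

Let pairsP z v : v \in pairs z ->
  exists x y, [/\ x \in A, y \in A, x + y = z & v = f x + f y].
Proof.
case/mapP => -[x y]; rewrite mem_filter /= => /andP[/eqP xyz].
case/allpairsP => -[x1 y1] /= [xA yA [ex ey]] ->.
by exists x1, y1; split=> //; rewrite -?ex -?ey.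
Qed.

Let mem_pairs x y : x \in A -> y \in A -> f x + f y \in pairs (x + y).
Proof.
move=> xA yA; apply/mapP; exists (x, y) => //.
by rewrite mem_filter /= eqxx; apply/allpairsP; exists (x, y); split.
Qed.

Lemma inf_conv_le x y : x \in A -> y \in A -> inf_conv A f (x + y) <= f x + f y.
Proof.
move=> xA yA; have h := mem_pairs xA yA.
have n0 : pairs (x + y) != [::] by case: (pairs _) h.
by have [_] := minseqP 0 n0; apply.
Qed.

Lemma inf_conv_attained z : z \in sumset A ->
  exists x y, [/\ x \in A, y \in A, x + y = z & inf_conv A f z = f x + f y].
Proof.
case/sumsetP => x [y [xA yA ->]]; have h := mem_pairs xA yA.
have n0 : pairs (x + y) != [::] by case: (pairs _) h.
by have [/pairsP] := minseqP 0 n0.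
Qed.

Lemma inf_conv_ge0 z : z \in sumset A -> 0 <= inf_conv A f z.
Proof. by case/inf_conv_attained => x [y [_ _ _ ->]]; rewrite addr_ge0. Qed.

Lemma inf_conv_le2 z : z \in sumset A -> inf_conv A f z <= 2.
Proof. by case/inf_conv_attained => x [y [_ _ _ ->]]; rewrite -[2]/(1 + 1) lerD. Qed.

(* The radius 3 leaves room for the roundings of a point and of its halves,
   which are within distance 2 of its cell. *)
Definition neighborhood y : {fset 'rV[int]_k} := int_box (fun i => y 0 i - 3) (fun=> 7%N).

Lemma neighborhoodP y p : reflect (forall i, `|p 0 i - y 0 i| <= 3) (p \in neighborhood y).
Proof.
by apply: (iffP (int_boxP _ _ _)) => h i; have := h i; lia.
Qed.

Definition good y := (neighborhood y `<=` A)%fset.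

Lemma goodP y p : good y -> (forall i, `|p 0 i - y 0 i| <= 3) -> p \in A.
Proof. by move=> /fsubsetP gy /neighborhoodP; exact: gy. Qed.

Lemma good_mem y : good y -> y \in A.
Proof. by move/goodP; apply => i; rewrite subrr. Qed.

(** Membership in [A] would be too narrow: the cells of rational points of the hull, and the rounded
    halves of points of [A + A], may fall outside [A] and still have to be counted. *)
Definition touches y := exists2 q : 'rV[R]_k, hull A q & forall i, `|q 0 i - (y 0 i)%:~R| <= 3.

Definition bad y := ~~ good y /\ touches y.

Definition defect x y : R := f x + f y - inf_conv A f (x + y).

Definition total_defect y : R :=
  \sum_(a <- neighborhood y) \sum_(b <- neighborhood y) defect a b.

Lemma defect_ge0 x y : x \in A -> y \in A -> 0 <= defect x y.
Proof. by move=> xA yA; rewrite subr_ge0 inf_conv_le. Qed.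

Lemma good_defect_ge0 y a b : good y -> a \in neighborhood y -> b \in neighborhood y ->
  0 <= defect a b.
Proof. by move=> /fsubsetP gy ay yb; rewrite defect_ge0// gy. Qed.

Lemma total_defect_ge0 y : good y -> 0 <= total_defect y.
Proof.
move=> gy; rewrite /total_defect big_seq; apply: sumr_ge0 => a ay.
by rewrite big_seq; apply: sumr_ge0 => b yb; exact: good_defect_ge0 gy _ _.
Qed.

Lemma defect_le_total y a b : good y -> a \in neighborhood y -> b \in neighborhood y ->
  defect a b <= total_defect y.
Proof.
move=> gy ay yb; rewrite /total_defect (big_rem a)//= (big_rem b)//=.
rewrite -addrA lerDl addr_ge0//.
  rewrite big_seq; apply: sumr_ge0 => b' /mem_rem b'y.
  exact: good_defect_ge0 gy _ _.
rewrite big_seq; apply: sumr_ge0 => a' /mem_rem a'y.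
rewrite big_seq; apply: sumr_ge0 => b' b'y.
exact: good_defect_ge0 gy _ _.
Qed.

(** Both pairs compete in the same infimum: the first exceeds it by at most the total defect, the
    second bounds it from above. *)
Lemma four_points y a b c d : good y -> a \in neighborhood y -> b \in neighborhood y ->
  c \in neighborhood y -> d \in neighborhood y -> a + b = c + d ->
  f a + f b <= f c + f d + total_defect y.
Proof.
move=> gy ay yb cy dy e; have /fsubsetP sA := gy.
have := defect_le_total gy ay yb; rewrite /defect e.
have := inf_conv_le (sA _ cy) (sA _ dy); lra.
Qed.

Definition slope y (v : 'rV[int]_k) : R :=
  \sum_i (v 0 i)%:~R * (f (y + delta_mx 0 i) - f y).

Lemma slopeD y v w : slope y (v + w) = slope y v + slope y w.
Proof.
by rewrite -big_split; apply: eq_bigr => i _; rewrite mxE intrD mulrDl.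
Qed.

Lemma slope0 y : slope y 0 = 0.
Proof. by apply: big1 => i _; rewrite mxE mul0r. Qed.

Lemma slope_sum y (J : Type) (r : seq J) (v : J -> 'rV[int]_k) :
  slope y (\sum_(j <- r) v j) = \sum_(j <- r) slope y (v j).
Proof.
elim: r => [|j r ih]; first by rewrite !big_nil slope0.
by rewrite !big_cons slopeD ih.
Qed.

Lemma slope_delta y i : slope y (delta_mx 0 i) = f (y + delta_mx 0 i) - f y.
Proof.
rewrite /slope (bigD1 i)//= mxE !eqxx mul1r big1 ?addr0// => j ji.
by rewrite mxE (negPf ji) andbF mul0r.
Qed.

(* Two pairs of nearby points with the same sum have almost the same sum of
   values, by [four_points]; hence the increments of [f] hardly depend on the
   base point. *)
Lemma locally_affine y p : good y -> (forall i, `|p 0 i - y 0 i| <= 2) ->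
  `|f p - (f y + slope y (p - y))| <= (k * 2)%:R * total_defect y.
Proof.
move=> gy.
have U0 := total_defect_ge0 gy.
have [n] := ubnP (\sum_i `|(p 0 i - y 0 i)%R|)%N.
have dE i j : (delta_mx 0 i : 'rV[int]_k) 0 j = (j == i)%:Z by rewrite mxE eqxx; case: eqP.
have step p' i : (forall j, `|p' 0 j - y 0 j| <= 2) ->
    (forall j, `|(p' + delta_mx 0 i) 0 j - y 0 j| <= 2) ->
    `|f (p' + delta_mx 0 i) - f p' - (f (y + delta_mx 0 i) - f y)| <= total_defect y.
  move=> h1 h2.
  have n1 : p' + delta_mx 0 i \in neighborhood y by apply/neighborhoodP => j; exact: le_trans (h2 j) _.
  have n2 : p' \in neighborhood y by apply/neighborhoodP => j; exact: le_trans (h1 j) _.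
  have n3 : y \in neighborhood y by apply/neighborhoodP => j; rewrite subrr.
  have n4 : y + delta_mx 0 i \in neighborhood y.
    by apply/neighborhoodP => j; rewrite mxE addrAC subrr add0r dE; case: eqP.
  have e : p' + delta_mx 0 i + y = p' + (y + delta_mx 0 i) by rewrite -addrA (addrC y).
  have := four_points gy n1 n3 n2 n4 e; have := four_points gy n2 n4 n1 n3 (esym e).
  by rewrite ler_norml; lra.
(* Induction on the l1 distance from [p] to [y]: a unit step towards [y] in one coordinate stays
   within distance 2 and costs one [total_defect]. The distance is at most [2 k]. *)
suff H : forall p, (\sum_i `|(p 0 i - y 0 i)%R| < n)%N ->
    (forall i, `|p 0 i - y 0 i| <= 2) ->
    `|f p - (f y + slope y (p - y))| <= (\sum_i `|(p 0 i - y 0 i)%R|)%N%:R * total_defect y.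
  move=> hn pn; apply: le_trans (H p hn pn) _.
  rewrite ler_wpM2r// ler_nat -[X in (X * _)%N]card_ord -sum_nat_const.
  by apply: leq_sum => i _; have := pn i; lia.
elim: n => // n ih {}p hn pn.
have [->|/eqP py] := eqVneq p y.
  by rewrite subrr slope0 addr0 subrr normr0 mulr_ge0.
have [i pi] : exists i, p 0 i != y 0 i.
  apply/existsP; apply: contraT; rewrite negb_exists => /forallP h.
  by case: py; apply/rowP => i; have := h i; rewrite negbK => /eqP.
have [lt_yp|lt_py] : y 0 i < p 0 i \/ p 0 i < y 0 i.
  by move: pi; rewrite neq_lt => /orP[]; [right|left].
- pose p' := p - delta_mx 0 i.
  have pE : p = p' + delta_mx 0 i by rewrite /p' subrK.
  have p'E j : p' 0 j = p 0 j - (j == i)%:Z by rewrite /p' mxE [in X in _ + X]mxE dE.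
  have p'n j : `|p' 0 j - y 0 j| <= 2.
    by rewrite p'E; have := pn j; case: eqP => [->|_] /=; lia.
  have sE : (\sum_i `|(p 0 i - y 0 i)%R| = (\sum_i `|(p' 0 i - y 0 i)%R|).+1)%N.
    rewrite (bigD1 i)//= [in RHS](bigD1 i)//= -addSn; congr (_ + _)%N.
      by rewrite p'E eqxx; lia.
    by apply: eq_bigr => j ji; rewrite p'E (negPf ji) subr0.
  rewrite sE in hn *; have := ih p' hn p'n.
  have := step p' i p'n; rewrite -pE => /(_ pn).
  have -> : slope y (p - y) = slope y (p' - y) + (f (y + delta_mx 0 i) - f y).
    by rewrite -slope_delta -slopeD {1}pE addrAC.
  rewrite -natr1 mulrDl mul1r !ler_norml; lra.
- pose p' := p + delta_mx 0 i.
  have p'E j : p' 0 j = p 0 j + (j == i)%:Z by rewrite /p' mxE dE.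
  have p'n j : `|p' 0 j - y 0 j| <= 2.
    by rewrite p'E; have := pn j; case: eqP => [->|_] /=; lia.
  have sE : (\sum_i `|(p 0 i - y 0 i)%R| = (\sum_i `|(p' 0 i - y 0 i)%R|).+1)%N.
    rewrite (bigD1 i)//= [in RHS](bigD1 i)//= -addSn; congr (_ + _)%N.
      by rewrite p'E eqxx; lia.
    by apply: eq_bigr => j ji; rewrite p'E (negPf ji) addr0.
  rewrite sE in hn *; have := ih p' hn p'n.
  have := step p i pn p'n; rewrite -/p'.
  have -> : slope y (p' - y) = slope y (p - y) + (f (y + delta_mx 0 i) - f y).
    by rewrite -slope_delta -slopeD /p' addrAC.
  rewrite -natr1 mulrDl mul1r !ler_norml; lra.
Qed.

Section Midpoint.
Variable N : nat.
Hypothesis N_gt0 : (0 < N)%N.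

(** The roundings of [m + l] and [m - l] may be far from the cell, but [inf_conv] sees only their
    sum [z j], which is also the sum of two points [a j], [b j] near the cell, where [f] is affine
    up to defects. The factor [1 + 8 k] is one defect of [(a j, b j)] plus four uses of
    [locally_affine], each costing [2 k]. *)
Lemma midpoint m (l : 'rV[int]_k) : good (cell N m) ->
  (forall j, (j < N)%N -> rounding N (m + l) j \in A) ->
  (forall j, (j < N)%N -> rounding N (m - l) j \in A) ->
  2 * rounding_mean N f m <= rounding_mean N f (m + l) + rounding_mean N f (m - l) +
    (1 + 8 * k)%:R * total_defect (cell N m).
Proof.
move=> gm gp gq; set y := cell N m; set U := total_defect y.
have U0 : 0 <= U by exact: total_defect_ge0.
pose z j : 'rV[int]_k := rounding N (m + l) j + rounding N (m - l) j.
pose a j : 'rV[int]_k := \row_i (z j 0%R i %/ 2)%Z.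
pose b j : 'rV[int]_k := z j - a j.
have abz j : a j + b j = z j by rewrite /b addrC subrK.
have an j i : (j < N)%N -> `|a j 0 i - y 0 i| <= 2 /\ `|b j 0 i - y 0 i| <= 2.
  move=> jN; have := div_midpoint (m 0 i) (l 0 i) jN.
  by rewrite /b /a /y /cell /z !mxE addr0 /=; lia.
have yn j i : (j < N)%N -> `|rounding N m j 0 i - y 0 i| <= 2.
  by move=> jN; have := rounding_cell N_gt0 m i jN; rewrite -/y; lia.
pose B : R := (k * 2)%:R * U.
have fz j : (j < N)%N -> 2 * f y + slope y (a j - y) + slope y (b j - y) - 2 * B - U <=
    f (rounding N (m + l) j) + f (rounding N (m - l) j).
  move=> jN; have := inf_conv_le (gp j jN) (gq j jN); rewrite -/(z j).
  have aB := locally_affine gm (fun i => (an j i jN).1).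
  have bB := locally_affine gm (fun i => (an j i jN).2).
  have : defect (a j) (b j) <= U.
    apply: defect_le_total => //; apply/neighborhoodP => i; have [h1 h2] := an j i jN.
      exact: le_trans h1 _.
    exact: le_trans h2 _.
  rewrite /defect abz; move: aB bB; rewrite !ler_norml -/U -/B -/y; lra.
have fr j : (j < N)%N -> f (rounding N m j) <= f y + slope y (rounding N m j - y) + B.
  move=> jN; have := locally_affine gm (fun i => yn j i jN).
  rewrite !ler_norml -/U -/B -/y; lra.
have N0 : 0 < N%:R :> R by rewrite ltr0n.
rewrite -(ler_pM2l N0) /rounding_mean.
have e (t : R) : N%:R * (N%:R^-1 * t) = t by rewrite mulrA divff ?mul1r// gt_eqF.
rewrite 2!mulrDr !e mulrCA e -big_split /=.
have S1 : \sum_(j < N) f (rounding N m j) <=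
    \sum_(j < N) (f y + slope y (rounding N m j - y) + B).
  by apply: ler_sum => j _; exact: fr.
have S2 : \sum_(j < N) (2 * f y + slope y (a j - y) + slope y (b j - y) - 2 * B - U) <=
    \sum_(j < N) (f (rounding N (m + l) j) + f (rounding N (m - l) j)).
  by apply: ler_sum => j _; exact: fz.
(* The linear terms agree exactly because the roundings of [m + l], [m - l] and [m] sum to these
   vectors, by [sum_rounding]. *)
have sl : \sum_(j < N) (slope y (a j - y) + slope y (b j - y)) =
    2 * \sum_(j < N) slope y (rounding N m j - y).
  under eq_bigr do rewrite -slopeD addrACA abz.
  rewrite -!slope_sum mulr_natl mulr2n -slopeD; congr slope.
  rewrite -big_split /=; under [RHS]eq_bigr do rewrite addrACA.
  rewrite [LHS]big_split [RHS]big_split /=; congr (_ + _); rewrite !big_split /= !sum_rounding//.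
  by rewrite addrACA subrr addr0.
have sc (t : R) : \sum_(j < N) t = N%:R * t.
  by rewrite sumr_const card_ord mulr_natl.
have S2' : \sum_(j < N) (2 * f y + slope y (a j - y) + slope y (b j - y) - 2 * B - U) =
    N%:R * (2 * f y - 2 * B - U) + 2 * \sum_(j < N) slope y (rounding N m j - y).
  rewrite -sl -sc -big_split /=.
  by apply: eq_bigr => j _; ring.
have S1' : \sum_(j < N) (f y + slope y (rounding N m j - y) + B) =
    N%:R * (f y + B) + \sum_(j < N) slope y (rounding N m j - y).
  rewrite -sc -big_split /=.
  by apply: eq_bigr => j _; ring.
move: S1 S2; rewrite S1' S2' /B natrD !natrM; lra.
Qed.
End Midpoint.
End LocalDefects.

Section DefectSum.
Variables (R : realType) (k : nat) (A : {fset 'rV[int]_k}).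
Variable (f : 'rV[int]_k -> R).
Hypotheses (f_ge0 : forall x, 0 <= f x) (f_le1 : forall x, f x <= 1).
Implicit Types (q : 'rV[R]_k) (x y z a b p : 'rV[int]_k).
Variable beta : nat.
Hypothesis bad_card : forall Y : {fset 'rV[int]_k},
  {in Y, forall y, bad R A y} -> (#|` Y| <= beta)%N.

Definition good_set : {fset 'rV[int]_k} := [fset y in A | good A y]%fset.

Lemma good_setP y : (y \in good_set) = good A y.
Proof. by rewrite !inE andb_idl// => /good_mem. Qed.

Definition parity z : 'rV[int]_k := \row_i (z 0%R i %% 2)%Z.

Lemma parity_in z : parity z \in int_box (fun=> 0) (fun=> 2%N).
Proof. by apply/int_boxP => i; rewrite !mxE; lia. Qed.

(* Each [z] of the parity of [s + t] is written as [(y + s) + (y + t)]. *)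
Lemma parity_class_le (s t : 'rV[int]_k) :
  (forall i, `|s 0 i| <= 3) -> (forall i, `|t 0 i| <= 3) ->
  \sum_(z <- [fset z in sumset A | parity z == parity (s + t)]%fset) inf_conv A f z <=
  \sum_(y <- good_set) (f (y + s) + f (y + t) - defect A f (y + s) (y + t))
  + 2 * beta%:R.
Proof.
move=> s3 t3.
pose h z : 'rV[int]_k := \row_i ((z 0%R i - s 0%R i - t 0%R i) %/ 2)%Z.
set Z := [fset z in _ | _]%fset.
have hz z : z \in Z -> z = (h z + s) + (h z + t).
  rewrite !inE => /andP[_ /eqP/rowP e]; apply/rowP => i.
  by have := e i; rewrite !mxE; move: (z 0 i) (s 0 i) (t 0 i) => z0 s0 t0; lia.
have hi : {in Z &, injective h}.
  by move=> z z' zZ z'Z e; rewrite (hz z)// (hz z')// e.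
rewrite (sum_fset_split _ (fun z => good A (h z))); apply: lerD; last first.
  set Z' := [fset z in Z | _]%fset.
  apply: (@le_trans _ _ (2 *+ #|` Z'|)).
    apply: sum_le_card => z; rewrite !inE => /andP[/andP[zA _] _].
    exact: inf_conv_le2.
  rewrite -[leLHS]mulr_natr; apply: ler_wpM2l; first by [].
  rewrite ler_nat.
  have hi' : {in Z' &, injective h}.
    by move=> z z' zZ z'Z; apply: hi; [move: zZ|move: z'Z]; rewrite inE => /andP[].
  rewrite -(card_in_imfset imfset_key hi'); apply: bad_card => y.
  case/imfsetP => z /=; rewrite inE => /andP[zZ gz ->]; split=> //.
  have := zZ; rewrite !inE => /andP[/sumsetP[a [b [aA bA ab]]] _].
  (* The hull point is [z / 2], the midpoint of two points of [A]; it differs from [h z] by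
     [(s + t) / 2], which is at most 3. *)
  exists (2^-1 *: (to_real R a + to_real R b)).
    by have [] := hull_mid f (hull_mem R aA) (hull_mem R bA).
  move=> i; have /rowP/(_ i) := hz z zZ.
  rewrite ab !mxE => /(congr1 (fun n : int => n%:~R : R)); rewrite !rmorphD /= => ->.
  set H := _%:~R; rewrite (_ : _ - _ = 2^-1 * ((s 0 i)%:~R + (t 0 i)%:~R)).
    have i3 (n : int) : `|n| <= 3 -> `|n%:~R : R| <= 3.
      by rewrite -intr_norm -[3 in X in _ -> X]/(3%:~R) ler_int.
    by have := i3 _ (s3 i); have := i3 _ (t3 i); rewrite !ler_norml; lra.
  by field.
have -> : \sum_(y <- good_set) (f (y + s) + f (y + t) - defect A f (y + s) (y + t)) =
    \sum_(y <- good_set) inf_conv A f ((y + s) + (y + t)).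
  by apply: eq_bigr => y _; rewrite /defect; ring.
have -> : \sum_(z <- [fset z in Z | good A (h z)]%fset) inf_conv A f z =
    \sum_(z <- [fset z in Z | good A (h z)]%fset)
       inf_conv A f ((h z + s) + (h z + t)).
  by apply: eq_big_seq => z; rewrite inE => /andP[zZ _]; rewrite -hz.
apply: (sum_inj_le (F := fun y => inf_conv A f ((y + s) + (y + t)))).
- move=> y; rewrite good_setP => gy; apply: inf_conv_ge0 => //; apply: mem_sumset.
    by apply: (goodP gy) => i; rewrite mxE addrAC subrr add0r.
  by apply: (goodP gy) => i; rewrite mxE addrAC subrr add0r.
- by move=> z; rewrite inE good_setP => /andP[].
- by move=> z z'; rewrite !inE => /andP[zZ _] /andP[z'Z _]; apply: hi; rewrite !inE.
Qed.

Lemma sum_good_shift (h : 'rV[int]_k -> R) (s : 'rV[int]_k) :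
  {in A, forall x, 0 <= h x} -> (forall i, `|s 0 i| <= 3) ->
  \sum_(y <- good_set) h (y + s) <= \sum_(x <- A) h x.
Proof.
move=> h0 s3; apply: (sum_inj_le (h := fun y => y + s)) => //.
  move=> y; rewrite good_setP => gy.
  by apply: (goodP gy) => i; rewrite mxE addrAC subrr add0r.
by move=> x y _ _ /addIr.
Qed.

Definition doubling_deficit : R :=
  2 ^+ k.+1 * \sum_(x <- A) f x - \sum_(z <- sumset A) inf_conv A f z.

(** In the parity class of [s + t], writing [z] as [(y + s) + (y + t)] gains the defects. Each of
    the other [2 ^ k - 1] classes contributes at most twice the sum of [f], up to boundary terms.
    All classes together give [2 ^ (k + 1)] times that sum, so the gain is at most the deficit. *)
Lemma sum_defect_le (s t : 'rV[int]_k) :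
  (forall i, `|s 0 i| <= 3) -> (forall i, `|t 0 i| <= 3) ->
  \sum_(y <- good_set) defect A f (y + s) (y + t) <=
  doubling_deficit + 2 ^+ k.+1 * beta%:R.
Proof.
move=> s3 t3.
have pIn z : z \in sumset A -> parity z \in int_box (fun=> 0) (fun=> 2%N).
  by move=> _; exact: parity_in.
rewrite /doubling_deficit (sum_fset_classes _ pIn).
have sf (v : 'rV[int]_k) : (forall i, `|v 0 i| <= 3) ->
    \sum_(y <- good_set) f (y + v) <= \sum_(x <- A) f x.
  by move=> v3; apply: sum_good_shift.
have cb e : e \in int_box (fun=> 0) (fun=> 2%N) ->
    \sum_(z <- [fset z in sumset A | parity z == e]%fset) inf_conv A f z <=
    2 * (\sum_(x <- A) f x + beta%:R).
  move=> /int_boxP eb.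
  have e3 i : `|e 0 i| <= 3 by have := eb i; move: (e 0 i) => n; lia.
  have z3 i : `|(0 : 'rV[int]_k) 0 i| <= 3 by rewrite mxE normr0.
  have pe : e = parity (0 + e).
    by apply/rowP => i; rewrite add0r mxE; have := eb i; move: (e 0 i) => n; lia.
  have := parity_class_le z3 e3; rewrite -pe => /le_trans; apply.
  rewrite mulrDr; apply: lerD => //.
  rewrite sumrB big_split /=.
  have := sf _ z3; have := sf _ e3.
  have : 0 <= \sum_(y <- good_set) defect A f (y + 0) (y + e).
    rewrite big_seq; apply: sumr_ge0 => y; rewrite good_setP => gy.
    by apply: defect_ge0; apply: (goodP gy) => i; rewrite mxE addrAC subrr add0r.
  lra.
have pst := parity_in (s + t).
rewrite (big_rem _ pst) /=.
have h1 := parity_class_le s3 t3; rewrite sumrB big_split /= in h1.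
have h2 : \sum_(e <- rem (parity (s + t)) (int_box (fun=> 0) (fun=> 2%N)))
    \sum_(z <- [fset z in sumset A | parity z == e]%fset) inf_conv A f z <=
    (2 ^+ k - 1) * (2 * (\sum_(x <- A) f x + beta%:R)).
  apply: (@le_trans _ _ (\sum_(e <- rem (parity (s + t)) (int_box (fun=> 0) (fun=> 2%N)))
     (2 * (\sum_(x <- A) f x + beta%:R)))).
    by apply: ler_sum_seq => e /mem_rem; exact: cb.
  rewrite big_const_seq count_predT iter_addr_0 size_rem// card_int_box.
  rewrite prod_nat_const card_ord -[leLHS]mulr_natl -subn1 natrB ?expn_gt0//.
  by rewrite natrX.
have := sf _ s3; have := sf _ t3; move: h1 h2; rewrite exprS; lra.
Qed.

Lemma sum_total_defect_le :
  \sum_(y <- good_set) total_defect A f y <=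
  (7 ^ k * 7 ^ k)%:R * (doubling_deficit + 2 ^+ k.+1 * beta%:R).
Proof.
pose B : {fset 'rV[int]_k} := int_box (fun=> -3) (fun=> 7%N).
have cB : #|` B| = (7 ^ k)%N by rewrite card_int_box prod_nat_const card_ord.
have B3 s i : s \in B -> `|s 0 i| <= 3 by move/int_boxP/(_ i); move: (s 0 i) => n; lia.
have shift (y : 'rV[int]_k) (F : 'rV[int]_k -> R) :
    {in neighborhood y, forall x, 0 <= F x} ->
    \sum_(a <- neighborhood y) F a <= \sum_(s <- B) F (y + s).
  move=> F0.
  have -> : \sum_(a <- neighborhood y) F a = \sum_(a <- neighborhood y) F (y + (a - y)).
    by apply: eq_bigr => a _; rewrite addrC subrK.
  apply: (sum_inj_le (h := fun a => a - y) (F := fun s => F (y + s))).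
  - move=> s sB; apply/F0/neighborhoodP => i.
    by rewrite mxE addrAC subrr add0r; exact: B3.
  - move=> a /neighborhoodP ay; apply/int_boxP => i.
    by have := ay i; rewrite !mxE; move: (a 0 i) (y 0 i) => m n; lia.
  - by move=> a b _ _ /addIr.
pose C := doubling_deficit + 2 ^+ k.+1 * beta%:R.
have le_y y : y \in good_set -> total_defect A f y <=
    \sum_(s <- B) \sum_(t <- B) defect A f (y + s) (y + t).
  rewrite good_setP => gy; have /fsubsetP sA := gy.
  apply: le_trans (shift y _ _) _ => [a ay|].
    rewrite big_seq; apply: sumr_ge0 => b yb.
    exact: good_defect_ge0 gy _ _.
  apply: ler_sum_seq => s sB; apply: shift => b yb.
  apply: good_defect_ge0 gy _ yb; apply/neighborhoodP => i.
  by rewrite mxE addrAC subrr add0r; exact: B3.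
apply: le_trans (ler_sum_seq le_y) _; rewrite exchange_big /=.
apply: (@le_trans _ _ (\sum_(s <- B) \sum_(t <- B) C)).
  apply: ler_sum_seq => s sB; rewrite exchange_big /=.
  by apply: ler_sum_seq => t tB; apply: sum_defect_le => i; exact: B3.
by rewrite !big_const_seq !count_predT !iter_addr_0 cB -mulrnA -[leLHS]mulr_natl.
Qed.
End DefectSum.

(** * Removing vertices within a cell *)

Section Descent.
Variables (R : realType) (k : nat) (A : {fset 'rV[int]_k}).
Variable (f : 'rV[int]_k -> R).
Implicit Types (q : 'rV[R]_k) (W w m : 'rV[int]_k) (a b : A).

Let lam q : {ffun A -> R} := opt_rep (vertex R (A:=A)) (fun a : A => f (val a)) q.

Let lamP q : hull A q -> is_rep (vertex R (A:=A)) q (lam q).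
Proof. by move=> /(opt_repP (fun a : A => f (val a)))[[]]. Qed.

Definition heavy_vertex (p : nat) W : option A := [pick a | 1 < p%:R * lam (scaled R p W) a].

Definition peel p W := if heavy_vertex p W is Some a then W - val a else W.

(** At most [k + 1] coefficients are nonzero, so they cannot all be at most [1 / (p + 1)] when
    [p > k]. The strict inequality at [a] leaves a positive coefficient after the removal; hence the
    support is unchanged and [opt_rep_sub] identifies the new optimal representation. *)
Lemma heavy_vertexP p W : (k < p)%N -> hull A (scaled R p.+1 W) -> exists a,
  [/\ heavy_vertex p.+1 W = Some a, peel p.+1 W = W - val a,
      hull A (scaled R p (peel p.+1 W)),
      forall b, (lam (scaled R p (peel p.+1 W)) b == 0) = (lam (scaled R p.+1 W) b == 0) &
      lam (scaled R p (peel p.+1 W)) a != 0 /\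
      p.+1%:R * low A f (scaled R p.+1 W) = f (val a) + p%:R * low A f (scaled R p (peel p.+1 W))].
Proof.
move=> kp hW; rewrite /peel /heavy_vertex; set l := lam (scaled R p.+1 W).
have [l0 l1 lW] := lamP hW; rewrite -/l in l0 l1 lW.
have p0 : (0 : R) < p%:R by rewrite ltr0n; lia.
have pS0 : (0 : R) < p.+1%:R by rewrite ltr0n.
case: pickP => [a la|no]; last first.
  have : (p.+1%:R : R) <= k.+1%:R.
    rewrite -[leLHS]mulr1 -[X in _ * X <= _]l1 mulr_sumr.
    have cl := opt_rep_card (fun a : A => f (val a)) hW.
    rewrite (bigID (fun b => l b != 0)) /= [X in _ + X]big1 ?addr0; last first.
      by move=> b; rewrite negbK => /eqP ->; rewrite mulr0.
    apply: (@le_trans _ _ (\sum_(b : A | l b != 0) 1)).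
      apply: ler_sum => b _; have := no b. by move/negbT; rewrite -leNgt.
    by rewrite big_const_seq iter_addr_0 ler_nat -sum1_count sum1_card.
  by rewrite ler_nat; lia.
have pN : (p%:R : R) != 0 by rewrite gt_eqF.
have pSN : (p.+1%:R : R) != 0 by rewrite gt_eqF.
pose l' : {ffun A -> R} := [ffun b => p%:R^-1 * (p.+1%:R * l b - (b == a)%:R)].
have sum1 (F : A -> R) : \sum_b l' b * F b = p%:R^-1 * (p.+1%:R * \sum_b l b * F b - F a).
  under eq_bigr do rewrite ffunE -mulrA mulrBl -mulrA.
  rewrite -mulr_sumr sumrB -mulr_sumr; congr (_ * (_ - _)).
  rewrite (bigD1 a)//= eqxx mul1r big1 ?addr0// => b /negPf ->.
  by rewrite mul0r.
have la0 : l a != 0.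
  by apply/eqP => la0; move: la; rewrite -/l la0 mulr0 ltr10.
have sl' b : (l' b == 0) = (l b == 0).
  rewrite ffunE mulf_eq0 invr_eq0 (negPf pN) /=.
  have [->|ba] := eqVneq b a; last by rewrite subr0 mulf_eq0 (negPf pSN).
  by rewrite (negPf la0) subr_eq0 gt_eqF.
have rl' : is_rep (vertex R (A:=A)) (scaled R p (W - val a)) l'.
  split=> [b||].
  - rewrite ffunE mulr_ge0 ?invr_ge0 ?(ltW p0)// subr_ge0.
    have [->|ba] := eqVneq b a; first exact: ltW.
    by rewrite mulr_ge0// ltW.
  - have := sum1 (fun=> 1); under eq_bigr do rewrite mulr1.
    under [in X in _ = _ * (_ * X - _) -> _]eq_bigr do rewrite mulr1.
    by rewrite l1 mulr1 -natr1 addrK mulVf.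
  - apply/rowP => i; rewrite summxE.
    under eq_bigr do rewrite mxE.
    rewrite sum1 /scaled to_realB [RHS]mxE; congr (_ * _).
    rewrite [RHS]mxE [X in _ = _ + X]mxE; congr (_ - _).
    have /rowP/(_ i) := lW; rewrite summxE.
    under eq_bigr do rewrite mxE.
    by move=> ->; rewrite mxE mulrA divff// mul1r.
have E : lam (scaled R p (W - val a)) = l'.
  by apply: (opt_rep_sub hW rl') => b /eqP lb; apply/eqP; rewrite sl'.
exists a; split=> //; first by eexists; exact: rl'.
  by move=> b; rewrite E sl'.
split; first by rewrite E sl'.
rewrite [in RHS]/low /opt_cost -/(lam _) E sum1 mulrA divff// mul1r addrC subrK.
by [].
Qed.

Fixpoint peel_iter t s W := if t is t'.+1 then peel_iter t' s (peel (s + t) W) else W.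

Fixpoint peel_count t s W (b : A) : nat :=
  if t is t'.+1 then ((heavy_vertex (s + t) W == Some b) + peel_count t' s (peel (s + t) W) b)%N else 0%N.

Lemma peel_iterP t s W : (k < s)%N -> hull A (scaled R (s + t) W) ->
  [/\ hull A (scaled R s (peel_iter t s W)),
      W = peel_iter t s W + \sum_b (peel_count t s W b)%:Z *: val b,
      (\sum_b peel_count t s W b = t)%N &
      (forall b, (lam (scaled R s (peel_iter t s W)) b == 0) = (lam (scaled R (s + t) W) b == 0)) /\
      (forall b, lam (scaled R s (peel_iter t s W)) b = 0 -> peel_count t s W b = 0%N)].
Proof.
move=> ks; elim: t W => [|t ih] W hW /=.
  split=> //.
  - by rewrite addn0 in hW.
  - by rewrite big1 ?addr0// => b _; rewrite scale0r.
  - by rewrite big1.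
  - by split=> // b; rewrite addn0.
have ks' : (k < s + t)%N by rewrite ltn_addr.
rewrite addnS in hW *.
have [a [va ra hr sr [a0 _]]] := heavy_vertexP ks' hW.
have [h1 h2 h3 [h5 h4]] := ih _ hr; rewrite va; split=> //.
- rewrite -[LHS](subrK (val a)) -ra {1}h2 -addrA; congr (_ + _).
  under [RHS]eq_bigr do rewrite PoszD scalerDl.
  rewrite big_split addrC; congr (_ + _).
  rewrite (bigD1 a)//= eqxx scale1r big1 ?addr0// => b ba.
  by rewrite (inj_eq Some_inj) eq_sym (negPf ba) scale0r.
- rewrite big_split /= h3 (bigD1 a)//= eqxx big1 ?addn0 ?add1n// => b ba.
  by rewrite (inj_eq Some_inj) eq_sym (negPf ba).
- split=> [b|b lb]; first by rewrite h5 sr.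
  rewrite h4// addn0; case: eqP => // -[ab].
  by move: a0; rewrite -h5 ab lb eqxx.
Qed.

(* The multiplicities of the removed vertices determine [W]; they live on at
   most [k + 1] vertices and have sum [t], so one of them is redundant. *)
Lemma peel_iter_fiber t s (w : 'rV[int]_k) (X : {fset 'rV[int]_k}) : (k < s)%N ->
  {in X, forall W, hull A (scaled R (s + t) W) /\ peel_iter t s W = w} ->
  (#|` X| <= t.+1 ^ k)%N.
Proof.
move=> ks hX; case: (fset_0Vmem X) => [->|[W0 W0X]]; first by rewrite cardfs0.
have hw : hull A (scaled R s w).
  by have [h0 <-] := hX _ W0X; have [] := peel_iterP ks h0.
have inj_cnt W W' : W \in X -> W' \in X -> (forall b, peel_count t s W b = peel_count t s W' b) -> W = W'.
  move=> /hX[hW eW] /hX[hW' eW'] e.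
  have [_ -> _ _] := peel_iterP ks hW; have [_ -> _ _] := peel_iterP ks hW'.
  by rewrite eW eW'; congr (_ + _); apply: eq_bigr => b _; rewrite e.
have cnt_t W b : W \in X -> (peel_count t s W b <= t)%N.
  move=> /hX[hW eW]; have [_ _ h _] := peel_iterP ks hW.
  by rewrite -[X in (_ <= X)%N]h (bigD1 b)//= leq_addr.
have cnt0 W b : W \in X -> lam (scaled R s w) b = 0 -> peel_count t s W b = 0%N.
  by move=> /hX[hW eW]; have [_ _ _ [_]] := peel_iterP ks hW; rewrite eW; apply.
pose S := enum [pred b | lam (scaled R s w) b != 0].
have cS : (size S <= k.+1)%N by rewrite -cardE; exact: opt_rep_card.
have Sin b : b \notin S -> lam (scaled R s w) b = 0.
  by rewrite mem_enum inE negbK => /eqP.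
case ES : S cS Sin => [|b0 S0] cS Sin.
  apply: (@leq_trans 1); last by rewrite expn_gt0.
  rewrite -[leqRHS](cardfs1 W0); apply: fsubset_leq_card; apply/fsubsetP => W WX.
  by rewrite inE; apply/eqP/inj_cnt => // b; rewrite !cnt0// Sin.
(* The multiplicity of [b0] is left out, since the total [t] determines it; the others fit into [k]
   coordinates, padded by zeros. *)
pose h W : 'rV[int]_k :=
  \row_(i < k) (if (i < size S0)%N then (peel_count t s W (nth b0 S0 i))%:Z else 0).
have -> : (t.+1 ^ k = \prod_(i < k) t.+1)%N by rewrite prod_nat_const card_ord.
apply: (card_le_box (h := h) (lo := fun=> 0)); last first.
  move=> W WX i; rewrite mxE; case: ifP => // _.
  by rewrite add0r !lez_nat /= ltz_nat ltnS cnt_t.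
move=> W W' WX W'X /rowP e.
have e1 b : b != b0 -> peel_count t s W b = peel_count t s W' b.
  move=> bb0; have [bS|bS] := boolP (b \in S0); last first.
    by rewrite !cnt0// Sin// inE (negPf bb0).
  have iS : (index b S0 < size S0)%N by rewrite index_mem.
  have ik : (index b S0 < k)%N by apply: leq_trans iS _.
  by have := e (Ordinal ik); rewrite !mxE /= iS nth_index// => -[].
apply: inj_cnt => // b; have [->|] := eqVneq b b0; last exact: e1.
have [hW _] := hX _ WX; have [hW' _] := hX _ W'X.
have [_ _ h1 _] := peel_iterP ks hW; have [_ _ h2 _] := peel_iterP ks hW'.
move: h1; rewrite -[RHS]h2 (bigD1 b0)//= [in RHS](bigD1 b0)//=.
by under [in X in _ = _ + X -> _]eq_bigr do rewrite -e1//; move/addIn.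
Qed.

Section Nodes.
Variables (N d p : nat).
Hypotheses (N_gt0 : (0 < N)%N) (kp : (k < p)%N) (dN : N = (d * (p.+1 * p))%N).

(* [node i a W / N] divides the segment from [a] to [W / p] in ratio [i : p.+1 - i]. *)
Definition node (i : nat) a W : 'rV[int]_k :=
  (d * ((p.+1 - i) * p))%N%:Z *: val a + (d * i)%N%:Z *: W.

Lemma node0 a W : node 0 a W = N%:Z *: val a.
Proof. by rewrite /node subn0 -dN muln0 scale0r addr0. Qed.

Lemma node_last a W : node p.+1 a W = (d * p.+1)%N%:Z *: W.
Proof. by rewrite /node subnn mul0n muln0 scale0r add0r. Qed.

(** So the point [W / (p + 1)] before the removal of [a] is the last but one node of the segment
    from [a] to the point after the removal. *)
Lemma node_prelast a W : node p a (W - val a) = (d * p)%N%:Z *: W.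
Proof. by rewrite /node subSnn mul1n -scalerDr addrC subrK. Qed.

Definition node_step a W : 'rV[int]_k := d%:Z *: W - (d * p)%N%:Z *: val a.

Lemma nodeS i a W : (i <= p)%N -> node i.+1 a W = node i a W + node_step a W.
Proof.
move=> ip; rewrite /node /node_step subSS (subSn ip) mulSn mulnDr.
rewrite mulnS !PoszD; apply/rowP => j; rewrite !mxE; ring.
Qed.

(** For positive [i] every nonzero coefficient at [W / p] keeps a positive share, so the node lies
    in the open cell of [W / p] and not merely in its closure. *)
Lemma node_hull i a W : (0 < i <= p.+1)%N -> hull A (scaled R p W) ->
  lam (scaled R p W) a != 0 ->
  hull A (scaled R N (node i a W)) /\
  forall b, (lam (scaled R N (node i a W)) b == 0) = (lam (scaled R p W) b == 0).
Proof.
move=> /andP[i0 ip] hW la; have [l0 l1 lW] := lamP hW.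
set l := lam _ in l0 l1 lW la *.
have iR : (0 : R) < i%:R by rewrite ltr0n.
have pR : (0 : R) < p%:R by rewrite ltr0n; lia.
have pSR : (0 : R) < p.+1%:R by rewrite ltr0n.
have dR : (0 : R) < d%:R by rewrite ltr0n; move: N_gt0; rewrite dN; case: (d).
have eR : (p.+1 - i)%:R = p.+1%:R - i%:R :> R by rewrite natrB.
pose l' : {ffun A -> R} := [ffun b => p.+1%:R^-1 * ((p.+1 - i)%:R * (b == a)%:R + i%:R * l b)].
have sum1 (F : A -> R) :
    \sum_b l' b * F b = p.+1%:R^-1 * ((p.+1 - i)%:R * F a + i%:R * \sum_b l b * F b).
  under eq_bigr do rewrite ffunE -mulrA mulrDl -!mulrA.
  rewrite -mulr_sumr big_split /= -mulr_sumr; congr (_ * (_ * _ + _)).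
    rewrite (bigD1 a)//= eqxx mul1r big1 ?addr0// => b /negPf ->.
    by rewrite mul0r.
  by rewrite -mulr_sumr.
have sl' b : (l' b == 0) = (l b == 0).
  rewrite ffunE mulf_eq0 invr_eq0 gt_eqF//=.
  have [->|ba] := eqVneq b a; last by rewrite mulr0 add0r mulf_eq0 gt_eqF.
  rewrite (negPf la) gt_eqF// mulr1 ltr_wpDl// mulr_gt0//.
  by rewrite lt_def la l0.
have rl' : is_rep (vertex R (A:=A)) (scaled R N (node i a W)) l'.
  split=> [b||].
  - by rewrite ffunE mulr_ge0 ?invr_ge0 ?(ltW pSR)// addr_ge0// mulr_ge0.
  - have := sum1 (fun=> 1); under eq_bigr do rewrite mulr1.
    under [in X in _ = _ * (_ + _ * X) -> _]eq_bigr do rewrite mulr1.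
    by rewrite l1 !mulr1 eR subrK mulVf ?gt_eqF.
  - apply/rowP => j; rewrite summxE.
    under eq_bigr do rewrite mxE.
    rewrite sum1.
    have /rowP/(_ j) := lW; rewrite summxE.
    under eq_bigr do rewrite mxE.
    move=> ->; rewrite /scaled /node to_realD !to_realZ !mxE dN !natrM !PoszM !intrM.
    rewrite -!pmulrn; field.
    by rewrite !gt_eqF.
have E : lam (scaled R N (node i a W)) = l'.
  by apply: (opt_rep_sub hW rl') => b /eqP lb; apply/eqP; rewrite sl'.
split; first by exists l'.
by move=> b; rewrite E sl'.
Qed.

(** A unit cell contains [N ^ k] numerators [m]. Given [m], the removed vertex is among the at most
    [k + 1] vertices of the cell of [m / N], and [m] together with this vertex determines [W]. *)
Lemma node_fiber i (y : 'rV[int]_k) (X : {fset 'rV[int]_k}) : (0 < i <= p.+1)%N ->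
  {in X, forall W, hull A (scaled R p.+1 W) /\ exists2 a,
     heavy_vertex p.+1 W = Some a & cell N (node i a (peel p.+1 W)) = y} ->
  (#|` X| <= k.+1 * N ^ k)%N.
Proof.
move=> ip hX.
pose g W := if heavy_vertex p.+1 W is Some a then node i a (peel p.+1 W) else 0.
pose B := int_box (fun j : 'I_k => N%:Z * y 0 j) (fun=> N).
have -> : (N ^ k = #|` B|)%N.
  by rewrite card_int_box prod_nat_const card_ord.
apply: (card_fiber_le (h := g)) => [W WX|m mB].
  have [_ [a va ey]] := hX _ WX; rewrite /g va; apply/int_boxP => j; rewrite -ey.
  move: (node i a _) => m'; rewrite !mxE addr0; move: (m' 0 j) => M.
  have N0 : 0 < N%:Z by lia.
  have := divz_eq M N%:Z; have := modz_ge0 M (lt0r_neq0 N0); have := ltz_pmod M N0.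
  by rewrite mulrC; lia.
set X' := [fset W in X | _]%fset.
have X'P W : W \in X' -> exists a, [/\ heavy_vertex p.+1 W = Some a, peel p.+1 W = W - val a,
    node i a (peel p.+1 W) = m, hull A (scaled R N m) & lam (scaled R N m) a != 0].
  rewrite inE => /andP[WX /eqP gW]; have [hW [a va _]] := hX _ WX.
  move: gW; rewrite /g va => nm.
  have [a' [va' ra hr sr [la _]]] := heavy_vertexP kp hW.
  move: va'; rewrite va => -[aa']; rewrite -aa' in la ra.
  have [hn sn] := node_hull ip hr la; rewrite nm in hn sn.
  by exists a; split=> //; rewrite sn.
case: (fset_0Vmem X') => [->|[W0 W0X]]; first by rewrite cardfs0.
have [a0 [_ _ _ hm la0]] := X'P _ W0X.
pose v W := odflt a0 (heavy_vertex p.+1 W).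
apply: leq_trans (opt_rep_card (fun a : A => f (val a)) hm).
apply: (card_inj_fin (h := v)) => [W /X'P[a [va _ _ _ la]]|].
  by rewrite /v va.
move=> W W' /X'P[a [va ra na _ _]] /X'P[a' [va' ra' na' _ _]].
rewrite /v va va' /= => aa'; rewrite -aa' in na' ra'.
have d0 : (0 < d)%N by move: N_gt0; rewrite dN; case: (d).
move: na'; rewrite -na /node => /addrI /rowP e.
apply: (@addIr _ (- val a)); rewrite -ra -ra'; apply/rowP => j.
have := e j; rewrite !mxE => /mulfI -> //.
by rewrite -lt0n muln_gt0 d0; case/andP: ip.
Qed.
End Nodes.
End Descent.

(** * Sums over dilates *)

Section DilateSums.
Variables (R : realType) (k : nat) (A : {fset 'rV[int]_k}).
Variable (f : 'rV[int]_k -> R).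
Hypotheses (f_ge0 : forall x, 0 <= f x) (f_le1 : forall x, f x <= 1).
Implicit Types (q : 'rV[R]_k) (x y z a b W : 'rV[int]_k).
Variable beta : nat.
Hypothesis bad_card : forall Y : {fset 'rV[int]_k},
  {in Y, forall y, bad R A y} -> (#|` Y| <= beta)%N.

Definition coord_bound : nat := \sum_(a <- A) \sum_i `|(a 0 i)%R|%N.

Definition dilate (p : nat) : {fset 'rV[int]_k} :=
  [fset W in int_box (fun=> - (p * coord_bound)%N%:Z) (fun=> (p * coord_bound).*2.+1)
  | `[< hull A (scaled R p W) >]]%fset.

Lemma dilateP p W : (0 < p)%N -> reflect (hull A (scaled R p W)) (W \in dilate p).
Proof.
move=> p0; rewrite !inE; apply: (iffP andP) => [[_ /asboolP//]|hW].
split; last exact/asboolP.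
apply/int_boxP => i; have := hull_bound i hW.
have pR : (0 : R) < p%:R by rewrite ltr0n.
rewrite !mxE normrM normfV [X in X^-1](gtr0_norm pR) ler_pdivrMl// -natrM.
rewrite -intr_norm pmulrn ler_int => h.
have {}h : `|W 0 i| <= (p * coord_bound)%N%:Z.
  apply: le_trans h _; rewrite lez_nat leq_mul2l; apply/orP; right.
  by apply: leq_sum => a _; rewrite (bigD1 i)//= leq_addr.
move: (W 0 i) (p * coord_bound)%N h => w n; lia.
Qed.

Let V x : R := low A f (to_real R x).

Lemma sum_good_ge (h : 'rV[int]_k -> R) : {in A, forall x, h x <= 1} ->
  \sum_(x <- A) h x - beta%:R <= \sum_(x <- good_set A) h x.
Proof.
move=> h1; rewrite (sum_fset_split _ (good A)) -addrA gerDl subr_le0.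
set X := [fset x in A | ~~ _]%fset.
apply: (@le_trans _ _ (1 *+ #|` X|)).
  by apply: sum_le_card => x; rewrite inE => /andP[xA _]; exact: h1.
rewrite ler_nat; apply: bad_card => x; rewrite inE => /andP[xA gx]; split=> //.
exists (to_real R x); first exact: hull_mem.
by move=> i; rewrite mxE subrr normr0.
Qed.

Lemma rounding_near (n : nat) m (j : nat) x : (0 < n)%N -> (j < n)%N ->
  (forall i, `|cell n m 0 i - x 0 i| <= 2) -> rounding n m j \in neighborhood x.
Proof.
move=> n0 jn h; apply/neighborhoodP => i; have := h i; have := rounding_cell n0 m i jn.
by move: (rounding n m j 0 i) (cell n m 0 i) (x 0 i) => u v w; lia.
Qed.

Lemma good_rounding (n : nat) m (j : nat) x : (0 < n)%N -> (j < n)%N -> good A x ->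
  (forall i, `|cell n m 0 i - x 0 i| <= 2) -> rounding n m j \in A.
Proof. by move=> n0 jn /fsubsetP gx h; apply/gx/rounding_near. Qed.

Lemma good_cell_rounding (n : nat) m (j : nat) : (0 < n)%N -> (j < n)%N ->
  good A (cell n m) -> rounding n m j \in A.
Proof. by move=> n0 jn gm; apply: (good_rounding n0 jn gm) => i; rewrite subrr. Qed.

Variables (N p d : nat).
Hypotheses (N_gt0 : (0 < N)%N) (N_pd : N = (p * d)%N).

Let p_gt0 : (0 < p)%N. Proof. by move: N_gt0; rewrite N_pd; case: (p). Qed.
Let d_gt0 : (0 < d)%N. Proof. by move: N_gt0; rewrite N_pd mulnC; case: (d). Qed.

Lemma scaled_dilate W : scaled R N (d%:Z *: W) = scaled R p W.
Proof. by rewrite N_pd scaledM. Qed.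

(** For fixed [j], every integer point is the [j]-th rounding of exactly [p ^ k] numerators [W].
    This is how sums over a dilate are compared with sums over [A]. *)
Lemma rounding_dilate W x (j : nat) : (j < N)%N -> rounding N (d%:Z *: W) j = x <->
  W \in int_box (fun i => p%:Z * x 0 i - (j %/ d)%N%:Z) (fun=> p).
Proof.
move=> jN; have N0 : 0 < N%:Z by lia.
have d0 : 0 < d%:Z by lia.
have H (w y : int) : ((d%:Z * w + j%:Z) %/ N%:Z)%Z = y <->
    p%:Z * y - (j %/ d)%N%:Z <= w < p%:Z * y - (j %/ d)%N%:Z + p%:Z.
  have NZ : N%:Z = p%:Z * d%:Z by rewrite N_pd PoszM.
  have := divz_eq (d%:Z * w + j%:Z) N%:Z.
  have := modz_ge0 (d%:Z * w + j%:Z) (lt0r_neq0 N0).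
  have := ltz_pmod (d%:Z * w + j%:Z) N0.
  move: (_ %/ _)%Z (_ %% _)%Z => q r rN r0 e.
  have ej := divn_eq j d; have jd : (j %% d < d)%N by rewrite ltn_mod.
  set jq := (j %/ d)%N in ej *; set jr := (j %% d)%N in ej jd *.
  split=> [<-|].
    have e' : (w + jq%:Z - p%:Z * q) * d%:Z = r - jr%:Z by move: e; rewrite NZ; lia.
    apply/andP; split.
      by rewrite -ltzD1 -(ltr_pM2r d0); nia.
    by rewrite -(ltr_pM2r d0); nia.
  move=> /andP[h1 h2]; set t := w + jq%:Z - p%:Z * y.
  have t0 : 0 <= t by rewrite /t; lia.
  have tp : t + 1 <= p%:Z by rewrite /t; lia.
  have td : t * d%:Z + d%:Z <= N%:Z.
    by rewrite NZ -[X in _ + X]mul1r -mulrDl ler_pM2r.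
  have td0 : 0 <= t * d%:Z by rewrite mulr_ge0.
  have e' : (q - y) * N%:Z = t * d%:Z + jr%:Z - r by rewrite /t mulrBl NZ in e *; lia.
  have h3 : q - y < 1 by rewrite -(ltr_pM2r N0) e'; lia.
  have h4 : -1 < q - y by rewrite -(ltr_pM2r N0) e'; lia.
  by lia.
split=> [e|/int_boxP h].
  by apply/int_boxP => i; apply/H; rewrite -e !mxE.
by apply/rowP => i; rewrite !mxE; apply/H; exact: h.
Qed.

Let phiW (h : 'rV[int]_k -> R) W := rounding_mean N h (d%:Z *: W).

Lemma fiber_le (X : {fset 'rV[int]_k}) (j : nat) x : (j < N)%N ->
  (#|` [fset W in X | rounding N (d%:Z *: W) j == x]%fset| <= p ^ k)%N.
Proof.
move=> jN; have -> : (p ^ k = \prod_(i < k) p)%N by rewrite prod_nat_const card_ord.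
rewrite -(card_int_box (fun i => p%:Z * x 0 i - (j %/ d)%N%:Z)).
by apply: fsubset_leq_card; apply/fsubsetP => W; rewrite inE => /andP[_ /eqP /rounding_dilate]; exact.
Qed.

Definition goodW W := good A (cell N (d%:Z *: W)).

Lemma sum_rounding_mean_le (h : 'rV[int]_k -> R) : {in A, forall x, 0 <= h x} ->
  \sum_(W <- [fset W in dilate p | goodW W]%fset) phiW h W <=
  (p ^ k)%:R * \sum_(x <- A) h x.
Proof.
move=> h0; rewrite /phiW /rounding_mean -mulr_sumr exchange_big /=.
rewrite ler_pdivrMl ?ltr0n//; set C := (p ^ k)%:R * _.
have -> : N%:R * C = \sum_(j < N) C by rewrite sumr_const card_ord mulr_natl.
apply: ler_sum => j _; apply: (sum_fiber (h := fun W => rounding N (d%:Z *: W) j)) => //.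
  by move=> W; rewrite inE => /andP[_ gW]; exact: good_cell_rounding.
by move=> x _; exact: fiber_le.
Qed.

Lemma bad_dilate_card :
  (#|` [fset W in dilate p | ~~ goodW W]%fset| <= p ^ k * beta)%N.
Proof.
set X := [fset W in _ | _]%fset.
apply: (@leq_trans (p ^ k * #|` [fset cell N (d%:Z *: W) | W in X]%fset|)%N).
  apply: (card_fiber_le (h := fun W => cell N (d%:Z *: W))) => [W WX|y _].
    by apply/imfsetP; exists W.
  exact: fiber_le.
rewrite leq_mul2l bad_card ?orbT// => y /imfsetP[W /= WX ->].
move: WX; rewrite inE => /andP[/(dilateP _ p_gt0) hW gW]; split=> //.
exists (scaled R N (d%:Z *: W)); first by rewrite scaled_dilate.
by move=> i; apply: le_trans (scaled_cell R N_gt0 _ _) _; rewrite ler1n.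
Qed.

Lemma sum_rounding_mean_ge (h : 'rV[int]_k -> R) : (forall x, 0 <= h x) ->
  (p ^ k)%:R * \sum_(x <- good_set A) h x <= \sum_(W <- dilate p) phiW h W.
Proof.
move=> h0; rewrite /phiW /rounding_mean -mulr_sumr exchange_big /=.
rewrite ler_pdivlMl ?ltr0n//; set C := (p ^ k)%:R * _.
have -> : N%:R * C = \sum_(j < N) C by rewrite sumr_const card_ord mulr_natl.
apply: ler_sum => j _; apply: (sum_fiber_ge (h := fun W => rounding N (d%:Z *: W) j)) => //.
move=> x; rewrite good_setP => gx.
have -> : (p ^ k = \prod_(i < k) p)%N by rewrite prod_nat_const card_ord.
rewrite -(card_int_box (fun i => p%:Z * x 0 i - (j %/ d)%N%:Z)).
apply: fsubset_leq_card; apply/fsubsetP => W /(rounding_dilate _ _ (ltn_ord j)) e.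
suff : W \in dilate p by rewrite !inE /= e eqxx andbT.
apply/dilateP => //; rewrite -scaled_dilate.
have [|//] := @hull_rounding R k N N_gt0 A f (d%:Z *: W).
move=> j' j'N; apply: (good_rounding N_gt0 j'N gx) => i.
have := rounding_cell N_gt0 (d%:Z *: W) i (ltn_ord j); rewrite e.
by move: (cell _ _ _ _) (x 0 i) => u v; lia.
Qed.

(** Convexity bounds the value of [low] at [W / p] by the mean of its values at the roundings; a
    numerator with a bad cell is charged 1. *)
Lemma sum_low_le :
  \sum_(W <- dilate p) low A f (scaled R p W) <= (p ^ k)%:R * (\sum_(x <- A) V x + beta%:R).
Proof.
rewrite (sum_fset_split _ goodW) mulrDr; apply: lerD.
  apply: le_trans (sum_rounding_mean_le (h := V) _); last first.
    by move=> x xA; apply: low_ge0 => //; exact: hull_mem.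
  apply: ler_sum_seq => W; rewrite inE => /andP[_ gW]; rewrite -scaled_dilate.
  have [|_ //] := @hull_rounding R k N N_gt0 A f (d%:Z *: W).
  by move=> j jN; exact: good_cell_rounding.
apply: (@le_trans _ _ (1 *+ #|` [fset W in dilate p | ~~ goodW W]%fset|)).
  apply: sum_le_card => W; rewrite inE => /andP[/(dilateP _ p_gt0) hW _].
  exact: low_le1.
by rewrite -natrM ler_nat bad_dilate_card.
Qed.

(* For [e, e'] in [[0, p)^k], the points [x + (e - e') / p] and
   [x + (e' - e) / p] have midpoint [x]; average over [e] and [e']. *)
Lemma sum_low_ge :
  (p ^ k)%:R * \sum_(x <- good_set A) V x <= \sum_(W <- dilate p) low A f (scaled R p W).
Proof.
pose E : {fset 'rV[int]_k} := int_box (fun=> 0) (fun=> p).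
have cE : #|` E| = (p ^ k)%N by rewrite card_int_box prod_nat_const card_ord.
pose L W := low A f (scaled R p W).
have hE x e e' : x \in good_set A -> e \in E -> e' \in E ->
    hull A (scaled R p (p%:Z *: x + (e - e'))).
  rewrite good_setP => gx /int_boxP eE /int_boxP eE'; rewrite -scaled_dilate.
  have [|//] := @hull_rounding R k N N_gt0 A f (d%:Z *: (p%:Z *: x + (e - e'))).
  move=> j jN; apply: (good_rounding N_gt0 jN gx) => i; have := eE i; have := eE' i.
  rewrite !mxE N_pd PoszM; move: (x 0 i) (e 0 i) (e' 0 i) => u v w hw hv.
  have -> : d%:Z * (p%:Z * u + (v - w)) + 0 = u * (p%:Z * d%:Z) + (v - w) * d%:Z by ring.
  have pd0 : 0 < p%:Z * d%:Z by have := N_gt0; rewrite N_pd; lia.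
  rewrite divzMDl ?gt_eqF// addrAC subrr add0r.
  have h1 : (v - w) * d%:Z < p%:Z * d%:Z by rewrite ltr_pM2r; lia.
  have h2 : - (p%:Z * d%:Z) < (v - w) * d%:Z by rewrite -mulNr ltr_pM2r; lia.
  move: ((v - w) * d%:Z) (p%:Z * d%:Z) pd0 h1 h2 => a b b0 ab ba.
  have := divz_eq a b; have := modz_ge0 a (lt0r_neq0 b0); have := ltz_pmod a b0.
  move: (_ %/ _)%Z (_ %% _)%Z => q r rb r0 aE.
  have q1 : q < 1 by rewrite -(ltr_pM2r b0); lia.
  have q2 : -2 < q by rewrite -(ltr_pM2r b0); lia.
  by lia.
have mid x e e' : x \in good_set A -> e \in E -> e' \in E ->
    2 * V x <= L (p%:Z *: x + (e - e')) + L (p%:Z *: x + (e' - e)).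
  move=> gx eE e'E; have [_] := hull_mid f (hE x e e' gx eE e'E) (hE x e' e gx e'E eE).
  rewrite /L /V; congr (2 * low _ _ _ <= _).
  rewrite /scaled -scalerDr -to_realD scalerA.
  have -> : p%:Z *: x + (e - e') + (p%:Z *: x + (e' - e)) = (2 * p)%N%:Z *: x.
    by apply/rowP => i; rewrite !mxE PoszM; ring.
  rewrite to_realZ scalerA -[_%:~R]/((2 * p)%N%:R : R) natrM.
  by rewrite mulrACA !mulVf ?mulr1 ?scale1r ?pnatr_eq0 -?lt0n.
have sumL e' : e' \in E -> \sum_(x <- good_set A) \sum_(e <- E) L (p%:Z *: x + (e - e')) <=
    \sum_(W <- dilate p) L W.
  move=> e'E.
  (* For fixed [e'] the points [p x + e - e'] are pairwise distinct, since [h] recovers [x] by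
     Euclidean division. Hence they contribute at most the whole sum over the dilate. *)
  pose h W : 'rV[int]_k := \row_i ((W 0%R i + e' 0%R i) %/ p%:Z)%Z.
  have hx x e : e \in E -> h (p%:Z *: x + (e - e')) = x.
    move=> /int_boxP eE; apply/rowP => i; rewrite !mxE addrA subrK mulrC.
    have := eE i; rewrite add0r => ei; have p0 : 0 < p%:Z by lia.
    by rewrite divzMDl ?gt_eqF// divz_small ?addr0// gtr0_norm.
  rewrite [leRHS](sum_fset_split _ (fun W => h W \in good_set A)).
  rewrite -[leLHS]addr0; apply: lerD; last first.
    rewrite big_seq; apply: sumr_ge0 => W; rewrite inE => /andP[/(dilateP _ p_gt0) hW _].
    exact: low_ge0.
  rewrite (sum_fset_classes (E := good_set A) (h := h)); last first.
    by move=> W; rewrite inE => /andP[].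
  apply: ler_sum_seq => x gx.
  apply: (sum_inj_le (h := fun e => p%:Z *: x + (e - e')) (F := L)).
  - move=> W; rewrite !inE => /andP[/andP[/andP[_ /asboolP hW] _] _].
    exact: low_ge0.
  - move=> e eE; have := hE _ _ _ gx eE e'E => /(dilateP _ p_gt0).
    by move: gx; rewrite !inE/= hx// eqxx andbT => -> ->.
  - by move=> e1 e2 _ _ /addrI /addIr.
have pR : (0 : R) < (p ^ k)%:R by rewrite ltr0n expn_gt0 p_gt0.
rewrite -(ler_pM2l pR) -(ler_pM2l (ltr0Sn R 1)).
set S := \sum_(W <- dilate p) _.
have S1 (G : 'rV[int]_k -> 'rV[int]_k -> 'rV[int]_k -> R) :
    (forall e', e' \in E -> \sum_(x <- good_set A) \sum_(e <- E) G x e e' <= S) ->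
    \sum_(e' <- E) \sum_(x <- good_set A) \sum_(e <- E) G x e e' <= (p ^ k)%:R * S.
  move=> h; apply: le_trans (ler_sum_seq h) _.
  by rewrite big_const_seq count_predT iter_addr_0 cE mulr_natl.
have H1 := S1 (fun x e e' => L (p%:Z *: x + (e - e'))) sumL.
have H2 := H1; rewrite exchange_big /= in H2.
have H3 : \sum_(x <- good_set A) \sum_(e' <- E) \sum_(e <- E) L (p%:Z *: x + (e' - e)) <=
    (p ^ k)%:R * S.
  by apply: le_trans H2; apply: ler_sum_seq => x _; rewrite exchange_big.
have H4 : \sum_(x <- good_set A) \sum_(e' <- E) \sum_(e <- E) (2 * V x) <=
   \sum_(x <- good_set A) \sum_(e' <- E) \sum_(e <- E)
     (L (p%:Z *: x + (e' - e)) + L (p%:Z *: x + (e - e'))).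
  apply: ler_sum_seq => x gx; apply: ler_sum_seq => e' eE'; apply: ler_sum_seq => e eE.
  exact: mid.
have H5 : \sum_(x <- good_set A) \sum_(e' <- E) \sum_(e <- E) (2 * V x) =
    2 * ((p ^ k)%:R * ((p ^ k)%:R * \sum_(x <- good_set A) V x)).
  rewrite !mulr_sumr; apply: eq_bigr => x _.
  by rewrite !big_const_seq !count_predT !iter_addr_0 cE -2!mulr_natl; ring.
rewrite -H5; apply: le_trans H4 _.
under eq_bigr do under eq_bigr do rewrite big_split.
under eq_bigr do rewrite big_split.
by rewrite big_split /= mulrDl !mul1r lerD.
Qed.
End DilateSums.

(** * Stability up to boundary points *)

(** [F] at [i] lies under the chord from [0] to [i + 1]. The induction adds [i + 1] times the next
    midpoint inequality, and the errors obey [i ^ 2 + (i + 1) <= (i + 1) ^ 2]. *)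
Lemma discrete_convexity (R : realFieldType) (F : nat -> R) (T : R) (p : nat) :
  0 <= T -> (forall i, (i < p)%N -> 2 * F i.+1 <= F i + F i.+2 + T) ->
  forall i, (i <= p)%N -> i.+1%:R * F i <= F 0%N + i%:R * F i.+1 + (i ^ 2)%:R * T.
Proof.
move=> T0 h; elim=> [|i ih] ip; first by rewrite !mul0r mul1r !addr0.
have := ih (ltnW ip).
have := ler_wpM2l (ler0n R i.+1) (h i ip).
have : ((i ^ 2)%:R + i.+1%:R) * T <= (i.+1 ^ 2)%:R * T.
  by rewrite ler_wpM2r// -natrD ler_nat; lia.
move: ((i ^ 2)%:R) ((i.+1 ^ 2)%:R : R) => a b.
have -> : i.+2%:R = i%:R + 2 :> R by rewrite -natrD addn2.
have -> : i.+1%:R = i%:R + 1 :> R by rewrite natr1.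
rewrite !mulrDr !mulrDl; lra.
Qed.

Section Core.
Variables (R : realType) (k : nat) (A : {fset 'rV[int]_k}).
Variable (f : 'rV[int]_k -> R).
Hypotheses (f_ge0 : forall x, 0 <= f x) (f_le1 : forall x, f x <= 1).
Implicit Types (q : 'rV[R]_k) (W x y m : 'rV[int]_k).
Variable beta : nat.
Hypothesis bad_card : forall Y : {fset 'rV[int]_k},
  {in Y, forall y, bad R A y} -> (#|` Y| <= beta)%N.
Variables (N M : nat).
Hypothesis N_gt0 : (0 < N)%N.
Hypothesis N_dvd : forall p, (0 < p < M)%N -> (p.+1 * p %| N)%N.

(* At a bad point the trivial bound 2 replaces the midpoint inequality. *)
Definition cell_cost y : R :=
  if good A y then (1 + 8 * k)%:R * total_defect A f y else 2.

Lemma cell_cost_ge0 y : 0 <= cell_cost y.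
Proof.
rewrite /cell_cost; case: ifP => // gy.
by rewrite mulr_ge0// total_defect_ge0.
Qed.

Let E : R := (1 + 8 * k)%:R * \sum_(y <- good_set A) total_defect A f y + 2 * beta%:R.

Let E_ge0 : 0 <= E.
Proof.
rewrite addr_ge0 ?mulr_ge0//; rewrite big_seq sumr_ge0// => y.
by rewrite good_setP => gy; exact: total_defect_ge0.
Qed.

Lemma sum_cell_cost (Y : {fset 'rV[int]_k}) : {in Y, forall y, touches R A y} ->
  \sum_(y <- Y) cell_cost y <= E.
Proof.
move=> tY; rewrite (sum_fset_split _ (good A)); apply: lerD.
  apply: (@le_trans _ _ (\sum_(y <- [fset y in Y | good A y]%fset)
      (1 + 8 * k)%:R * total_defect A f y)).
    by apply: ler_sum_seq => y; rewrite inE /cell_cost => /andP[_ ->].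
  rewrite -mulr_sumr; apply: ler_wpM2l => //.
  apply: (sum_inj_le (h := id)) => //.
    by move=> y; rewrite good_setP => gy; exact: total_defect_ge0.
  by move=> y; rewrite good_setP inE => /andP[].
set Y' := [fset y in Y | ~~ good A y]%fset.
apply: (@le_trans _ _ (2 *+ #|` Y'|)).
  by apply: sum_le_card => y; rewrite inE /cell_cost => /andP[_ /negPf ->].
rewrite -[leLHS]mulr_natr; apply: ler_wpM2l => //; rewrite ler_nat.
by apply: bad_card => y; rewrite inE => /andP[/tY].
Qed.

Let node_scale p := (N %/ (p.+1 * p))%N.

Let node_scaleE p : (0 < p < M)%N -> N = (node_scale p * (p.+1 * p))%N.
Proof. by move=> /N_dvd /divnK ->. Qed.

(** Node 0 is left out: all its roundings are the vertex [a] itself, which lies in [A] even when it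
    is a bad point. *)
Definition path_cost p W : R :=
  if heavy_vertex A f p.+1 W is Some a then
    \sum_(i < p.+1) cell_cost (cell N (node (A := A) (node_scale p) p i.+1 a (peel A f p.+1 W)))
  else 0.

Lemma path_cost_ge0 p W : 0 <= path_cost p W.
Proof.
rewrite /path_cost; case: heavy_vertex => // a.
by apply: sumr_ge0 => i _; exact: cell_cost_ge0.
Qed.

(** The factor [p] matches the additivity of [p * low] under [peel]. Truncation at 0 makes the gap
    nonnegative, as [sum_fiber] requires. *)
Definition gap_at p W : R :=
  p%:R * Num.max 0 (rounding_mean N f ((N %/ p)%N%:Z *: W) - low A f (scaled R p W)).

Lemma gap_at_ge0 p W : 0 <= gap_at p W.
Proof. by rewrite mulr_ge0// le_max lexx. Qed.

(** Let [F i] be the rounding mean at node [i]. Then [discrete_convexity] at [i = p] bounds [p + 1]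
    times the mean at [W / (p + 1)] by [f a] plus [p] times the mean at the next point. Subtracting
    the identity for [low] from [heavy_vertexP] cancels [f a]. *)
Lemma gap_step p W : (k < p < M)%N -> hull A (scaled R p.+1 W) ->
  gap_at p.+1 W <= gap_at p (peel A f p.+1 W) + (p ^ 2)%:R * path_cost p W.
Proof.
move=> /andP[kp pM] hW.
have p0 : (0 < p)%N by apply: leq_ltn_trans kp.
have dE := node_scaleE (p := p) (introT andP (conj p0 pM)).
have [a [va ra hr _ [_ lowE]]] := heavy_vertexP f kp hW.
set W' := peel A f p.+1 W in ra hr lowE *; set T := path_cost p W.
have T0 : 0 <= T by exact: path_cost_ge0.
pose m i := node (A := A) (node_scale p) p i a W'.
pose F i := rounding_mean N f (m i).
have cT i : (i < p.+1)%N -> cell_cost (cell N (m i.+1)) <= T.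
  move=> ip; rewrite /T /path_cost va (bigD1 (Ordinal ip))//= lerDl.
  by apply: sumr_ge0 => j _; exact: cell_cost_ge0.
have F01 i : 0 <= F i <= 1 by rewrite rounding_mean_ge0//= rounding_mean_le1.
have bT i : (i < p.+1)%N -> ~~ good A (cell N (m i.+1)) -> 2 <= T.
  by move=> ip gi; have := cT i ip; rewrite /cell_cost (negPf gi).
have conv i : (i < p)%N -> 2 * F i.+1 <= F i + F i.+2 + T.
  move=> ip.
  have triv : 2 <= T -> 2 * F i.+1 <= F i + F i.+2 + T.
    by have := F01 i; have := F01 i.+1; have := F01 i.+2; lra.
  have [g1|b1] := boolP (good A (cell N (m i.+1))); last first.
    by apply: triv; apply: bT b1; lia.
  have [g2|b2] := boolP (good A (cell N (m i.+2))); last first.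
    by apply: triv; apply: bT b2; lia.
  have [g0|b0] := boolP ((i == 0%N) || good A (cell N (m i))); last first.
    move: b0; rewrite negb_or => /andP[i0 b0].
    apply: triv; apply: (bT i.-1); first by lia.
    by rewrite prednK// lt0n.
  have e2 : m i.+2 = m i.+1 + node_step (A := A) (node_scale p) p a W'.
    by apply: nodeS.
  have e0 : m i = m i.+1 - node_step (A := A) (node_scale p) p a W'.
    by rewrite /m (nodeS (node_scale p) a W' (ltnW ip)) addrK.
  have a2 j : (j < N)%N -> rounding N (m i.+2) j \in A by move=> jN; exact: good_cell_rounding.
  have a0 j : (j < N)%N -> rounding N (m i) j \in A.
    move=> jN; case/orP: g0 => [/eqP ->|g0]; last exact: good_cell_rounding.
    by rewrite /m (node0 dE) roundingZ// fsvalP.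
  rewrite e2 in a2; rewrite e0 in a0.
  have := midpoint f N_gt0 g1 a2 a0; rewrite -e2 -e0 -/(F _) -/(F _) -/(F _).
  have := cT i (leqW ip); rewrite /cell_cost g1; lra.
have := discrete_convexity T0 conv (leqnn p).
have F0E : F 0%N = f (val a) by rewrite /F /m (node0 dE) rounding_meanZ.
have FpE : F p = rounding_mean N f ((N %/ p.+1)%N%:Z *: W).
  by rewrite /F /m ra node_prelast {3}dE mulnCA mulKn.
have FSE : F p.+1 = rounding_mean N f ((N %/ p)%N%:Z *: W').
  by rewrite /F /m node_last {3}dE mulnA mulnK.
rewrite F0E FpE FSE => ineq.
rewrite /gap_at -/W' maxr_pMr//; rewrite ge_max; apply/andP; split.
  rewrite mulr0 addr_ge0 ?mulr_ge0//; by rewrite le_max lexx.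
have : p%:R * (rounding_mean N f ((N %/ p)%N%:Z *: W') - low A f (scaled R p W')) <=
    p%:R * Num.max 0 (rounding_mean N f ((N %/ p)%N%:Z *: W') - low A f (scaled R p W')).
  by apply: ler_wpM2l => //; rewrite le_max lexx orbT.
move: ineq; rewrite !mulrBr lowE; lra.
Qed.

Lemma sum_path_cost p : (k < p < M)%N ->
  \sum_(W <- dilate R A p.+1) path_cost p W <= (p.+1 * (k.+1 * N ^ k))%:R * E.
Proof.
move=> /andP[kp pM].
have p0 : (0 < p)%N by apply: leq_ltn_trans kp.
have dE := node_scaleE (p := p) (introT andP (conj p0 pM)).
pose g (i : nat) W := if heavy_vertex A f p.+1 W is Some a then
  cell N (node (A := A) (node_scale p) p i a (peel A f p.+1 W)) else 0.
have -> : \sum_(W <- dilate R A p.+1) path_cost p W =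
    \sum_(W <- dilate R A p.+1) \sum_(i < p.+1) cell_cost (g i.+1 W).
  apply: eq_big_seq => W /(dilateP _ _ _ (ltn0Sn p)) hW.
  by have [a [va _ _ _ _]] := heavy_vertexP f kp hW; rewrite /path_cost /g va.
rewrite exchange_big /= natrM -mulrA mulr_natl -[in leRHS](card_ord p.+1).
rewrite -sumr_const; apply: ler_sum => i _.
have ip : (0 < i.+1 <= p.+1)%N by rewrite ltnS ltn_ord.
set X := dilate R A p.+1.
apply: (@le_trans _ _ ((k.+1 * N ^ k)%:R * \sum_(y <- [fset g i.+1 W | W in X]%fset) cell_cost y)).
  apply: (sum_fiber (h := g i.+1)) => [y _|W WX|y _]; first exact: cell_cost_ge0.
    by apply/imfsetP; exists W.
  apply: (@node_fiber R k A f N (node_scale p) p N_gt0 kp dE i.+1 y _ ip) => W; rewrite inE => /andP[].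
  move=> /(dilateP _ _ _ (ltn0Sn p)) hW /eqP gW; split=> //.
  have [a [va _ _ _ _]] := heavy_vertexP f kp hW.
  by exists a => //; rewrite -gW /g va.
apply: ler_wpM2l => //; apply: sum_cell_cost => y /imfsetP[W /= WX ->].
move: WX => /(dilateP _ _ _ (ltn0Sn p)) hW.
have [a [va ra hr _ [la _]]] := heavy_vertexP f kp hW.
have [hn _] := node_hull N_gt0 kp dE ip hr la.
rewrite /g va; exists (scaled R N (node (A := A) (node_scale p) p i.+1 a (peel A f p.+1 W))) => // j.
by apply: le_trans (scaled_cell R N_gt0 _ _) _; rewrite ler1n.
Qed.

Fixpoint chain_cost s t W : R :=
  if t is t'.+1 then
    ((s + t') ^ 2)%:R * path_cost (s + t') W + chain_cost s t' (peel A f (s + t) W)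
  else 0.

Lemma gap_chain s t W : (k < s)%N -> (s + t <= M)%N -> hull A (scaled R (s + t) W) ->
  gap_at (s + t) W <= gap_at s (peel_iter A f t s W) + chain_cost s t W.
Proof.
move=> ks; elim: t W => [|t ih] W stM hW; first by rewrite addn0 addr0.
rewrite addnS in hW stM *.
have kst : (k < s + t < M)%N by rewrite stM (leq_trans ks) ?leq_addr.
have [_ [_ _ hr _ _]] := heavy_vertexP f (ltn_addr t ks) hW.
apply: le_trans (gap_step kst hW) _; rewrite /= addnS.
by have := ih _ (ltnW stM) hr; lra.
Qed.

(** The factor [2 ^ k] bounds the fibers of a single removal: [peel_iter_fiber] with [t = 1]. *)
Fixpoint chain_const s t : nat :=
  if t is t'.+1 then
    ((s + t') ^ 2 * ((s + t) * (k.+1 * N ^ k)) + 2 ^ k * chain_const s t')%N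
  else 0%N.

Lemma sum_chain_cost s t : (k < s)%N -> (s + t <= M)%N ->
  \sum_(W <- dilate R A (s + t)) chain_cost s t W <= (chain_const s t)%:R * E.
Proof.
move=> ks; elim: t => [|t ih] stM; first by rewrite big1 ?mul0r.
rewrite addnS in stM *.
have kst : (k < s + t < M)%N by rewrite stM (leq_trans ks) ?leq_addr.
rewrite /= big_split /= natrD mulrDl; apply: lerD.
  by rewrite -mulr_sumr addnS natrM -mulrA; apply: ler_wpM2l => //; exact: sum_path_cost.
rewrite natrM -mulrA.
have cc0 t' W : 0 <= chain_cost s t' W.
  elim: t' W => //= t' iht W.
  by rewrite addr_ge0 ?mulr_ge0 ?path_cost_ge0.
apply: le_trans (ler_wpM2l (ler0n _ _) (ih (ltnW stM))).
apply: (sum_fiber (h := peel A f (s + t.+1))) => [W _|W|W _] //.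
  rewrite addnS => /(dilateP _ _ _ (ltn0Sn _)) hW.
  have [_ [_ _ hr _ _]] := heavy_vertexP f (ltn_addr t ks) hW.
  by apply/dilateP => //; rewrite addn_gt0 (leq_ltn_trans _ ks).
apply: (@peel_iter_fiber R k A f 1 (s + t) W); first exact: ltn_addr.
move=> W' /=; rewrite inE addn1 addnS => /andP[/(dilateP _ _ _ (ltn0Sn _)) hW' /eqP <-].
by split.
Qed.

Let D : R := \sum_(x <- A) f x - \sum_(x <- A) low A f (to_real R x).

Lemma low01 x : x \in A -> 0 <= low A f (to_real R x) <= 1.
Proof.
move=> xA; rewrite low_ge0 ?low_le1//; exact: hull_mem.
Qed.

(** A good point is hit [p ^ k] times and each gap has weight [p]. One [beta] pays for restricting
    the sum of [f] to good points, the other for [low] at numerators with bad cells. *)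
Lemma sum_gap_ge p : (0 < p)%N -> (p %| N)%N ->
  (p ^ k.+1)%:R * (D - 2 * beta%:R) <= \sum_(W <- dilate R A p) gap_at p W.
Proof.
move=> p0 pN; have N_pd : N = (p * (N %/ p))%N by rewrite mulnC divnK.
have h1 := sum_rounding_mean_ge A f N_gt0 N_pd f_ge0.
have h2 := sum_low_le f_ge0 f_le1 bad_card N_gt0 N_pd.
have h3 := sum_good_ge bad_card (h := f) (fun x _ => f_le1 x).
have h4 : p%:R * (\sum_(W <- dilate R A p) rounding_mean N f ((N %/ p)%N%:Z *: W) -
    \sum_(W <- dilate R A p) low A f (scaled R p W)) <= \sum_(W <- dilate R A p) gap_at p W.
  rewrite -sumrB mulr_sumr; apply: ler_sum => W _.
  by apply: ler_wpM2l => //; rewrite le_max lexx orbT.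
apply: le_trans h4; rewrite expnS natrM -mulrA; apply: ler_wpM2l => //.
have := ler_wpM2l (ler0n R (p ^ k)) h3; rewrite /D; lra.
Qed.

Lemma sum_gap_le p : (0 < p)%N -> (p %| N)%N ->
  \sum_(W <- dilate R A p) gap_at p W <= (p ^ k.+1)%:R * (D + 3 * beta%:R).
Proof.
move=> p0 pN; have N_pd : N = (p * (N %/ p))%N by rewrite mulnC divnK.
have h1 := sum_rounding_mean_le N_gt0 N_pd (fun x (_ : x \in A) => f_ge0 x).
have h2 := sum_low_ge A f_ge0 N_gt0 N_pd.
have h3 := sum_good_ge bad_card (h := fun x => low A f (to_real R x))
  (fun x xA => (andP (low01 xA)).2).
have h4 := bad_dilate_card bad_card N_gt0 N_pd.
set X := [fset W in _ | ~~ _]%fset in h4; set Y := [fset W in _ | _]%fset in h1.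
have ptE W : scaled R p W = scaled R N ((N %/ p)%N%:Z *: W) by rewrite (scaled_dilate _ N_gt0 N_pd).
have lowX : \sum_(W <- X) low A f (scaled R p W) <= (p ^ k * beta)%:R.
  apply: (@le_trans _ _ (1 *+ #|` X|)); last by rewrite ler_nat.
  apply: sum_le_card => W; rewrite inE => /andP[/(dilateP _ _ _ p0) hW _].
  exact: low_le1.
have gapX : \sum_(W <- X) gap_at p W <= p%:R * (p ^ k * beta)%:R.
  apply: (@le_trans _ _ (p%:R *+ #|` X|)).
    apply: sum_le_card => W; rewrite inE => /andP[/(dilateP _ _ _ p0) hW _].
    rewrite -[leRHS]mulr1; apply: ler_wpM2l => //; rewrite ge_max ler01 /=.
    have := low_ge0 f_ge0 hW; have := @rounding_mean_le1 R k N N_gt0 f ((N %/ p)%N%:Z *: W) f_le1; lra.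
  by rewrite -[leLHS]mulr_natr; apply: ler_wpM2l => //; rewrite ler_nat.
have gapY : \sum_(W <- Y) gap_at p W =
   p%:R * (\sum_(W <- Y) rounding_mean N f ((N %/ p)%N%:Z *: W) - \sum_(W <- Y) low A f (scaled R p W)).
  rewrite -sumrB mulr_sumr; apply: eq_big_seq => W; rewrite inE => /andP[_ gW].
  (* The truncation is inactive here: by convexity [low] is at most the mean of its values at the
     roundings, and these are at most the values of [f]. *)
  congr (_ * _); apply/max_idPr; rewrite subr_ge0 ptE.
  have [|_ h] := @hull_rounding R k N N_gt0 A f ((N %/ p)%N%:Z *: W).
    by move=> j jN; exact: good_cell_rounding.
  apply: le_trans h _; apply: ler_wpM2l; first by rewrite invr_ge0.
  by apply: ler_sum => j _; apply: low_le; exact: good_cell_rounding.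
rewrite (sum_fset_split _ (goodW A N (N %/ p))) -/X -/Y gapY.
rewrite (@sum_fset_split _ _ (dilate R A p) (goodW A N (N %/ p))) -/X -/Y in h2.
apply: (@le_trans _ _ (p%:R * ((p ^ k)%:R * (D + 3 * beta%:R)))).
  move: gapX; rewrite -subr_ge0 => gapX; rewrite -subr_ge0.
  have : 0 <= p%:R * ((p ^ k)%:R * (D + 3 * beta%:R) -
     (\sum_(W <- Y) rounding_mean N f ((N %/ p)%N%:Z *: W) - \sum_(W <- Y) low A f (scaled R p W))
     - (p ^ k * beta)%:R).
    apply: mulr_ge0 => //; rewrite subr_ge0.
    have := ler_wpM2l (ler0n R (p ^ k)) h3; rewrite natrM in lowX *.
    move: h1 h2 lowX => /=; rewrite /D.
    set a1 := \sum_(W <- Y) rounding_mean _ _ _; set a2 := \sum_(W <- Y) low _ _ _.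
    set a3 := \sum_(W <- X) _; set a4 := \sum_(x <- A) f _.
    set a5 := \sum_(x <- A) _; set a6 := \sum_(x <- good_set A) _.
    move: (p ^ k)%:R => Q; lra.
  lra.
by rewrite expnS natrM -mulrA.
Qed.

(* [M] is chosen so that [M ^ k * (k + 1) ^ (k + 1)] is at most half of
   [M ^ (k + 1)]. *)
Lemma stability_with_constants : (k.+1 < M)%N -> (M %| N)%N -> (k.+1 %| N)%N ->
  (2 * k.+1 ^ k.+1 <= M)%N ->
  D <= 7 * beta%:R + (chain_const k.+1 (M - k.+1))%:R * E.
Proof.
move=> kM MN kN M2.
have stM : (k.+1 + (M - k.+1) = M)%N by rewrite subnKC// ltnW.
set t := (M - k.+1)%N in stM *.
have M0 : (0 < M)%N by apply: leq_ltn_trans kM.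
have lo := sum_gap_ge M0 MN.
have up := sum_gap_le (ltn0Sn k) kN.
set S := \sum_(W <- dilate R A k.+1) _ in up.
have S0 : 0 <= S by apply: sumr_ge0 => W _; exact: gap_at_ge0.
have ch : \sum_(W <- dilate R A M) gap_at M W <= (M ^ k)%:R * S + (chain_const k.+1 t)%:R * E.
  rewrite -stM; apply: (@le_trans _ _ (\sum_(W <- dilate R A (k.+1 + t))
      (gap_at k.+1 (peel_iter A f t k.+1 W) + chain_cost k.+1 t W))).
    apply: ler_sum_seq => W /dilateP hW; apply: gap_chain => //; first by rewrite stM.
    exact: hW.
  rewrite big_split /=; apply: lerD; last by apply: sum_chain_cost; rewrite ?stM.
  rewrite stM; apply: (@le_trans _ _ ((t.+1 ^ k)%:R * S)); last first.
    apply: ler_wpM2r => //; rewrite ler_nat.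
    have tM : (t.+1 <= M)%N by lia.
    by elim: (k) => [|j ihj]; rewrite ?expn0// !expnS leq_mul.
  apply: (sum_fiber (h := peel_iter A f t k.+1)) => [W _|W|W _]; first exact: gap_at_ge0.
    move=> /(dilateP _ _ _ M0) hW; apply/dilateP => //.
    by rewrite -stM in hW; have [] := peel_iterP f (ltnSn k) hW.
  apply: (@peel_iter_fiber R k A f t k.+1 W) => // W'; rewrite inE => /andP[].
  by move=> /(dilateP _ _ _ M0) hW' /eqP; rewrite stM.
set C := (chain_const _ _)%:R * E in ch *.
have C0 : 0 <= C by rewrite mulr_ge0.
set Q : R := (M ^ k)%:R in ch.
have Q1 : 1 <= Q by rewrite ler1n expn_gt0 M0.
have e1 : 2 * (Q * (k.+1 ^ k.+1)%:R) <= (M ^ k.+1)%:R.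
  by rewrite /Q -!natrM ler_nat (expnS M) mulnCA [leqRHS]mulnC leq_mul2l M2 orbT.
set q : R := (k.+1 ^ k.+1)%:R in up e1.
have q1 : 1 <= q by rewrite ler1n expn_gt0.
have [D2|D2] := leP D (2 * beta%:R).
  have : 0 <= beta%:R :> R by []. 
  lra.
set P := Q * q in e1.
have P1 : 1 <= P by rewrite /P -[1]mul1r ler_pM.
(* Rearranged, this is [P * (D - 7 * beta) <= C], with [7 = 2 * 2 + 3]. The case split on [D2]
   provides the sign needed to multiply [e1] by [D - 2 * beta]. *)
have h1 : 2 * P * (D - 2 * beta%:R) <= P * (D + 3 * beta%:R) + C.
  have : 2 * P * (D - 2 * beta%:R) <= (M ^ k.+1)%:R * (D - 2 * beta%:R).
    by apply: ler_wpM2r => //; rewrite subr_ge0 ltW.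
  have : Q * S <= Q * (q * (D + 3 * beta%:R)) by apply: ler_wpM2l => //; lra.
  rewrite mulrA -/P; lra.
have [//|D3] := leP D (7 * beta%:R + C).
have h2 : P * (D - 7 * beta%:R) <= C by lra.
have : 1 * (D - 7 * beta%:R) <= P * (D - 7 * beta%:R).
  by apply: ler_wpM2r => //; lra.
lra.
Qed.

End Core.

Lemma hull_stability (k : nat) : exists c1 c2 : nat, forall (R : realType)
  (A : {fset 'rV[int]_k}) (f : 'rV[int]_k -> R) (beta : nat),
  (forall x, 0 <= f x) -> (forall x, f x <= 1) ->
  (forall Y : {fset 'rV[int]_k}, {in Y, forall y, bad R A y} -> (#|` Y| <= beta)%N) ->
  \sum_(x <- A) f x - \sum_(x <- A) low A f (to_real R x) <=
    c1%:R * doubling_deficit A f + c2%:R * beta%:R.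
Proof.
(* The factorial makes [N] divisible by [M], by [k + 1], and by [p (p + 1)] for every [p < M], the
   latter because [(p + 1)!] divides it. *)
pose M := (2 * k.+1 ^ k.+1)%N; pose N := M`!.
have kM : (k.+1 < M)%N.
  rewrite /M expnS mulnCA -[ltnLHS]muln1 ltn_mul2l /=.
  by have := expn_gt0 k.+1 k; move: (k.+1 ^ k)%N => e; lia.
pose C := chain_const k N k.+1 (M - k.+1).
pose c1 := (C * ((1 + 8 * k) * (7 ^ k * 7 ^ k)))%N.
exists c1, (7 + (c1 * 2 ^ k.+1 + C * 2))%N => R A f beta f0 f1 bc.
have N0 : (0 < N)%N by exact: fact_gt0.
have Nd p : (0 < p < M)%N -> (p.+1 * p %| N)%N.
  case: p => // p /andP[_ pM]; apply: (@dvdn_trans p.+2`!); last first.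
    by rewrite /N -(bin_fact pM) mulnCA dvdn_mulr.
  by rewrite !factS mulnA dvdn_mulr.
have := stability_with_constants f0 f1 bc N0 Nd kM _ _ (leqnn _).
have MN : (M %| N)%N by apply: dvdn_fact; rewrite leqnn andbT (leq_ltn_trans _ kM).
have kN : (k.+1 %| N)%N by apply: dvdn_fact; apply/andP; split; last exact: ltnW kM.
move=> /(_ MN kN) /le_trans; apply.
have := sum_total_defect_le f0 f1 bc.
set U := \sum_(y <- _) _; set Dl := doubling_deficit _ _ => hU.
have := ler_wpM2l (ler0n R (C * (1 + 8 * k))) hU.
rewrite -/C /c1 !natrD !natrM natrX !natrX; move: (C%:R) => c; lra.
Qed.

(** * Counting integer points close to the boundary *)

Section Orthants.
Variables (R : realType) (k : nat) (K : 'rV[R]_k -> Prop).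
Hypothesis K_conv : forall (t : R) x y, 0 <= t <= 1 -> K x -> K y ->
  K (t *: x + (1 - t) *: y).

(* Eliminates one coordinate at a time by convex combination; it serves as a
   substitute for a separating hyperplane. *)
Lemma mem_of_orthants (c : 'rV[R]_k) :
  (forall b : 'I_k -> bool, exists2 x, K x & forall i, 0 <= (-1) ^+ b i * (x 0 i - c 0 i)) ->
  K c.
Proof.
move=> h.
have H (j : nat) : (j <= k)%N -> forall b : 'I_k -> bool, exists2 x, K x &
    forall i : 'I_k, if (i < j)%N then x 0 i = c 0 i else 0 <= (-1) ^+ b i * (x 0 i - c 0 i).
  elim: j => [|j ih] jk b; first exact: h.
  pose o := Ordinal jk.
  have sg (b' : bool) i : i != o -> (fun l => if l == o then b' else b l) i = b i.
    by move=> /negPf /= ->.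
  have [x Kx hx] := ih (ltnW jk) (fun l => if l == o then false else b l).
  have [y Ky hy] := ih (ltnW jk) (fun l => if l == o then true else b l).
  have := hx o; have := hy o; rewrite /= ltnn eqxx expr0 expr1 mul1r mulN1r oppr_ge0.
  rewrite subr_le0 subr_ge0 => yc cx.
  have [t t01 te] : exists2 t : R, 0 <= t <= 1 & t * x 0 o + (1 - t) * y 0 o = c 0 o.
    have [e|ne] := eqVneq (x 0 o) (y 0 o).
      exists 0; first by rewrite lexx ler01.
      by rewrite mul0r add0r subr0 mul1r; apply/eqP; rewrite eq_le yc -e cx.
    have xy : 0 < x 0 o - y 0 o by rewrite subr_gt0 lt_def ne (le_trans yc cx).
    exists ((c 0 o - y 0 o) / (x 0 o - y 0 o)).
      rewrite divr_ge0 ?subr_ge0 ?(ltW xy)//=; last by rewrite ltW// -subr_gt0.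
      by rewrite ler_pdivrMr// mul1r lerD2r.
    by field; rewrite gt_eqF.
  have /andP[t0 t1] := t01; have t1' : 0 <= 1 - t by rewrite subr_ge0.
  exists (t *: x + (1 - t) *: y); first exact: K_conv.
  move=> i; rewrite !mxE ltnS leq_eqVlt; have := hx i; have := hy i.
  have [->|io] := eqVneq i o; first by rewrite /= ltnn !eqxx /= te.
  have -> : (i == j :> nat) = false by apply: contra_neqF io => /eqP e; exact/val_inj.
  rewrite /=; case: ifP => _; first by move=> -> ->; rewrite -mulrDl addrC subrK mul1r.
  move=> h1 h2; have := mulr_ge0 t0 h2; have := mulr_ge0 t1' h1.
  by move: ((-1) ^+ b i) => s; lra.
have [x Kx hx] := H k (leqnn k) (fun=> false).
suff -> : c = x by [].
by apply/rowP => i; have := hx i; rewrite ltn_ord.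
Qed.
End Orthants.

Section BadCount.
Variables (R : realType) (k : nat) (A : {fset 'rV[int]_k}).
Hypothesis hullA : forall x, hull A (to_real R x) -> x \in A.
Variables (H : 'M[int]_k) (l0 : 'rV[int]_k) (D n0 : nat) (n : 'I_k -> nat).
Hypothesis H_le : forall i j, `|H i j| <= D%:Z.
(** In the application [y] is a coordinate vector with respect to a basis of the affine lattice,
    given by [H], and [ell y] consists of the progression coordinates of the same point. *)
Let ell (y : 'rV[int]_k) : 'rV[int]_k := l0 + y *m H.
Hypothesis ell_inj : injective ell.
Hypothesis ellA : forall a, a \in A -> forall i, 0 <= ell a 0 i < (n i)%:Z.
Hypothesis n0_gt0 : (0 < n0)%N.
Hypothesis n0_le : forall i, (n0 <= n i)%N.

Lemma hull_conv (t : R) (x y : 'rV[R]_k) : 0 <= t <= 1 -> hull A x -> hull A y ->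
  hull A (t *: x + (1 - t) *: y).
Proof.
move=> /andP[t0 t1] hx hy.
have [|||h _] := @hull_comb R k A (fun=> 0) 2 (fun j => if j == 0 then t else 1 - t)
   (fun j => if j == 0 then x else y).
- by move=> j; case: ifP => // _; rewrite subr_ge0.
- by rewrite !big_ord_recl big_ord0 /= addr0 addrC subrK.
- by move=> j; case: ifP.
by move: h; rewrite !big_ord_recl big_ord0 /= addr0.
Qed.

Lemma touches_ell y i : touches R A y ->
  - (3 * (k * D))%N%:Z <= ell y 0 i <= (n i + 3 * (k * D))%N%:Z.
Proof.
move=> [q [l [lge l1 lq]] qy].
pose L (x : 'rV[R]_k) : R := (l0 0 i)%:~R + \sum_j x 0 j * (H j i)%:~R.
have LE x : L (to_real R x) = (ell x 0 i)%:~R.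
  rewrite /L /ell !mxE intrD; congr (_ + _); rewrite rmorph_sum; apply: eq_bigr => j _.
  by rewrite mxE [RHS]rmorphM.
have Lq : 0 <= L q <= (n i)%:R.
  have -> : L q = \sum_a l a * L (vertex R a).
    rewrite /L; under [RHS]eq_bigr do rewrite mulrDr.
    rewrite big_split /= -mulr_suml l1 mul1r; congr (_ + _).
    under [RHS]eq_bigr do rewrite mulr_sumr.
    rewrite exchange_big; apply: eq_bigr => j _ /=.
    rewrite -lq summxE mulr_suml; apply: eq_bigr => a _.
    by rewrite mxE mulrA.
  apply/andP; split.
    apply: sumr_ge0 => a _; rewrite mulr_ge0// LE ler0z.
    by case/andP: (ellA (fsvalP a) i).
  rewrite -[leRHS]mul1r -[X in _ <= X * _]l1 mulr_suml; apply: ler_sum => a _.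
  apply: ler_wpM2l => //; rewrite LE pmulrn ler_int.
  by case/andP: (ellA (fsvalP a) i) => _ /ltW.
have d : `|L q - L (to_real R y)| <= (3 * (k * D))%:R.
  rewrite /L opprD addrACA subrr add0r -sumrB.
  apply: le_trans (ler_norm_sum _ _ _) _.
  apply: (@le_trans _ _ (\sum_(j < k) (3 * D)%:R)).
    apply: ler_sum => j _; rewrite -mulrBl normrM natrM ler_pM//.
      by have := qy j; rewrite mxE.
    by rewrite -intr_norm pmulrn ler_int.
  by rewrite sumr_const card_ord -[leLHS]mulr_natr -natrM ler_nat; lia.
rewrite -!(ler_int R) -LE; move: Lq d; rewrite ler_norml intrN.
rewrite -[_%N%:Z%:~R]/(_%N%:R) -[_%N%:Z%:~R]/(_%N%:R) natrD; lra.
Qed.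

(** The translates in [orthant_fiber] have [i]-th coordinate in an interval with
    [n i + 6 k D + 12 n0 k D + 1] integers, which is at most [K1 * n i] as [1 <= n0 <= n i]. *)
Let K1 := (18 * (k * D) + 2)%N.

(* The translates of [X] by the multiples of [6] of the sign vector are
   disjoint, since no hull point lies in the given orthant at [y + delta]. *)
Lemma orthant_fiber (delta : 'rV[int]_k) (b : 'I_k -> bool) (X : {fset 'rV[int]_k}) :
  (forall i, `|delta 0 i| <= 3) ->
  {in X, forall y, touches R A y /\
     forall x, hull A x -> ~ forall i, 0 <= (-1) ^+ b i * (x 0 i - to_real R (y + delta) 0 i)} ->
  (#|` X| * n0 <= K1 ^ k * \prod_i n i)%N.
Proof.
move=> d3 hX; pose sg : 'rV[int]_k := \row_i (-1) ^+ b i.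
(* The constant is [6 = 3 + 3]: a hull point within 3 of [y'], compared with [y + delta] where
   [delta] is at most 3, would lie in the forbidden orthant. *)
have sep y y' (t : int) : y \in X -> y' \in X -> y' = y + t *: sg -> 6 <= t -> False.
  move=> /hX[_ hy] /hX[[q hq qy] _] e t6; apply: (hy q hq) => i.
  have := qy i; rewrite e !mxE -[6]/(6%:Z) in t6 *.
  have t6' : 6 <= t%:~R :> R by rewrite -[6]/(6%:~R) ler_int.
  have : `|(delta 0 i)%:~R : R| <= 3 by rewrite -intr_norm -[3]/(3%:~R) ler_int.
  rewrite !ler_norml !intrD intrM rmorphXn /= rmorphN /=.
  by case: (b i); rewrite ?expr0 ?expr1; lra.
pose s := [seq ell (y + (6 * t)%N%:Z *: sg) | y <- X, t <- iota 0 n0].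
have us : uniq s.
  apply: allpairs_uniq; [exact: fset_uniq|exact: iota_uniq|].
  move=> [y t] [y' t'] /allpairsP[[u1 u2] /= [yX _ [-> ->]]].
  move=> /allpairsP[[u1' u2'] /= [yX' _ [-> ->]]] /= /ell_inj e.
  have e' : u1' = u1 + ((6 * u2)%N%:Z - (6 * u2')%N%:Z) *: sg.
    by rewrite scalerBl addrA e addrK.
  have e'' : u1 = u1' + ((6 * u2')%N%:Z - (6 * u2)%N%:Z) *: sg.
    by rewrite scalerBl addrA -e addrK.
  have [lt|lt|eqt] := ltngtP u2 u2'.
  - by case: (sep _ _ _ yX' yX e''); lia.
  - by case: (sep _ _ _ yX yX' e'); lia.
  - by move: e'; rewrite eqt subrr scale0r addr0 => ->.
have -> : (#|` X| * n0 = size s)%N by rewrite size_allpairs size_iota.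
have -> : (K1 ^ k * \prod_i n i = \prod_i (K1 * n i))%N.
  by rewrite big_split /= prod_nat_const card_ord.
pose lo : int := - (3 * (k * D) + 6 * (n0 * (k * D)))%N%:Z.
rewrite -(card_int_box (fun=> lo)); apply: uniq_leq_size => //.
move=> _ /allpairsP[[y t] /= [yX tn ->]]; apply/int_boxP => i.
move: tn; rewrite mem_iota add0n /= => tn.
have [ty _] := hX _ yX; have := touches_ell i ty.
have -> : ell (y + (6 * t)%N%:Z *: sg) 0 i = ell y 0 i + (6 * t)%N%:Z * (sg *m H) 0 i.
  by rewrite /ell mulmxDl -scalemxAl addrA [LHS]mxE [X in _ + X]mxE.
have : `|(sg *m H) 0 i| <= (k * D)%N%:Z.
  rewrite mxE; apply: le_trans (ler_norm_sum _ _ _) _.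
  apply: (@le_trans _ _ (\sum_(j < k) D%:Z)).
    apply: ler_sum => j _; rewrite mxE normrM normrX normrN1 expr1n mul1r.
    exact: H_le.
  by rewrite sumr_const card_ord -[leLHS]mulr_natr natz -PoszM lez_nat mulnC.
move: ((sg *m H) 0 i) (ell y 0 i) (n0_le i) n0_gt0 => u v.
rewrite /lo /K1; move: (k * D)%N (n i) => e m hm h0 hu hv.
have h1 : `|(6 * t)%N%:Z * u| <= (6 * (n0 * e))%N%:Z.
  rewrite normrM; apply: (@le_trans _ _ ((6 * n0)%N%:Z * e%:Z)); last by lia.
  by apply: ler_pM => //; lia.
move: h1; set w := _ * u => h1.
have h2 : (12 * (n0 * e) <= 12 * (m * e))%N by rewrite leq_mul2l leq_mul2r hm orbT.
have h3 : (e <= m * e)%N by rewrite leq_pmull// (leq_trans h0).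
have h4 : ((18 * e + 2) * m = 18 * (m * e) + 2 * m)%N by lia.
rewrite h4; move: (n0 * e)%N (m * e)%N h1 h2 h3 => a c h1 h2 h3; lia.
Qed.

(** A bad point has a neighbor outside [A], hence outside the hull, and by [mem_of_orthants] some
    orthant at this neighbor misses the hull. Displacement and orthant leave [7 * 2] choices per
    coordinate, and [orthant_fiber] bounds each class. *)
Lemma bad_card_le (Y : {fset 'rV[int]_k}) : {in Y, forall y, bad R A y} ->
  (#|` Y| * n0 <= 14 ^ k * (K1 ^ k * \prod_i n i))%N.
Proof.
move=> hY.
(* A digit [e_i] below 7 encodes the displacement [e_i - 3] and the sign [+];
   a digit from 7 on encodes [e_i - 10] and the sign [-]. *)
pose wit (y e : 'rV[int]_k) := forall x, hull A x ->
  ~ forall i, 0 <= (-1) ^+ (7 <= e 0 i)%R * (x 0 i -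
     to_real R (y + (\row_j (if 7 <= e 0 j then e 0 j - 10 else e 0 j - 3))) 0 i).
have ex y : y \in Y -> exists2 e, e \in int_box (fun _ : 'I_k => 0) (fun=> 14%N) & wit y e.
  move=> /hY[gy ty]; have [p py pA] : exists2 p, p \in neighborhood y & p \notin A.
    apply: contrapT => no; move/negP: gy; apply; apply/fsubsetP => p py.
    by apply: contraT => pA; case: no; exists p.
  have : ~ hull A (to_real R p) by move/hullA; apply/negP.
  move=> np; have [b hb] : exists b : 'I_k -> bool, forall x, hull A x ->
      ~ forall i, 0 <= (-1) ^+ b i * (x 0 i - to_real R p 0 i).
    apply: contrapT => no; apply: np; apply: (mem_of_orthants hull_conv) => b.
    apply: contrapT => no'; apply: no; exists b => x hx h; apply: no'.
    by exists x.
  move/neighborhoodP: py => py.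
  exists (\row_i (if b i then p 0 i - y 0 i + 10 else p 0 i - y 0 i + 3)).
    apply/int_boxP => i; rewrite mxE; have := py i.
    by move: (p 0 i) (y 0 i) => u v; case: (b i); lia.
  have eb i : (7 <= (\row_i (if b i then p 0 i - y 0 i + 10 else p 0 i - y 0 i + 3)) 0 i) = b i.
    rewrite mxE; have := py i.
    by move: (p 0 i) (y 0 i) => u v; case: (b i) => h; [apply/idP|apply/negbTE]; lia.
  move=> x hx h; apply: (hb x hx) => i; have := h i; rewrite eb.
  have -> // : y + (\row_j (if 7 <= (\row_i (if b i then p 0 i - y 0 i + 10
     else p 0 i - y 0 i + 3)) 0 j then (\row_i (if b i then p 0 i - y 0 i + 10
     else p 0 i - y 0 i + 3)) 0 j - 10 else (\row_i (if b i then p 0 i - y 0 i + 10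
     else p 0 i - y 0 i + 3)) 0 j - 3)) = p.
  by apply/rowP => j; rewrite [LHS]mxE [X in _ + X]mxE eb !mxE; move: (p 0 j) (y 0 j) => u v; case: (b j); lia.
have [h hh] : exists h : 'rV[int]_k -> 'rV[int]_k, {in Y, forall y,
    h y \in int_box (fun _ : 'I_k => 0) (fun=> 14%N) /\ wit y (h y)}.
  have : forall y, exists e, y \in Y -> e \in int_box (fun _ : 'I_k => 0) (fun=> 14%N) /\ wit y e.
    move=> y; have [yY|yY] := boolP (y \in Y); last by exists 0.
    by have [e e1 e2] := ex y yY; exists e.
  by move/choice => [h hh]; exists h => y; exact: hh.
pose B := ((K1 ^ k * \prod_i n i) %/ n0)%N.
have c14 : #|` int_box (fun _ : 'I_k => 0) (fun=> 14%N)| = (14 ^ k)%N.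
  by rewrite card_int_box prod_nat_const card_ord.
have : (#|` Y| <= B * 14 ^ k)%N.
  rewrite -c14; apply: (card_fiber_le (h := h)) => [y /hh[]//|e eb].
  rewrite leq_divRL//.
  apply: (orthant_fiber (b := fun i => 7 <= e 0 i)
    (delta := \row_j (if 7 <= e 0 j then e 0 j - 10 else e 0 j - 3))).
    move=> i; rewrite mxE; have /int_boxP/(_ i) := eb.
    by move: (e 0 i) => u; case: ifP; lia.
  move=> y; rewrite inE => /andP[yY /eqP he]; split; first by case: (hY _ yY).
  by have [_] := hh _ yY; rewrite he.
move=> h1; apply: (@leq_trans (B * 14 ^ k * n0)%N); first by rewrite leq_mul2r h1 orbT.
by rewrite mulnAC mulnC leq_mul2l leq_divM orbT.
Qed.
End BadCount.

(** * Change of coordinates *)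

(** A form of the Hermite normal form. The pivot of row [i] is the least positive [i]-th coordinate
    among the elements of [L] that vanish beyond [i]; the entries before it are reduced modulo [D],
    which is allowed as [L] contains all multiples of [D]. *)
Lemma triangular_basis (k D : nat) (L : 'rV[int]_k -> Prop) : (0 < D)%N -> L 0 ->
  (forall x y, L x -> L y -> L (x - y)) -> (forall i, L (D%:Z *: delta_mx 0 i)) ->
  exists H : 'M[int]_k, [/\ forall i j, `|H i j| <= D%:Z, forall y, L (y *m H),
    \det H != 0 & forall x, L x -> exists y, x = y *m H].
Proof.
move=> D0 L0 LB LD.
have LN x : L x -> L (- x) by move=> Lx; rewrite -sub0r; exact: LB.
have LA x y : L x -> L y -> L (x + y) by move=> Lx Ly; rewrite -[y]opprK; apply/LB => //; exact: LN.
have LZ (t : int) x : L x -> L (t *: x).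
  move=> Lx; have LM (n : nat) : L (n%:Z *: x).
    elim: n => [|n ih]; first by rewrite scale0r.
    by rewrite intS scalerDl scale1r; exact: LA.
  by case: t => n; [exact: LM|rewrite NegzE scaleNr; exact: LN].
have LS (c : 'I_k -> 'rV[int]_k) : (forall i, L (c i)) -> L (\sum_i c i).
  by move=> Lc; elim/big_ind: _ => // x y; exact: LA.
have LrowD (c : 'I_k -> int) : L (\row_j (c j * D%:Z)).
  rewrite [\row_j _]row_sum_delta; apply: LS => j.
  by rewrite mxE -scalerA; apply: LZ.
have piv (i : 'I_k) : exists r : 'rV[int]_k, [/\ L r, (forall j : 'I_k, (i < j)%N -> r 0 j = 0),
    0 < r 0 i, (forall j, `|r 0 j| <= D%:Z) &
    forall x, L x -> (forall j : 'I_k, (i < j)%N -> x 0 j = 0) -> exists q, x 0 i = q * r 0 i].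
  pose P (h : nat) := `[< (0 < h)%N /\ exists x : 'rV[int]_k,
    [/\ L x, forall j : 'I_k, (i < j)%N -> x 0 j = 0 & x 0 i = h%:Z] >].
  have exP : exists h, P h.
    exists D; apply/asboolP; split=> //; exists (D%:Z *: delta_mx 0 i); split=> //.
      move=> j ij; rewrite !mxE /=; case: eqP => [e|_]; last by rewrite mulr0.
      by move: ij; rewrite e ltnn.
    by rewrite !mxE !eqxx mulr1.
  have [h /asboolP[h0 [x [Lx x0 xh]]] hmin] := ex_minnP exP.
  have hD : (h <= D)%N.
    apply: hmin; apply/asboolP; split=> //; exists (D%:Z *: delta_mx 0 i); split=> //.
      move=> j ij; rewrite !mxE /=; case: eqP => [e|_]; last by rewrite mulr0.
      by move: ij; rewrite e ltnn.
    by rewrite !mxE !eqxx mulr1.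
  pose r : 'rV[int]_k := \row_j (if (j < i)%N then (x 0%R j %% D%:Z)%Z else x 0%R j).
  have ri : r 0 i = h%:Z by rewrite mxE ltnn.
  exists r; split.
  - have -> : r = x - \row_j ((if (j < i)%N then (x 0%R j %/ D%:Z)%Z else 0) * D%:Z).
      apply/rowP => j; rewrite !mxE; case: ifP => _; last by rewrite mul0r subr0.
      by rewrite {2}(divz_eq (x 0 j) D%:Z) addrC addKr.
    exact: LB.
  - by move=> j ij; rewrite mxE ltnNge (ltnW ij) /= x0.
  - by rewrite ri.
  - move=> j; rewrite mxE; case: ltngtP => [ji|ij|/val_inj ->].
    + have D0' : D%:Z != 0 by lia.
      by have := modz_ge0 (x 0 j) D0'; have := ltz_pmod (x 0 j) (_ : 0 < D%:Z); lia.
    + by rewrite x0// normr0.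
    + by rewrite xh; lia.
  move=> y Ly y0; exists (y 0%R i %/ h%:Z)%Z; rewrite ri.
  rewrite {1}(divz_eq (y 0 i) h%:Z) -[RHS]addr0; congr (_ + _).
  have h0' : h%:Z != 0 by lia.
  apply/eqP; apply: contraT => m0.
  have mp := modz_ge0 (y 0 i) h0'; have ml := ltz_pmod (y 0 i) (_ : 0 < h%:Z).
  have /hmin : P `|(y 0%R i %% h%:Z)%Z|%N.
    apply/asboolP; split; first by rewrite absz_gt0.
    exists (y - (y 0%R i %/ h%:Z)%Z *: x); split; first by apply/LB => //; exact: LZ.
      by move=> j ij; rewrite !mxE (y0 j ij) (x0 j ij) mulr0 subr0.
    rewrite !mxE xh gez0_abs//; apply/eqP; rewrite subr_eq addrC; apply/eqP.
  by have := ml; lia.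
have [H hH] := choice piv.
pose HM : 'M[int]_k := \matrix_i H i.
have rowH i : row i HM = H i by rewrite rowK.
have HE i j : HM i j = H i 0 j by rewrite mxE.
exists HM; split.
- by move=> i j; rewrite HE; have [] := hH i.
- by move=> y; rewrite mulmx_sum_row; apply: LS => i; rewrite rowH; apply: LZ; have [] := hH i.
- rewrite det_trig; last by apply/is_trig_mxP => i j ij; rewrite HE; have [_ h0 _ _ _] := hH i; exact: h0.
  by apply/prodf_neq0 => i _; rewrite HE; have [_ _ /lt0r_neq0] := hH i.
suff S (m : nat) : (m <= k)%N -> forall x, L x -> (forall j : 'I_k, (m <= j)%N -> x 0 j = 0) ->
    exists y, x = y *m HM.
  by move=> x Lx; apply: (S k (leqnn k) x Lx) => j; rewrite leqNgt ltn_ord.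
elim: m => [|m ih] mk x Lx x0.
  by exists 0; rewrite mul0mx; apply/rowP => j; rewrite mxE x0.
pose o := Ordinal mk.
have [Lo o0 op _ odiv] := hH o.
have [q xq] := odiv x Lx x0.
have [||y yE] := ih (ltnW mk) (x - q *: H o).
- by apply/LB => //; exact: LZ.
- move=> j; rewrite leq_eqVlt => /orP[/eqP mj|mj]; rewrite !mxE.
    by have -> : j = o by [apply/val_inj]; rewrite xq subrr.
  by rewrite x0// o0// mulr0 subr0.
exists (y + q *: delta_mx 0 o).
by rewrite mulmxDl -scalemxAl -rowE rowH -yE subrK.
Qed.

Section RealHull.
Variables (R : realType) (k : nat) (A : {fset 'rV[int]_k}).

Lemma convE (V : lmodType R) (t : {i01 R}) (x y : convex_lmodType V) :
  conv t x y = (t%:num *: (x : V) + (1 - t%:num) *: (y : V) : V).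
Proof. by []. Qed.

Lemma i01_bounds (t : {i01 R}) : 0 <= t%:num <= 1.
Proof. by rewrite ge0 le1. Qed.

(** Dividing by the total weight, instead of assuming it to be 1, lets the induction run over
    partial sums. *)
Lemma convex_mean (V : lmodType R) (C : set V) (I : Type) (r : seq I) (w : I -> R)
    (p : I -> V) : @convex_set R V C -> (forall i, 0 <= w i) -> (forall i, C (p i)) ->
  0 < \sum_(i <- r) w i -> C ((\sum_(i <- r) w i)^-1 *: \sum_(i <- r) w i *: p i).
Proof.
move=> cC w0 Cp; elim: r => [|i r ih]; first by rewrite big_nil ltxx.
rewrite !big_cons; set S := \sum_(j <- r) w j in ih *; set P := \sum_(j <- r) _ in ih *.
have S0 : 0 <= S by apply: sumr_ge0.
have [Sp|Sn] := ltP 0 S; last first.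
  have Sz : S = 0 by apply/eqP; rewrite eq_le Sn S0.
  have -> : P = 0.
    have := Sz; rewrite /S /P; elim: (r) => [|j r' ihr]; first by rewrite !big_nil.
    rewrite !big_cons => /eqP; rewrite paddr_eq0// ?sumr_ge0// => /andP[/eqP -> /eqP /ihr ->].
    by rewrite scale0r addr0.
  by rewrite Sz !addr0 => wi; rewrite scalerA mulVf ?scale1r ?gt_eqF.
move=> wS; have t0 : 0 <= w i / (w i + S) by rewrite divr_ge0// ltW.
have t1 : w i / (w i + S) <= 1 by rewrite ler_pdivrMr// mul1r lerDl.
have := cC (p i) (S^-1 *: P) (Itv01 t0 t1); rewrite !inE => /(_ (Cp i) (ih Sp)).
rewrite convE /=; congr (C _); rewrite scalerDr !scalerA mulrC; congr (_ + _ *: _).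
by field; rewrite !gt_eqF.
Qed.

Lemma real_hullP (q : 'rV[R]_k) : real_hull A q <-> hull A q.
Proof.
split=> [|[l [l0 l1 lq]]].
  move: q; apply: smallest_sub => [x y t|_ [a /= aA <-]]; last exact: hull_mem.
  rewrite !inE convE => hx hy; apply: hull_conv => //; exact: i01_bounds.
have := @convex_mean _ (real_hull A) A (index_enum A) l (fun a => vertex R a)
   (@convex_real_hull _ _ A) l0.
rewrite l1 invr1 scale1r lq; apply => // a.
exact: real_hull_sub (fsvalP a).
Qed.

(** [low] is itself a convex minorant, hence below the largest one. Replacing [fhat] by [low]
    therefore only enlarges the left side of the theorem. *)
Lemma lower_convex_hull_ge (f fhat h : 'rV[int]_k -> R) : lower_convex_hull A f fhat ->
  {in A, f =1 h} -> {in A, forall x, low A h (to_real R x) <= fhat x}.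
Proof.
move=> [g [_ gmax] gE] fh x xA; rewrite gE//; apply: gmax; last exact: real_hull_sub.
split=> [t y z|y yA]; last by rewrite fh//; exact: low_le.
rewrite !inE => /real_hullP hy /real_hullP hz; rewrite convRE convE.
have [|||_] := @hull_comb R k A h 2 (fun j => if j == 0 then t%:num else 1 - t%:num)
   (fun j => if j == 0 then y else z).
- by have /andP[t0 t1] := i01_bounds t; move=> j; case: ifP => // _; rewrite subr_ge0.
- by rewrite !big_ord_recl big_ord0 /= addr0 addrC subrK.
- by move=> j; case: ifP.
by rewrite !big_ord_recl !big_ord0 /= !addr0.
Qed.

(** With origin [a] the affine lattice becomes a subgroup: the difference of two coefficient systems
    has sum 0, and adding 1 at [a] restores the sum 1. *)
Lemma affine_latticeB (a x y : 'rV[int]_k) : affine_lattice A (a + x) ->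
  affine_lattice A (a + y) -> a \in A -> affine_lattice A (a + (x - y)).
Proof.
move=> [m m1 mE] [m' m1' mE'] aA.
exists (fun z => m z - m' z + (z == a)%:Z).
  rewrite big_split sumrB /= m1 m1' subrr add0r (big_rem a)//= eqxx.
  rewrite big1_seq ?addr0// => z; rewrite mem_rem_uniq ?fset_uniq// inE.
  by case/andP => _ /andP[/negPf ->].
under eq_bigr do rewrite scalerDl scalerBl.
rewrite big_split sumrB /= -mE -mE' (big_rem a)//= eqxx scale1r.
rewrite [X in _ = _ + (_ + X)]big1_seq ?addr0; last first.
  move=> z; rewrite mem_rem_uniq ?fset_uniq// inE.
  by case/andP => _ /andP[/negPf ->] _; rewrite scale0r.
by apply/rowP => i; rewrite !mxE; ring.
Qed.

Lemma affine_lattice_mem (a : 'rV[int]_k) : a \in A -> affine_lattice A a.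
Proof.
move=> aA; exists (fun z => (z == a)%:Z).
  rewrite (big_rem a)//= eqxx big1_seq ?addr0// => z; rewrite mem_rem_uniq ?fset_uniq// inE.
  by case/andP => _ /andP[/negPf ->].
rewrite (big_rem a)//= eqxx scale1r big1_seq ?addr0// => z; rewrite mem_rem_uniq ?fset_uniq// inE.
by case/andP => _ /andP[/negPf ->] _; rewrite scale0r.
Qed.

End RealHull.

Section Transport.
Variables (R : realType) (k : nat) (A2 : {fset 'rV[int]_k}).
Variables (T : 'M[int]_k) (a0 : 'rV[int]_k).
Let TR : 'M[R]_k := map_mx intr T.
Hypothesis TR_inj : forall q : 'rV[R]_k, q *m TR = 0 -> q = 0.
Definition affine_map (y : 'rV[int]_k) : 'rV[int]_k := a0 + y *m T.
Let psi := affine_map.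
Definition affine_image : {fset 'rV[int]_k} := [fset psi y | y in A2]%fset.
Let A := affine_image.

Lemma to_realM (y : 'rV[int]_k) : to_real R (y *m T) = to_real R y *m TR.
Proof. by rewrite /to_real map_mxM. Qed.

Lemma to_real_eq0 (y : 'rV[int]_k) : to_real R y = 0 -> y = 0.
Proof.
move=> /rowP e; apply/rowP => i; have := e i; rewrite !mxE => /eqP.
by rewrite intr_eq0 => /eqP.
Qed.

Lemma mulT_inj (x y : 'rV[int]_k) : x *m T = y *m T -> x = y.
Proof.
move=> e; apply/eqP; rewrite -subr_eq0; apply/eqP/to_real_eq0/TR_inj.
by rewrite -to_realM mulmxBl e subrr; apply/rowP => i; rewrite !mxE.
Qed.

Lemma affine_map_inj : injective psi.
Proof. by move=> x y /addrI /mulT_inj. Qed.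

Lemma affine_imageP x : reflect (exists2 y, y \in A2 & x = psi y) (x \in A).
Proof. by apply: (iffP idP) => [/imfsetP[y]|[y yA ->]]; [exists y|apply/imfsetP; exists y]. Qed.

Lemma mem_affine_image y : (psi y \in A) = (y \in A2).
Proof.
apply/affine_imageP/idP => [[z zA /affine_map_inj ->//]|yA]; by exists y.
Qed.

Lemma sum_affine_image (F : 'rV[int]_k -> R) :
  \sum_(x <- A) F x = \sum_(y <- A2) F (psi y).
Proof. by rewrite big_imfset//= => x y _ _; exact: affine_map_inj. Qed.

Let psiR (q : 'rV[R]_k) : 'rV[R]_k := to_real R a0 + q *m TR.

Lemma to_real_psi y : to_real R (psi y) = psiR (to_real R y).
Proof. by rewrite /psi /affine_map to_realD to_realM. Qed.

Lemma hull_affine_image y : hull A2 (to_real R y) -> real_hull A (to_real R (psi y)).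
Proof.
move=> [l [l0 l1 lq]].
have := @convex_mean R _ (real_hull A) A2 (index_enum A2) l (fun a => psiR (vertex R a))
   (@convex_real_hull _ _ A) l0.
rewrite l1 invr1 scale1r.
have -> : \sum_a l a *: psiR (vertex R a) = to_real R (psi y).
  rewrite to_real_psi -lq /psiR; under eq_bigr do rewrite scalerDr.
  rewrite big_split /= -scaler_suml l1 scale1r mulmx_suml; congr (_ + _).
  by apply: eq_bigr => a _; rewrite -scalemxAl.
apply => // a; rewrite -to_real_psi; apply: real_hull_sub.
by rewrite mem_affine_image; exact: fsvalP.
Qed.

Lemma low_affine_image (f : 'rV[int]_k -> R) y : y \in A2 ->
  low A2 (f \o psi) (to_real R y) <= low A f (to_real R (psi y)).
Proof.
move=> yA.
have hx : hull A (to_real R (psi y)) by apply: hull_mem; rewrite mem_affine_image.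
have [[[l0 l1 lq] _] _] := opt_repP (fun a : A => f (val a)) hx.
rewrite [leRHS]/low /opt_cost.
set l := opt_rep _ _ _ in l0 l1 lq *.
(* Extends the coefficients by 0 to all integer points, so that sums over the types [A] and [A2] can
   be exchanged along [psi]. *)
pose ext (x : 'rV[int]_k) : R := if insub x is Some a then l a else 0.
have extE (a : A) : ext (val a) = l a by rewrite /ext valK.
have ext0 x : 0 <= ext x by rewrite /ext; case: insub.
have tr (U : nmodType) (F : 'rV[int]_k -> U) : \sum_(a : A) F (val a) = \sum_(b : A2) F (psi (val b)).
  rewrite -(big_seq_fsetE _ A xpredT) big_imfset /=; last first.
    by move=> x z _ _; exact: affine_map_inj.
  by rewrite big_seq_fsetE.
pose l2 : {ffun A2 -> R} := [ffun b => ext (psi (val b))].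
have s1 : \sum_b l2 b = 1.
  under eq_bigr do rewrite ffunE.
  rewrite -(tr _ ext) -[RHS]l1; apply: eq_bigr => a _; exact: extE.
have rl2 : is_rep (vertex R (A:=A2)) (to_real R y) l2.
  split=> [b|//|]; first by rewrite ffunE.
  apply/eqP; rewrite -subr_eq0; apply/eqP/TR_inj; rewrite mulmxBl.
  apply/eqP; rewrite subr_eq0; apply/eqP.
  apply: (@addrI _ (to_real R a0)); rewrite -[RHS]/(psiR _) -to_real_psi -lq.
  have -> : \sum_a l a *: vertex R a = \sum_(a : A) ext (val a) *: to_real R (val a).
    by apply: eq_bigr => a _; rewrite extE.
  rewrite (tr _ (fun x => ext x *: to_real R x)).
  under [RHS]eq_bigr do rewrite to_real_psi /psiR scalerDr.
  rewrite big_split /= -scaler_suml; congr (_ + _).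
    rewrite -[LHS]scale1r -s1; congr (_ *: _).
    by apply: eq_bigr => b _; rewrite ffunE.
  rewrite mulmx_suml; apply: eq_bigr => b _.
  by rewrite ffunE scalemxAl.
apply: le_trans (opt_cost_min (fun b : A2 => (f \o psi) (val b)) rl2) _.
under eq_bigr do rewrite ffunE.
rewrite -(tr _ (fun x => ext x * f x)) le_eqVlt; apply/predU1P; left.
by apply: eq_bigr => a _; rewrite extE.
Qed.

Lemma inf_conv_affine_image (f : 'rV[int]_k -> R) z : z \in sumset A2 ->
  inf_conv A f (a0 + psi z) = inf_conv A2 (f \o psi) z.
Proof.
have psiD x y : psi x + psi y = a0 + psi (x + y).
  by rewrite /psi /affine_map mulmxDl !addrA (addrAC a0).
move=> zA; apply/eqP; rewrite eq_le; apply/andP; split.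
  have [x [y [xA yA <- ->]]] := inf_conv_attained (f \o psi) zA.
  by rewrite -psiD; apply: inf_conv_le; rewrite mem_affine_image.
have zA' : a0 + psi z \in sumset A.
  have [x [y [xA yA ->]]] := sumsetP zA.
  by rewrite -psiD; apply: mem_sumset; rewrite mem_affine_image.
have [x' [y' [xA' yA' e ->]]] := inf_conv_attained f zA'.
have [x xA ex] := affine_imageP _ xA'; have [y yA ey] := affine_imageP _ yA'.
have -> : z = x + y.
  by apply/affine_map_inj/(@addrI _ a0); rewrite -[RHS]psiD -ex -ey e.
by rewrite ex ey; apply: (@inf_conv_le R k A2 (f \o psi)).
Qed.

Lemma deficit_affine_image (f : 'rV[int]_k -> R) :
  doubling_deficit A f = doubling_deficit A2 (f \o psi).
Proof.
rewrite /doubling_deficit sum_affine_image; congr (_ - _).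
have -> : sumset A = [fset (a0 + psi z)%R | z in sumset A2]%fset.
  apply/fsetP => x; apply/idP/imfsetP => [/sumsetP[x' [y' [/affine_imageP[u uA ->]]]]|[z /= zA ->]].
    move=> /affine_imageP[w wA ->] ->; exists (u + w); first exact: mem_sumset.
    by rewrite /psi /affine_map mulmxDl !addrA (addrAC a0).
  have [u [w [uA wA ->]]] := sumsetP zA.
  have -> : a0 + psi (u + w) = psi u + psi w.
    by rewrite /psi /affine_map mulmxDl !addrA (addrAC a0).
  by apply: mem_sumset; rewrite mem_affine_image.
rewrite big_imfset /=; last by move=> x y _ _ /addrI /affine_map_inj.
by apply: eq_big_seq => z zA; exact: inf_conv_affine_image.
Qed.

End Transport.

Section Progression.
Variables (R : realType) (k : nat) (n : 'I_k -> nat) (v : 'I_k -> 'rV[int]_k).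
Variable b : 'rV[int]_k.
Definition gen_mx : 'M[int]_k := \matrix_i v i.
Let coord (l : 'rV[int]_k) := b + l *m gen_mx.

Lemma coordE (l : 'rV[int]_k) : coord l = b + \sum_i l 0 i *: v i.
Proof.
rewrite /coord mulmx_sum_row; congr (_ + _).
by apply: eq_bigr => i _; rewrite rowK.
Qed.

Lemma gapP x : x \in gap n v b <->
  exists2 l : 'rV[int]_k, x = b + l *m gen_mx & forall i, 0 <= l 0 i < (n i)%:Z.
Proof.
split=> [/imfsetP[l _ ->]|[l -> lb]].
  exists (\row_i (l i)%:Z).
    rewrite -[RHS]/(coord _) coordE; congr (_ + _).
    by apply: eq_bigr => i _; rewrite mxE.
  by move=> i; rewrite mxE /= ltz_nat ltn_ord.
have h i : (`|l 0%R i|%N < n i)%N by have := lb i; lia.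
apply/imfsetP; exists (@finfun _ (fun i => 'I_(n i)) (fun i => Ordinal (h i))) => //=.
rewrite -[LHS]/(coord _) coordE; congr (_ + _).
by apply: eq_bigr => i _; rewrite ffunE /= gez0_abs//; case/andP: (lb i).
Qed.

Lemma card_sumset_gap (A : {fset 'rV[int]_k}) : (A `<=` gap n v b)%fset ->
  (#|` sumset A| <= 2 ^ k * \prod_i n i)%N.
Proof.
move=> /fsubsetP Ag.
have -> : (2 ^ k * \prod_i n i = \prod_i (2 * n i))%N.
  by rewrite big_split /= prod_nat_const card_ord.
rewrite -(card_int_box (fun=> 0)).
pose Z := [fset (b + coord l)%R | l in int_box (fun _ : 'I_k => 0) (fun i => 2 * n i)%N]%fset.
apply: (@leq_trans #|` Z|); last exact: leq_imfset_card.
apply: fsubset_leq_card; apply/fsubsetP => z /sumsetP[x [y [/Ag /gapP[l -> lb] /Ag /gapP[l' -> lb'] ->]]].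
apply/imfsetP; exists (l + l').
  by apply/int_boxP => i; have := lb i; have := lb' i; rewrite !mxE; move: (l 0 i) (l' 0 i) (n i) => u w m; lia.
by rewrite /coord mulmxDl !addrA (addrAC b).
Qed.

Hypothesis v_free : free [seq to_real R (v i) | i : 'I_k].

Lemma gen_mx_inj (q : 'rV[R]_k) : q *m map_mx intr gen_mx = 0 -> q = 0.
Proof.
have fr : free (mktuple (fun i => to_real R (v i))).
  by move: v_free; congr (free _); rewrite /= /image_mem enumT; congr map; rewrite -enumT val_ord_tuple.
move=> e; apply/rowP => i; rewrite [RHS]mxE.
apply: (freeP fr (q 0)); rewrite -[RHS]e mulmx_sum_row; apply: eq_bigr => j _.
rewrite nth_mktuple; congr (_ *: _); apply/rowP => c; by rewrite !mxE.
Qed.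

Lemma gen_mul_inj (x y : 'rV[int]_k) : x *m gen_mx = y *m gen_mx -> x = y.
Proof. exact: (mulT_inj gen_mx_inj). Qed.

Lemma card_gap_ge : (\prod_i n i <= #|` gap n v b|)%N.
Proof.
rewrite -(card_int_box (fun=> 0)); apply: (card_inj_le (h := coord)).
  by move=> l /int_boxP lb; apply/gapP; exists l.
by move=> x y _ _ /addrI /gen_mul_inj.
Qed.

Section FullRank.
Variables (A : {fset 'rV[int]_k}) (eps : R) (mm : nat).
Hypothesis Agap : (A `<=` gap n v b)%fset.
Hypothesis dense : eps * #|` gap n v b|%:R <= #|` A|%:R.
Hypothesis eps0 : 0 < eps.
Hypothesis mm_gt : 2 / eps < mm%:R.
Hypothesis n_gt0 : forall i, (0 < n i)%N.

Lemma prod_le_card : eps * (\prod_i n i)%N%:R <= #|` A|%:R.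
Proof.
by apply: le_trans dense; rewrite ler_pM2l// ler_nat card_gap_ge.
Qed.

(* Otherwise the translates of [A] by [t v_i], [t < mm], would be disjoint. *)
Lemma close_points i : (mm <= n i)%N -> exists t : nat, [/\ (0 < t < mm)%N &
  exists2 x : 'rV[int]_k, x \in A & x + t%:Z *: v i \in A].
Proof.
move=> mi; apply: contrapT => no.
have sep x y (t : nat) : x \in A -> y \in A -> (0 < t < mm)%N -> y = x + t%:Z *: v i -> False.
  by move=> xA yA tm e; apply: no; exists t; split=> //; exists x; rewrite -?e.
have mvi (t : int) : t *: v i = (t *: delta_mx 0 i) *m gen_mx.
  by rewrite -scalemxAl -rowE rowK.
pose s := [seq x + t%:Z *: v i | x <- A, t <- iota 0 mm].
have us : uniq s.
  apply: allpairs_uniq; [exact: fset_uniq|exact: iota_uniq|].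
  move=> [x t] [y t'] /allpairsP[[x1 t1] /= [xA tm [-> ->]]].
  move=> /allpairsP[[y1 t1'] /= [yA tm' [-> ->]]] /= e.
  rewrite !mem_iota !add0n /= in tm tm'.
  have [lt|lt|eqt] := ltngtP t1 t1'.
  - case: (sep y1 x1 (t1' - t1)%N) => //; first by lia.
    by rewrite -subzn ?(ltnW lt)// scalerBl addrA -e addrK.
  - case: (sep x1 y1 (t1 - t1')%N) => //; first by lia.
    by rewrite -subzn ?(ltnW lt)// scalerBl addrA e addrK.
  - by move: e; rewrite eqt => /addIr ->.
(* Lengthening side [i] by [mm <= n i] at most doubles the box. Disjoint translates would give that
   [mm * #|A|] is at most twice the product of the [n j], hence at most [2 / eps * #|A|], against
   [mm_gt]. *)
pose L j := if j == i then (n i + mm)%N else n j.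
have sub : (size s <= \prod_j L j)%N.
  pose Z := [fset coord l | l in int_box (fun _ : 'I_k => 0) L]%fset.
  apply: (@leq_trans #|` Z|); last first.
    by rewrite -(card_int_box (fun=> 0)); exact: leq_imfset_card.
  apply: uniq_leq_size => // _ /allpairsP[[x t] /= [xA tm ->]].
  rewrite mem_iota add0n /= in tm.
  have /gapP[l -> lb] := fsubsetP Agap _ xA.
  apply/imfsetP; exists (l + t%:Z *: delta_mx 0 i) => /=.
    apply/int_boxP => j; rewrite !mxE eqxx /L /=; have := lb j.
    by case: eqP => [->|_] /=; lia.
  by rewrite /coord mulmxDl addrA mvi.
have pL : (\prod_j L j <= 2 * \prod_j n j)%N.
  rewrite (bigD1 i)//= [in leqRHS](bigD1 i)//= mulnA leq_mul//.
    by rewrite /L eqxx; lia.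
  by apply: leq_prod => j /negPf ji; rewrite /L ji.
have : (#|` A|%:R * mm%:R : R) <= 2 * (\prod_j n j)%N%:R.
  rewrite -!natrM ler_nat; apply: leq_trans pL; apply: leq_trans sub.
  by rewrite size_allpairs size_iota.
have P0 : (0 : R) < (\prod_j n j)%N%:R by rewrite ltr0n prodn_gt0.
have := prod_le_card; have m0 : (0 : R) < mm%:R by apply: lt_trans mm_gt; rewrite divr_gt0.
move: mm_gt; rewrite ltr_pdivrMr// => mg h1 h2.
have := ler_wpM2r (ltW m0) h1; have := mg; rewrite -(ltr_pM2r P0); lra.
Qed.
End FullRank.
End Progression.

(** By [close_points], for each [i] two points of [A] differ by [t v_i] with [0 < t < mm]. So the
    lattice contains every [mm! v_i], and [triangular_basis] applies with a bound that depends on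
    [eps] only through [mm]. *)
Lemma affine_lattice_sub_gap (R : realType) (k : nat) (A : {fset 'rV[int]_k}) (n : 'I_k -> nat)
    (v : 'I_k -> 'rV[int]_k) (b : 'rV[int]_k) (eps : R) (mm : nat) (a0 : 'rV[int]_k) :
  (A `<=` gap n v b)%fset -> free [seq to_real R (v i) | i : 'I_k] ->
  eps * #|` gap n v b|%:R <= #|` A|%:R -> 0 < eps -> 2 / eps < mm%:R ->
  (forall i, (0 < n i)%N) -> (forall i, (mm <= n i)%N) -> a0 \in A ->
  exists H : 'M[int]_k, [/\ forall i j, `|H i j| <= mm`!%:Z, \det H != 0,
    forall y, affine_lattice A (a0 + y *m H *m gen_mx v) &
    forall x, affine_lattice A (a0 + x *m gen_mx v) -> exists y, x = y *m H].
Proof.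
move=> Ag vf dn e0 me n0 mn aA.
pose L (x : 'rV[int]_k) := affine_lattice A (a0 + x *m gen_mx v).
have L0 : L 0 by rewrite /L mul0mx addr0; exact: affine_lattice_mem.
have LB x y : L x -> L y -> L (x - y).
  by rewrite /L mulmxBl => Lx Ly; exact: affine_latticeB.
have LM (c : nat) x : L x -> L (c%:Z *: x).
  move=> Lx; elim: c => [|c ih]; first by rewrite scale0r.
  rewrite intS scalerDl scale1r -[X in _ + X]opprK; apply/LB => //.
  by rewrite -sub0r; exact: LB.
have LD i : L (mm`!%:Z *: delta_mx 0 i).
  have [t [/andP[t0 tm] [x xA yA]]] := close_points vf Ag dn e0 me n0 (mn i).
  have /dvdnP[c ->] : (t %| mm`!)%N by apply: dvdn_fact; rewrite t0 ltnW.
  rewrite PoszM -scalerA; apply: LM.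
  have vE : t%:Z *: delta_mx 0 i *m gen_mx v = t%:Z *: v i.
    by rewrite -scalemxAl -rowE rowK.
  rewrite /L vE.
  have -> : a0 + t%:Z *: v i = a0 + ((x + t%:Z *: v i - a0) - (x - a0)).
    by apply/rowP => j; rewrite !mxE; ring.
  apply: affine_latticeB => //; rewrite addrC subrK; exact: affine_lattice_mem.
have [H [Hle HL Hdet Hx]] := triangular_basis (fact_gt0 mm) L0 LB LD.
by exists H; split.
Qed.

Lemma int_mx_inj (R : realType) (k : nat) (H : 'M[int]_k) (q : 'rV[R]_k) : \det H != 0 ->
  q *m map_mx intr H = 0 -> q = 0.
Proof.
move=> Hdet e.
have dR : \det (map_mx intr H : 'M[R]_k) != 0 by rewrite det_map_mx intr_eq0.
have := congr1 (fun x => x *m \adj (map_mx intr H)) e.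
rewrite -mulmxA mul_mx_adj mul0mx mul_mx_scalar => /eqP.
by rewrite scaler_eq0 (negPf dR) => /eqP.
Qed.

(** * Assembling the theorem: long and short progressions *)

(** [c1] precedes [eps] because [hull_stability] is applied in lattice coordinates, where its
    constants depend on [k] alone. The density enters [g] through the entries of the lattice basis
    and the ratio of the box to [A]. *)
Lemma stability_large (k : nat) :
  exists c1 : nat, forall (R : realType) (eps : R) (mm : nat), 0 < eps ->
  2 / eps < mm%:R -> exists2 g : R, 0 <= g &
  forall (A : {fset 'rV[int]_k}) (n : 'I_k -> nat) (v : 'I_k -> 'rV[int]_k)
    (b : 'rV[int]_k) (h : 'rV[int]_k -> R) (nm : nat),
  A != fset0 -> [set` A] = discrete_hull R A -> (A `<=` gap n v b)%fset ->
  free [seq to_real R (v i) | i : 'I_k] ->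
  eps * #|` gap n v b|%:R <= #|` A|%:R ->
  (forall x, 0 <= h x) -> (forall x, h x <= 1) ->
  (0 < nm)%N -> (forall i, (nm <= n i)%N) -> (mm <= nm)%N ->
  \sum_(x <- A) h x - \sum_(x <- A) low A h (to_real R x) <=
    c1%:R * doubling_deficit A h + g * nm%:R^-1 * #|` A|%:R.
Proof.
have [c1 [c2 stab]] := hull_stability k.
exists c1 => R eps mm e0 me.
pose K := (14 ^ k * (18 * (k * mm`!) + 2) ^ k)%N.
exists (c2%:R * (K%:R / eps)); first by rewrite mulr_ge0// divr_ge0// ltW.
move=> A n v b h nm /fset0Pn[a0 a0A] hullA Ag vf dn h0 h1 nm0 nmn mnm.
have n0 i : (0 < n i)%N by apply: leq_trans (nmn i).
have mn i : (mm <= n i)%N by apply: leq_trans (nmn i).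
have [H [Hle Hdet HL Hx]] := affine_lattice_sub_gap Ag vf dn e0 me n0 mn a0A.
have /gapP[l0 a0E l0b] := fsubsetP Ag _ a0A.
pose T := H *m gen_mx v.
have TR (q : 'rV[R]_k) : q *m map_mx intr T = 0 -> q = 0.
  by rewrite map_mxM mulmxA => /(gen_mx_inj vf); exact: int_mx_inj.
pose psi := affine_map T a0.
have psiE y : psi y = b + (l0 + y *m H) *m gen_mx v.
  by rewrite /psi /affine_map a0E -addrA mulmxDl mulmxA.
have exY x : exists y, x \in A -> x = psi y.
  have [xA|xA] := boolP (x \in A); last by exists 0.
  have /gapP[l xE lb] := fsubsetP Ag _ xA.
  have xE' : x = a0 + (l - l0) *m gen_mx v.
    by rewrite a0E xE mulmxBl -addrA (addrC (l0 *m _)) subrK.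
  have [|y yE] := Hx (l - l0); first by rewrite -xE'; exact: affine_lattice_mem.
  by exists y => _; rewrite xE' yE /psi /affine_map mulmxA.
have [Y hY] := choice exY.
pose A2 := [fset Y x | x in A]%fset.
have AE : A = affine_image A2 T a0.
  apply/fsetP => x; apply/idP/affine_imageP => [xA|[_ /imfsetP[y /= yA ->] ->]].
    by exists (Y x); [apply/imfsetP; exists x|exact: hY].
  by rewrite -[affine_map _ _ _]/(psi _) -hY.
have inA2 y : psi y \in A -> y \in A2 by rewrite AE (mem_affine_image _ _ TR).
have psiA y : y \in A2 -> psi y \in A by rewrite AE (mem_affine_image _ _ TR).
(* This is where [A] being its own discrete hull is used: in lattice coordinates every integer point
   of the hull belongs to the set. *)
have hull2 x : hull A2 (to_real R x) -> x \in A2.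
  move=> hx; apply: inA2.
  have : discrete_hull R A (psi x).
    split; first by rewrite AE; exact: (hull_affine_image TR).
    by rewrite /psi /affine_map mulmxA; exact: HL.
  by rewrite -hullA.
pose ell (y : 'rV[int]_k) : 'rV[int]_k := l0 + y *m H.
have ell_inj : injective ell.
  move=> x y e; apply: (affine_map_inj TR (a0 := a0)); rewrite -/psi !psiE.
  by rewrite -/(ell x) e.
have ellA a : a \in A2 -> forall i, 0 <= ell a 0 i < (n i)%:Z.
  move=> /psiA aA; have /gapP[l aE lb] := fsubsetP Ag _ aA.
  move: aE; rewrite psiE => /addrI /(gen_mul_inj vf) aE i.
  by rewrite /ell aE; exact: lb.
pose P := (\prod_i n i)%N.
pose beta := ((K * P) %/ nm)%N.
have bc Z : {in Z, forall y, bad R A2 y} -> (#|` Z| <= beta)%N.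
  move=> hZ; rewrite leq_divRL//.
  have := bad_card_le hull2 Hle ell_inj ellA nm0 nmn hZ.
  by rewrite /K /P mulnA.
have h0' y : 0 <= (h \o psi) y by exact: h0.
have h1' y : (h \o psi) y <= 1 by exact: h1.
have main := stab R A2 (h \o psi) beta h0' h1' bc.
have lowE : \sum_(x <- A2) low A2 (h \o psi) (to_real R x) <= \sum_(x <- A) low A h (to_real R x).
  rewrite [leRHS](_ : _ = \sum_(y <- A2) low A h (to_real R (psi y))).
    apply: ler_sum_seq => y yA; rewrite [in leRHS]AE.
    exact: (low_affine_image _ TR).
  by rewrite {1}AE (sum_affine_image _ _ TR).
have sumE : \sum_(x <- A) h x = \sum_(x <- A2) (h \o psi) x.
  by rewrite AE (sum_affine_image _ _ TR).
have defE : doubling_deficit A h = doubling_deficit A2 (h \o psi).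
  by rewrite {1}AE (deficit_affine_image _ _ TR).
rewrite sumE defE; apply: (@le_trans _ _ (\sum_(x <- A2) (h \o psi) x -
   \sum_(x <- A2) low A2 (h \o psi) (to_real R x))); first by rewrite lerD2l lerN2.
apply: le_trans main _; rewrite lerD2l -!mulrA; apply: ler_wpM2l => //.
have nmR : (0 : R) < nm%:R by rewrite ltr0n.
apply: (@le_trans _ _ ((K * P)%:R / nm%:R)).
  by rewrite ler_pdivlMr// -natrM ler_nat leq_divM.
rewrite natrM -!mulrA; apply: ler_wpM2l => //.
rewrite mulrC mulrCA; apply: ler_wpM2l; first by rewrite invr_ge0.
by rewrite ler_pdivlMl//; exact: (prod_le_card vf dn e0).
Qed.

Lemma inf_conv_congr (R : realType) (k : nat) (A : {fset 'rV[int]_k}) (f h : 'rV[int]_k -> R) z :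
  {in A, f =1 h} -> inf_conv A f z = inf_conv A h z.
Proof.
move=> fh; rewrite /inf_conv; congr minseq; apply/eq_in_map => -[x y].
rewrite mem_filter => /andP[_ /allpairsP[[x' y'] /= [xA yA [-> ->]]]].
by rewrite !fh.
Qed.

Theorem theorem1p7 (R : realType) (k : nat) (hk : (0 < k)%N) :
  exists c : R, forall eps0 : R, 0 < eps0 ->
  exists2 g : R, 0 < g &
  forall (A : {fset 'rV[int]_k}) (n : 'I_k -> nat) (v : 'I_k -> 'rV[int]_k)
    (b : 'rV[int]_k) (f fhat : 'rV[int]_k -> R),
  A != fset0%fset ->
  [set` A] = discrete_hull R A ->
  (A `<=` gap n v b)%fset ->
  free [seq to_real R (v i) | i : 'I_k] ->
  eps0 * #|` gap n v b|%:R <= #|` A|%:R ->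
  {in A, forall x, 0 <= f x <= 1} ->
  lower_convex_hull A f fhat ->
  \sum_(x <- A) (f x - fhat x) <=
    c * (2 ^+ k.+1 * \sum_(x <- A) f x - \sum_(z <- sumset A) inf_conv A f z)
    + g * (minseq 0%N [seq n i | i : 'I_k])%:R
            `^ (- (1 + 2^-1 * k%:R * (k.+1 %/ 2)%:R)^-1) * #|` A|%:R.
Proof.
have [c1 large] := stability_large k; exists c1%:R => eps e0.
pose mm := (Num.bound (2 / eps)).+1.
have me : 2 / eps < mm%:R.
  apply: lt_trans (archi_boundP _) _; first by rewrite divr_ge0// ltW.
  by rewrite ltr_nat.
have [g1 g10 {}large] := large R eps mm e0 me.
(* Chosen for the case [nm < mm]: the left side is at most [#|A|], and the deficit is at least
   [- 2 ^ (k + 1) / eps * #|A|] because [A + A] lies in a doubled progression. The factor [mm]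
   compensates [nm^-1]. *)
pose g2 : R := mm%:R * (1 + c1%:R * (2 ^+ k.+1 / eps)).
have g2_fact : 0 < 1 + c1%:R * (2 ^+ k.+1 / eps).
  by rewrite ltr_pwDl// mulr_ge0// divr_ge0 ?exprn_ge0// ltW.
have g20 : 0 < g2 by rewrite mulr_gt0 ?ltr0n.
exists (g1 + g2) => [|A n v b f fhat A0 hullA Ag vf dn f01 fhatP]; first by rewrite ltr_wpDl.
set nm := minseq 0%N _.
have [nm_in nm_le] : nm \in [seq n i | i : 'I_k] /\ (forall i, (nm <= n i)%N).
  (* Positivity of [k] rules out the dummy value of [minseq]. *)
  have s0 : [seq n i | i : 'I_k] != [::].
    by rewrite -size_eq0 size_map -cardE card_ord -lt0n.
  have [h1 h2] := minseqP 0%N s0; split=> // i.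
  by apply: (h2 (n i)); apply/mapP; exists i; rewrite ?mem_enum.
have n_gt0 i : (0 < n i)%N.
  have /fset0Pn[a aA] := A0.
  have /gapP[l _ /(_ i)] := fsubsetP Ag _ aA; lia.
have nm_gt0 : (0 < nm)%N by case/mapP: nm_in => i _ ->.
(* Cutting [f] off outside [A] makes its bounds hold everywhere, as the lemmas above assume. *)
pose h x := if x \in A then f x else 0.
have fh : {in A, f =1 h} by move=> x xA; rewrite /h xA.
have h0 x : 0 <= h x by rewrite /h; case: ifP => // /f01/andP[].
have h1 x : h x <= 1 by rewrite /h; case: ifP => // /f01/andP[].
set al : R := _^-1.
have nmR : (0 : R) < nm%:R by rewrite ltr0n.
(* The error obtained is of order [1 / nm]; as [al <= 1] and [nm >= 1], it is within the power of
   the statement. *)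
have pw : nm%:R^-1 <= nm%:R `^ (- al).
  rewrite -powR_inv1 ?(ltW nmR)//; apply: ler_powR; first by rewrite ler1n.
  by rewrite lerN2 invf_le1 ?lerDl ?ltr_pwDl// !mulr_ge0// invr_ge0.
have pw0 : 0 <= nm%:R `^ (- al) by exact: powR_ge0.
have sum_le : \sum_(x <- A) (f x - fhat x) <=
    \sum_(x <- A) h x - \sum_(x <- A) low A h (to_real R x).
  rewrite -sumrB; apply: ler_sum_seq => x xA.
  by rewrite fh// lerD2l lerN2; exact: (lower_convex_hull_ge fhatP fh).
have -> : 2 ^+ k.+1 * \sum_(x <- A) f x - \sum_(z <- sumset A) inf_conv A f z =
    doubling_deficit A h.
  rewrite /doubling_deficit; congr (_ * _ - _); first exact: eq_big_seq.
  by apply: eq_bigr => z _; exact: inf_conv_congr.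
apply: le_trans sum_le _.
have [mn|mn] := leqP mm nm.
  apply: le_trans (large A n v b h nm A0 hullA Ag vf dn h0 h1 nm_gt0 nm_le mn) _.
  rewrite lerD2l ler_wpM2r//.
  by apply: ler_pM; [|rewrite invr_ge0 ltW|rewrite lerDl ltW|exact: pw].
have cS : (#|` sumset A|%:R : R) <= 2 ^+ k * (#|` A|%:R / eps).
  apply: (@le_trans _ _ (2 ^ k * \prod_i n i)%N%:R).
    by rewrite ler_nat; exact: (card_sumset_gap Ag).
  rewrite natrM natrX; apply: ler_wpM2l; first by rewrite exprn_ge0.
  by rewrite ler_pdivlMr// mulrC; exact: (prod_le_card vf dn e0).
have def_ge : - (2 * (2 ^+ k * (#|` A|%:R / eps))) <= doubling_deficit A h.
  have sA : 0 <= \sum_(x <- A) h x by apply: sumr_ge0.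
  have sS : \sum_(z <- sumset A) inf_conv A h z <= 2 * #|` sumset A|%:R.
    rewrite mulr_natr; apply: sum_le_card => z; exact: inf_conv_le2.
  have : 0 <= 2 ^+ k.+1 * \sum_(x <- A) h x by rewrite mulr_ge0// exprn_ge0.
  rewrite /doubling_deficit; lra.
have hA : \sum_(x <- A) h x <= #|` A|%:R.
  by apply: le_trans (sum_le_card (c := 1) _) _ => // x _; exact: h1.
have lA : 0 <= \sum_(x <- A) low A h (to_real R x).
  by rewrite big_seq sumr_ge0// => x xA; apply: low_ge0 => //; exact: hull_mem.
have g2E : (1 + c1%:R * (2 ^+ k.+1 / eps)) * #|` A|%:R <= (g1 + g2) * nm%:R `^ (- al) * #|` A|%:R.
  rewrite ler_wpM2r//; apply: (@le_trans _ _ (g2 * nm%:R^-1)).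
    rewrite /g2 mulrAC ler_pMl//; first by rewrite ler_pdivlMr// mul1r ler_nat ltnW.
  by apply: ler_pM; [exact: ltW|rewrite invr_ge0 ltW|rewrite lerDr|exact: pw].
have := ler_wpM2l (ler0n R c1) def_ge.
move: g2E; rewrite exprS; lra.
Qed.
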